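(* Let $0<\alpha<1$ and let $\{B(t):t\in[0,1]\}$ be a fractional Brownian motion of Hurst index $\alpha$. Then \[ \mathbb P\left(\exists A\subset[0,1]:\ \overline{\dim}_{\mathcal M}A>\max\{1-\alpha,\alpha\}\text{ and }B|_A\text{ is non-decreasing}\right)=0. \]
   Context: A process $\{B(t):t\ge0\}$ is a fractional Brownian motion of Hurst index $\alpha\in(0,1)$ if $B$ is a Gaussian process with stationary increments, $B(0)=0$, $t^{-\alpha}B(t)$ is standard normal for every $t>0$, and almost surely $t\mapsto B(t)$ is continuous; its covariance is $\mathbb E(B(t)B(s))=\frac12(|t|^{2\alpha}+|s|^{2\alpha}-|t-s|^{2\alpha})$. Here it is restricted to $[0,1]$. $\overline{\dim}_{\mathcal M}$ is the upper Minkowski (upper box) dimension: for an integer $M\ge2$, $\overline{\dim}_{\mathcal M}A=\limsup_{n\to\infty}\frac{\log N_n(A,M)}{n\log M}$, where $N_n(A,M)$ is the number of intervals $[pM^{-n},(p+1)M^{-n})$, $p\in\{0,\dots,M^n-1\}$, that intersect $A$ (the value does not depend on $M$). *)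

(* Defs.v *)
From HB Require Import structures.
From mathcomp Require Export all_boot all_order all_algebra.
From mathcomp Require Export all_classical all_reals all_analysis.

Set Implicit Arguments.
Unset Strict Implicit.
Unset Printing Implicit Defensive.

Import Order.TTheory GRing.Theory Num.Theory.
Import numFieldNormedType.Exports.

Local Open Scope classical_set_scope.
Local Open Scope ring_scope.

Section fractional_brownian_motion.
Context {R : realType} {d : measure_display} {T : measurableType d}.
Variable P : probability T R.

(* The library's [normal_prob m 0] is the uniform law on [0, 1], not the point
   mass at [m]; the degenerate Gaussian is therefore a separate case. *)
Definition gaussian_rv (X : {RV P >-> R}) : Prop :=
  (exists m : R, forall U : set R, measurable U ->
     distribution P X U = \d_m U) \/
  (exists m s : R, 0 < s /\ forall U : set R, measurable U ->
     distribution P X U = normal_prob m s U).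

Definition standard_normal (X : {RV P >-> R}) : Prop :=
  forall U : set R, measurable U -> distribution P X U = normal_prob 0 1 U.

(* Processes are families of random variables; only the times in [I] matter. *)
Implicit Types (I : set R) (B : R -> {RV P >-> R}).

Definition gaussian_process I B : Prop :=
  forall (n : nat) (t : 'I_n -> R) (a : 'I_n -> R),
    (forall i, I (t i)) -> gaussian_rv (\sum_(i < n) a i *: B (t i)).

(* The processes t |-> B (h + t) - B h and t |-> B t - B 0 have the same
   finite-dimensional distributions, as long as all the times lie in [I]. *)
Definition stationary_increments I B : Prop :=
  forall (n : nat) (h : R) (t : 'I_n -> R),
    I h -> (forall i, I (t i)) -> (forall i, I (h + t i)) ->
    forall U : set (n.-tuple R), measurable U ->
      P [set w | U [tuple B (h + t i) w - B h w | i < n]] =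
      P [set w | U [tuple B (t i) w - B 0 w | i < n]].

Record fractional_brownian_motion (alpha : R) I B : Prop := {
  fbm_gaussian : gaussian_process I B ;
  fbm_stationary : stationary_increments I B ;
  fbm_zero : {ae P, forall w, B 0 w = 0} ;
  fbm_normal : forall t, I t -> 0 < t -> standard_normal (t `^ (- alpha) *: B t) ;
  fbm_continuous : {ae P, forall w, {within I, continuous (fun t => B t w)}}
}.

End fractional_brownian_motion.

Section upper_minkowski_dimension.
Context {R : realType}.
Implicit Types (A : set R) (M n : nat).

Definition mesh_count A M n : nat :=
  #|[pred p : 'I_(M ^ n) |
      `[< A `&` `[p%:R / M%:R ^+ n, p.+1%:R / M%:R ^+ n[ !=set0 >] ]|.

(* [lne] takes the value -oo at 0. The term n = 0 is a junk value. *)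
Definition upper_minkowski_dim M A : \bar R :=
  limn_esup (fun n =>
    lne (mesh_count A M n)%:R%:E / (n%:R * ln M%:R)%:E)%E.

End upper_minkowski_dimension.

(* Main.v *)
From mathcomp Require Import ring lra zify.
From mathcomp Require Import measurable_realfun.
Require Import Defs.

Set Implicit Arguments.
Unset Strict Implicit.
Unset Printing Implicit Defensive.

Import Order.TTheory GRing.Theory Num.Theory.
Import numFieldNormedType.Exports.

Local Open Scope classical_set_scope.
Local Open Scope ring_scope.

(** Let [A] be a set on which the path is nondecreasing and let [N n] be the number
    of [M]-adic intervals of level [n] that meet [A]. Such an interval gets two
    labels: the interval of level [n - q] that contains it, and the window of length
    [M ^ (- n * beta)], with [beta] slightly below [alpha], that contains the value
    of the path at a point of [A] in the interval. As the path is nondecreasing on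
    [A], both labels are nondecreasing along the line, so that only about [N (n - q) + M ^ (n * beta)] pairs of labels occur instead of
    the product of the two numbers ([card_monotone_pair]). Two intervals with the
    same labels are at most [M ^ q] mesh steps apart, and the path takes nearly the
    same value on both: the class of an interval is bounded by the number of close
    returns of the path within [M ^ q] steps. This number is about
    [M ^ (q * (1 - alpha))], up to a factor [M ^ (3 * eps * n)], simultaneously for
    all starting points of the mesh once [n] is large. Hence
    [N n <= (N (n - q) + C * M ^ (n * alpha)) * C * M ^ (q * (1 - alpha) + 3 * eps * n)]
    ([mesh_count_recursion]). Taking [q] to be a small proportion of [n] and
    iterating, the first summand produces the exponent [1 - alpha] and the second
    one the exponent [alpha] ([recursive_growth]). The argument is pathwise: the
    exceptional null event depends on neither [A] nor the monotone restriction.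

    Two almost sure properties of the path enter. The increments over one step of
    the mesh are at most [M ^ (- n * beta)] for [n] large, by Gaussian tails and
    Borel-Cantelli; chaining extends this to the oscillation inside mesh intervals
    ([oscillation_bound]). And no mesh point has too many close returns. For the
    latter a union bound over [M ^ n] starting points is needed, so moments of high
    order [k] are used: the binomial coefficient of the number of returns over [k]
    counts the increasing chains of [k] returns, and a chain with gaps [g_i] (in
    units of [1 / N], [N = M ^ n]) has probability at most the product of the
    [C * r * (N / g_i) ^ alpha]. Summing over the gaps bounds the [k]-th moment by
    the [k]-th power of the expected order of magnitude ([expected_close_chains]).

    The probability of a chain is a small-ball probability for increments
    [X_0, ..., X_(k-1)] from a common time ([fbm_small_ball]). It is bounded without
    densities or determinants: the indicator of [|x| <= r] is at most
    [2 * exp (- (x / r)^2 / 2)], which is the average of [2 * cos (y * x / r)] over a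
    standard normal [y]; therefore only the characteristic function of the vector is
    needed, and if the variance of [\sum a_i X_i] is at least a sum of squares of
    triangular linear forms in the [a_i], the averages over the [y] can be performed
    one coordinate at a time ([triangular_small_ball]). The triangular lower bound is
    the local nondeterminism of the process ([mvn_local_nondeterminism]). The
    variance of [\sum a_i X_i] is, up to a constant, the squared [L^2] norm of the
    same combination of Mandelbrot-Van Ness kernels, because both quadratic forms
    are determined by the variances of differences; and on the interval
    between two consecutive (reflected) times only the kernels of the later times
    are nonzero. *)

(** * The standard normal law *)

Section normal_integrals.
Import HBNNSimple.
Context {R : realType}.
Notation mu := (@lebesgue_measure R).
Local Notation pdf := (@normal_pdf R 0 1).

(** The density formula is the definition on indicators; it passes to simple
    functions by linearity and to the limit by monotone convergence. *)
Lemma ge0_integral_normal_prob (m s : R) (f : R -> \bar R) :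
  measurable_fun [set: R] f -> (forall x, 0 <= f x)%E ->
  (\int[normal_prob m s]_x f x = \int[mu]_x (f x * (normal_pdf m s x)%:E))%E.
Proof.
move=> mf f0.
have mpdf : measurable_fun [set: R] (fun x => (normal_pdf m s x)%:E).
  by apply/measurable_EFinP; exact: measurable_normal_pdf.
pose h := @nnsfun_approx _ (measurableTypeR R) R setT measurableT f mf.
transitivity (limn (fun n => \int[normal_prob m s]_x (h n x)%:E))%E.
  rewrite -monotone_convergence//; last 3 first.
  - by move=> n; apply/measurable_EFinP.
  - by move=> n x _; rewrite lee_fin.
  - by move=> x _ a b ab; rewrite lee_fin; exact/lefP/nd_nnsfun_approx.
  apply: eq_integral => x _; apply/esym/cvg_lim => //.
  exact: cvg_nnsfun_approx.
transitivity (limn (fun n => \int[mu]_x ((h n x)%:E * (normal_pdf m s x)%:E)))%E.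
  congr (limn _); apply/funext => n.
  rewrite integralT_nnsfun sintegralE.
  under [RHS]eq_integral => x _.
    rewrite fimfunE -fsumEFin// ge0_mule_fsuml; last first.
      move=> r; exact: nnfun_muleindic_ge0.
    over.
  rewrite ge0_integral_fsum//=; last 2 first.
  - move=> r; apply/emeasurable_funM => //.
    by apply/measurable_EFinP; apply: measurable_funM => //.
  - move=> r x _; apply: mule_ge0; first exact: nnfun_muleindic_ge0.
    by rewrite lee_fin normal_pdf_ge0.
  apply: eq_fsbigr => r _.
  have [r0|r0] := ltP r 0.
    rewrite preimage_nnfun0// measure0 mule0.
    by under eq_integral do rewrite indic0 mulr0 mul0e; rewrite integral0.
  under eq_integral do rewrite EFinM -muleA.
  rewrite ge0_integralZl//=; last 2 first.
  - by apply/emeasurable_funM => //; apply/measurable_EFinP.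
  - by move=> x _; rewrite mule_ge0// lee_fin normal_pdf_ge0.
  congr (_ * _)%E; rewrite /normal_prob integral_mkcond.
  apply: eq_integral => x _; rewrite patchE indicE.
  by case: ifPn; rewrite ?mul1e ?mul0e.
rewrite -monotone_convergence//; last 3 first.
- by move=> n; apply/emeasurable_funM => //; apply/measurable_EFinP.
- by move=> n x _; rewrite mule_ge0 ?lee_fin ?normal_pdf_ge0.
- move=> x _ a b ab; rewrite lee_wpmul2r ?lee_fin ?normal_pdf_ge0//.
  exact/lefP/nd_nnsfun_approx.
apply: eq_integral => x _; apply/cvg_lim => //.
apply: cvgeMr => //; exact: cvg_nnsfun_approx.
Qed.

End normal_integrals.

Section stein.
Context {R : realType}.
Notation mu := (@lebesgue_measure R).
Local Notation pdf := (@normal_pdf R 0 1).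

Lemma std_pdfE (x : R) : pdf x = normal_peak 1 * expR (- (x ^+ 2 / 2)).
Proof.
by rewrite normal_pdfE ?oner_neq0//= /normal_fun subr0 expr1n -mulr_natr mul1r mulNr.
Qed.

Lemma is_derive_std_pdf (x : R) : is_derive x (1 : R) pdf (- x * pdf x).
Proof.
have -> : pdf = (fun y => normal_peak 1 * expR (- (y ^+ 2 / 2))).
  by apply/funext => y; rewrite std_pdfE.
apply: is_derive_eq.
by rewrite /GRing.scale/=; field.
Qed.

(** Widening the Gaussian to variance 2 absorbs a quadratic factor, which makes
    every function of quadratic growth integrable. *)
Lemma sqr_pdf_le (x : R) :
  (1 + x ^+ 2) * pdf x <= 4 * normal_peak 1 * expR (- (x ^+ 2 / 4)).
Proof.
rewrite std_pdfE mulrCA [4 * _]mulrC -[leRHS]mulrA ler_wpM2l ?normal_peak_ge0//.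
have -> : - (x ^+ 2 / 2) = - (x ^+ 2 / 4) + - (x ^+ 2 / 4) by lra.
rewrite expRD mulrA ler_wpM2r ?expR_ge0//.
rewrite expRN ler_pdivrMr ?expR_gt0//.
have := expR_ge1Dx (x ^+ 2 / 4).
have := sqr_ge0 x; lra.
Qed.

Lemma integrable_exp_sqr :
  mu.-integrable [set: R] (fun x => (expR (- (x ^+ 2 / 4)))%:E).
Proof.
have s2 : (Num.sqrt 2 : R) != 0 by rewrite gt_eqF// sqrtr_gt0.
have := integrable_normal_pdf 0 (Num.sqrt (2:R)).
move/(integrableZl measurableT (normal_peak (Num.sqrt (2:R)))^-1).
apply: eq_integrable => //= x _.
rewrite -EFinM normal_pdfE//= mulKf ?gt_eqF ?normal_peak_gt0//.
by rewrite /normal_fun subr0 sqr_sqrtr// -mulr_natr mulNr; congr (expR (- (_ / _)))%:E; lra.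
Qed.

Lemma integrable_quadratic_pdf (h : R -> R) (a : R) :
  measurable_fun [set: R] h -> (forall x, `|h x| <= a * (1 + x ^+ 2)) ->
  mu.-integrable [set: R] (fun x => (h x * pdf x)%:E).
Proof.
move=> mh ha.
have a0 : 0 <= a.
  by have := ha 0; rewrite expr0n addr0 mulr1; apply: le_trans.
apply: (le_integrable measurableT _ _
  (integrableZl measurableT (a * (4 * normal_peak 1)) integrable_exp_sqr)) => //=.
  by apply/measurable_EFinP/measurable_funM => //; exact: measurable_normal_pdf.
move=> x _; rewrite lee_fin normrM (ger0_norm (normal_pdf_ge0 _ _ _)).
rewrite [leRHS]ger0_norm; last by rewrite !mulr_ge0 ?normal_peak_ge0 ?expR_ge0.
apply: (@le_trans _ _ (a * (1 + x ^+ 2) * pdf x)).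
  by rewrite ler_wpM2r ?normal_pdf_ge0.
by rewrite -mulrA -[leRHS]mulrA ler_wpM2l// sqr_pdf_le.
Qed.

(** Stein's identity: the difference of the two integrands is the derivative of
    [g * pdf], and the boundary terms vanish because [g] grows at most linearly. *)
Lemma stein_identity (g g' : R -> R) (a : R) :
  (forall x, is_derive x (1 : R) g (g' x)) -> continuous g' ->
  (forall x, `|g x| <= a * (1 + `|x|)) -> (forall x, `|g' x| <= a) ->
  \int[mu]_x (x * g x * pdf x) = \int[mu]_x (g' x * pdf x).
Proof.
move=> dg cg' ga g'a.
have a0 : 0 <= a by apply: le_trans (g'a 0).
have cg : continuous g.
  move=> x; apply: differentiable_continuous; apply/derivable1_diffP.
  exact: (@ex_derive _ _ _ _ _ _ _ (dg x)).
pose h x := (g' x - x * g x).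
have ch : continuous h.
  by move=> x; apply: cvgB; [exact: cg'|apply: cvgM; [exact: cvg_id|exact: cg]].
have mc (f : R -> R) : continuous f -> measurable_fun [set: R] f.
  exact: continuous_measurable_fun.
have x2 (x : R) : `|x| <= 1 + x ^+ 2.
  by have := sqr_ge0 (`|x| - 1); rewrite sqrrB1 real_normK ?num_real//; have := sqr_ge0 x; lra.
have g'b x : `|g' x| <= a * (1 + x ^+ 2).
  by apply: (le_trans (g'a x)); rewrite ler_peMr// lerDl sqr_ge0.
have xgb x : `|x * g x| <= 2 * a * (1 + x ^+ 2).
  rewrite normrM; apply: (@le_trans _ _ (`|x| * (a * (1 + `|x|)))).
    by rewrite ler_wpM2l.
  rewrite mulrCA -[leRHS]mulrA [leRHS]mulrCA ler_wpM2l//.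
  rewrite mulrDr mulr1 -expr2 real_normK ?num_real//.
  by have := x2 x; have := sqr_ge0 x; lra.
have ig' : mu.-integrable setT (fun x => (g' x * pdf x)%:E).
  by apply: integrable_quadratic_pdf g'b; exact: mc.
have ixg : mu.-integrable setT (fun x => (x * g x * pdf x)%:E).
  apply: integrable_quadratic_pdf xgb; apply: mc => x.
  by apply: cvgM; [exact: cvg_id|exact: cg].
have hb x : `|h x| <= (a + 2 * a) * (1 + x ^+ 2).
  by rewrite (le_trans (ler_normB _ _))// mulrDl lerD.
have ih : mu.-integrable setT (fun x => (h x * pdf x)%:E).
  by apply: integrable_quadratic_pdf hb; exact: mc.
suff h0 : (\int[mu]_x (h x * pdf x)%:E = 0)%E.
  apply/esym/eqP; rewrite -subr_eq0 -RintegralB//.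
  under eq_Rintegral do rewrite -mulrBl.
  by rewrite /Rintegral h0.
pose f_ n := ((fun x => (h x * pdf x)%:E) \_ (`[(- n.+1%:R), n.+1%:R] : set R)).
have cvgf : (\int[mu]_x f_ n x)%E @[n --> \oo] --> (\int[mu]_x (h x * pdf x)%:E)%E.
  apply: (@dominated_cvg _ _ _ mu setT measurableT f_ _ (fun x => `|(h x * pdf x)%:E|%E)).
  - move=> n; apply/(measurable_restrictT _ _).1 => //.
    by apply: measurable_funTS; have /measurable_int := ih.
  - move=> x _; apply: cvg_near_cst; near=> n; rewrite /f_ patchE ifT// inE/= in_itv/=.
    rewrite -ler_norml; apply: (@le_trans _ _ n%:R); last by rewrite ler_nat.
    by near: n; exact: nbhs_infty_ger.
  - by [].
  - exact: (integrable_abse ih).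
  - move=> n x _; rewrite /f_ patchE; case: ifPn => // _.
    by rewrite abse0 abse_ge0.
apply/(cvg_unique _ cvgf) => //=; apply/cvg_abse0P.
pose K := 2 * a * (4 * normal_peak 1 : R) * 2.
have Fb n : (`|\int[mu]_x f_ n x| <= (K * (expR 1 * expR (- n.+1%:R)))%:E)%E.
  pose F (x : R) := g x * pdf x.
  have dF (x : R) : is_derive x (1 : R) F (h x * pdf x).
    have dgx := dg x; have dpx := is_derive_std_pdf x.
    have -> : F = g * pdf by [].
    by apply: is_derive_eq; rewrite /GRing.scale/= /h; ring.
  rewrite /f_ -integral_mkcond (@continuous_FTC2 _ _ F); last 4 first.
  - by rewrite -subr_gt0 opprK addr_gt0.
  - apply: continuous_subspaceT => x.
    by apply: cvgM; [exact: ch|exact: continuous_normal_pdf].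
  - have cF : continuous F.
      move=> x; apply: differentiable_continuous; apply/derivable1_diffP.
      exact: (@ex_derive _ _ _ _ _ _ _ (dF x)).
    split; first by move=> x _; apply: (@ex_derive _ _ _ _ _ _ _ (dF x)).
    + exact/cvg_at_right_filter/cF.
    + exact/cvg_at_left_filter/cF.
  - by move=> x _; rewrite derive1E; exact: (@derive_val _ _ _ _ _ _ _ (dF x)).
  have Fx x : `|F x| <= 2 * a * (4 * normal_peak 1 * expR (- (x ^+ 2 / 4))).
    rewrite normrM (ger0_norm (normal_pdf_ge0 _ _ _)).
    apply: (@le_trans _ _ (2 * a * (1 + x ^+ 2) * pdf x)).
      rewrite ler_wpM2r ?normal_pdf_ge0//.
      apply: (le_trans (ga x)); rewrite -mulrA [leRHS]mulrCA ler_wpM2l//.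
      by have := x2 x; have := sqr_ge0 x; lra.
    by rewrite -mulrA ler_wpM2l ?mulr_ge0// sqr_pdf_le.
  rewrite -EFinB abse_EFin lee_fin (le_trans (ler_normB _ _))//.
  apply: (le_trans (lerD (Fx _) (Fx _))); rewrite sqrrN -mulr2n -mulr_natr.
  apply: (@le_trans _ _ (K * expR (- (n.+1%:R ^+ 2 / 4)))).
    by rewrite le_eqVlt; apply/orP; left; apply/eqP; rewrite /K; ring.
  rewrite ler_wpM2l ?mulr_ge0 ?normal_peak_ge0//.
  rewrite -expRD ler_expR.
  by have := sqr_ge0 (n.+1%:R / 2 - 1 : R); rewrite sqrrB1 exprMn; lra.
apply: (@squeeze_cvge _ _ _ _ (cst 0%E) _
   (fun n => (K * (expR 1 * expR (- n.+1%:R)))%:E)).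
- by apply: nearW => n /=; rewrite abse_ge0/= Fb.
- exact: cvg_cst.
- apply: cvg_EFin; first exact: nearW.
  rewrite -[X in _ --> X](mulr0 K); apply: cvgMl_tmp.
  rewrite -[X in _ --> X](mulr0 (expR 1)); apply: cvgMl_tmp.
  have := @cvgn_expR R; rewrite -(cvg_shiftS _).
  exact.
Unshelve. all: by end_near. Qed.

End stein.

Section standard_normal_moments.
Context {R : realType}.
Notation mu := (@lebesgue_measure R).
Local Notation pdf := (@normal_pdf R 0 1).

Lemma Rintegral_std_pdf : \int[mu]_x pdf x = 1.
Proof. by rewrite /Rintegral integral_normal_pdf. Qed.

Lemma std_second_moment : \int[mu]_x (x ^+ 2 * pdf x) = 1.
Proof.
under eq_Rintegral do rewrite expr2.
rewrite (@stein_identity _ id (cst 1) 1) //.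
- by under eq_Rintegral do rewrite mul1r; exact: Rintegral_std_pdf.
- by move=> x; exact: cst_continuous.
- by move=> x; rewrite mul1r lerDr.
- by move=> x; rewrite normr1.
Qed.

Lemma std_mean : \int[mu]_x (x * pdf x) = 0.
Proof.
have := @stein_identity R (cst 1) (cst 0) 1.
rewrite (@eq_Rintegral _ _ _ mu setT (fun x : R => x * pdf x)); last by move=> x _; rewrite mulr1.
move=> ->//.
- rewrite (@eq_Rintegral _ _ _ mu setT (cst 0)); last by move=> x _; rewrite mul0r.
  by rewrite /Rintegral integral0.
- by move=> x; exact: cst_continuous.
- by move=> x; rewrite normr1 mul1r lerDl.
- by move=> x; rewrite normr0.
Qed.

Lemma continuous_cosM (s : R) : continuous (fun x => cos (s * x)).
Proof.
move=> x; apply: (@continuous_comp _ _ _ (fun x : R => s * x) cos).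
  by apply: cvgM; [exact: cvg_cst|exact: cvg_id].
exact: continuous_cos.
Qed.

Lemma integrable_cos_pdf (s : R) :
  mu.-integrable [set: R] (fun x => (cos (s * x) * pdf x)%:E).
Proof.
apply: (@integrable_quadratic_pdf _ _ 1).
  apply: continuous_measurable_fun; exact: continuous_cosM.
move=> x; rewrite mul1r (@le_trans _ _ 1)//.
  by rewrite ler_norml cos_geN1 cos_le1.
by rewrite lerDl sqr_ge0.
Qed.

(** Differentiation under the integral, followed by Stein's identity for the sine,
    shows that the characteristic function [m] solves [m' = - s * m], so that
    [m s * exp (s^2 / 2)] is constant. *)
Lemma std_charf (s : R) : \int[mu]_x (cos (s * x) * pdf x) = expR (- (s ^+ 2 / 2)).
Proof.
pose m (t : R) := \int[mu]_x (cos (t * x) * pdf x).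
have dm (t : R) : is_derive t (1 : R) m (- t * m t).
  pose f (u x : R) : R := cos (u * x) * pdf x.
  have df (u x : R) : is_derive u (1 : R) (f ^~ x) (- (x * sin (u * x) * pdf x)).
    rewrite /f.
    apply: is_derive_eq; rewrite /GRing.scale/=.
    by ring.
  have df1 (u x : R) : partial1of2 f u x = - (x * sin (u * x) * pdf x).
    by rewrite /partial1of2 derive1E; exact: (@derive_val _ _ _ _ _ _ _ (df u x)).
  have iG : mu.-integrable setT (EFin \o (fun x => `|x| * pdf x)).
    apply: (@integrable_quadratic_pdf _ (fun x => `|x|) 1) => // x.
    rewrite normr_id mul1r.
    have := sqr_ge0 (`|x| - 1).
    by rewrite sqrrB1 real_normK ?num_real//; have := sqr_ge0 x; lra.
  have G0 (x : R) : 0 <= `|x| * pdf x by rewrite mulr_ge0 ?normal_pdf_ge0.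
  have It : (`]t - 1, t + 1[%classic : set R) t.
    by rewrite /= in_itv/=; apply/andP; split; lra.
  have intf (u : R) : (`]t - 1, t + 1[%classic : set R) u ->
      mu.-integrable setT (EFin \o f u).
    by move=> _; exact: integrable_cos_pdf.
  have derf (u x : R) : (`]t - 1, t + 1[%classic : set R) u -> setT x ->
      derivable (f ^~ x) u 1.
    by move=> _ _; exact: (@ex_derive _ _ _ _ _ _ _ (df u x)).
  have Gub (u x : R) : (`]t - 1, t + 1[%classic : set R) u -> setT x ->
      `|partial1of2 f u x| <= `|x| * pdf x.
    move=> _ _; rewrite df1 normrN !normrM (ger0_norm (normal_pdf_ge0 _ _ _)).
    rewrite ler_wpM2r ?normal_pdf_ge0// ler_piMr// ler_norml.
    by rewrite sin_geN1 sin_le1.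
  have dm := derivable_under_integral measurableT It intf derf G0 iG Gub.
  have dE := differentiation_under_integral measurableT It intf derf G0 iG Gub.
  apply: DeriveDef => //; rewrite -derive1E dE.
  under eq_Rintegral do rewrite df1.
  have isin : mu.-integrable setT (fun x => (x * sin (t * x) * pdf x)%:E).
    apply: (@integrable_quadratic_pdf _ _ 1).
      apply: measurable_funM => //; apply: continuous_measurable_fun => x.
      apply: (@continuous_comp _ _ _ (fun x : R => t * x) sin).
        by apply: cvgM; [exact: cvg_cst|exact: cvg_id].
      exact: continuous_sin.
    move=> x; rewrite normrM mul1r (@le_trans _ _ `|x|)//.
      by rewrite ler_piMr// ler_norml sin_geN1 sin_le1.
    have := sqr_ge0 (`|x| - 1).
    by rewrite sqrrB1 real_normK ?num_real//; have := sqr_ge0 x; lra.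
  under eq_Rintegral do rewrite -mulN1r.
  rewrite RintegralZl//.
  have dsin (x : R) : is_derive x (1 : R) (fun x => sin (t * x)) (t * cos (t * x)).
    by apply: is_derive_eq; rewrite /GRing.scale/=; ring.
  rewrite (stein_identity (a := `|t| + 1) dsin).
  - under eq_Rintegral do rewrite -mulrA.
    by rewrite RintegralZl//; [rewrite mulN1r mulNr | exact: integrable_cos_pdf].
  - by move=> x; apply: cvgM; [exact: cvg_cst|exact: continuous_cosM].
  - move=> x; apply: (@le_trans _ _ 1); first by rewrite ler_norml sin_geN1 sin_le1.
    by have := normr_ge0 t; have := normr_ge0 x; nra.
  - move=> x; rewrite normrM (@le_trans _ _ `|t|) ?lerDl//.
    by rewrite ler_piMr// ler_norml cos_geN1 cos_le1.
pose F := m * (fun t => expR (t ^+ 2 / 2)).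
have dF (t : R) : is_derive t (1 : R) F 0.
  have dmt := dm t.
  by apply: is_derive_eq; rewrite /GRing.scale/=; field.
have FE : m s * expR (s ^+ 2 / 2) = m 0 * expR (0 ^+ 2 / 2).
  by have : F s = F 0 by exact: is_derive_0_is_cst.
rewrite -[LHS]/(m s) expRN; apply: (mulIf (negbT (expR_eq0 (s ^+ 2 / 2)))).
rewrite mulVf ?expR_eq0//.
rewrite FE expr0n/= mul0r expR0 mulr1.
rewrite /m; under eq_Rintegral do rewrite mul0r cos0 mul1r.
exact: Rintegral_std_pdf.
Qed.
End standard_normal_moments.

(** * Small balls for triangular Gaussian families *)

Section smoothing.
Context {R : realType} {d : measure_display} {T : measurableType d}.
Variable P : probability T R.
Notation mu := (@lebesgue_measure R).
Local Notation pdf := (@normal_pdf R 0 1).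

Lemma bounded_RV_integrable (G : T -> R) (c : R) :
  measurable_fun setT G -> (forall x, `|G x| <= c) ->
  P.-integrable setT (EFin \o G).
Proof.
move=> mG Gc; apply: measurable_bounded_integrable => //.
  by apply: fin_num_fun_lty; exact: fin_num_measure.
by exists c; split; [exact: num_real|move=> M cM x _; rewrite /= (le_trans (Gc x))// ltW].
Qed.

Lemma integral_expR_sqr (c w : R) : 0 < w ->
  (\int[mu]_x (normal_peak 1 * expR (- ((c + w * x) ^+ 2 / 2)))%:E = (w^-1)%:E)%E.
Proof.
move=> w0; have wV0 : w^-1 != 0 by rewrite invr_eq0 gt_eqF.
have pE : normal_peak (1 : R) = w^-1 * normal_peak w^-1.
  rewrite /normal_peak expr1n mul1r -(mulrnAr (_ ^+ 2)) sqrtrM ?sqr_ge0//.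
  rewrite sqrtr_sqr gtr0_norm ?invr_gt0// invfM mulrA mulfV ?mul1r//.
under eq_integral => x _.
  have -> : normal_peak 1 * expR (- ((c + w * x) ^+ 2 / 2)) =
      w^-1 * normal_pdf (- (c / w)) w^-1 x.
    rewrite normal_pdfE// /normal_fun pE -mulrA; congr (_ * (_ * expR _)).
    by rewrite -mulr_natr; field; rewrite gt_eqF.
  rewrite EFinM; over.
by rewrite integralZl ?integral_normal_pdf ?mule1//; exact: integrable_normal_pdf.
Qed.

(** Since [exp (- X^2 / 2)] is the average of [cos (y * X)] over a standard normal
    [y], Fubini's theorem trades a Gaussian weight for characteristic functions. *)
Lemma gauss_smoothing (G X : T -> R) :
  measurable_fun setT G -> measurable_fun setT X -> (forall x, `|G x| <= 1) ->
  mu.-integrable setT (fun y => \int[P]_x (G x * cos (y * X x) * pdf y)%:E)%E /\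
  (\int[P]_x (G x * expR (- (X x ^+ 2 / 2)))%:E =
   \int[mu]_y (\int[P]_x (G x * cos (y * X x) * pdf y)%:E))%E.
Proof.
move=> mG mX G1.
pose f (z : measurableTypeR R * T) : \bar R :=
  (G z.2 * cos (z.1 * X z.2) * pdf z.1)%:E.
have mf : measurable_fun setT f.
  apply/measurable_EFinP; apply: measurable_funM.
    apply: measurable_funM; first exact: measurableT_comp.
    apply: (@measurableT_comp _ _ _ _ _ _ cos).
      apply: continuous_measurable_fun; exact: continuous_cos.
    apply: measurable_funM => //; exact: measurableT_comp.
  by apply: (@measurableT_comp _ _ _ _ _ _ pdf) => //; exact: measurable_normal_pdf.
have fb y x : (`|f (y, x)| <= (pdf y)%:E)%E.
  rewrite /f/= lee_fin !normrM (ger0_norm (normal_pdf_ge0 _ _ _)).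
  rewrite ler_piMl ?normal_pdf_ge0// mulr_ile1//.
  by rewrite ler_norml cos_geN1 cos_le1.
have mpdf : measurable_fun setT (fun y => (pdf y)%:E).
  by apply/measurable_EFinP; exact: measurable_normal_pdf.
have intf : (mu \x P)%E.-integrable setT f.
  apply/integrable12ltyP => //.
  apply: (@le_lt_trans _ _ (\int[mu]_y (pdf y)%:E)%E).
    apply: ge0_le_integral => //.
    - by move=> x _; apply: integral_ge0.
    - apply: (measurable_fun_fubini_tonelli_F (abse \o f)) => //=.
      exact: measurableT_comp.
    - move=> y _; apply: (@le_trans _ _ (\int[P]_x (pdf y)%:E)%E).
        apply: ge0_le_integral => //.
        by apply/measurableT_comp => //; exact: measurableT_comp.
      by rewrite integral_cst// [X in (_ * X)%E](@probability_setT _ _ _ P) mule1.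
  by rewrite integral_normal_pdf ltry.
split; first exact: integrable_fubini_F intf.
rewrite [RHS](Fubini intf); apply: eq_integral => x _.
rewrite /f/=.
under [RHS]eq_integral do rewrite -mulrA EFinM.
have icos : mu.-integrable setT (fun y => (cos (y * X x) * pdf y)%:E).
  have := integrable_cos_pdf (X x).
  by apply: eq_integrable => // y _; rewrite (mulrC y).
rewrite integralZl// EFinM; congr (_ * _)%E.
have := std_charf (X x); rewrite /Rintegral => <-.
rewrite fineK; last exact/integrable_fin_num/integrable_cos_pdf.
by apply: eq_integral => y _; rewrite (mulrC y).
Qed.

(** One coordinate is integrated out. The product [cos Y * cos (y * X)] is half the
    sum of the cosines of [Y + y * X] and [Y - y * X], both controlled by the
    hypothesis; and the integral in [y] of a Gaussian of slope [w] is a multiple of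
    [w^-1] that does not depend on its centre [c]. *)
Lemma smoothing_step (Y X F : T -> R) (K c w : R) :
  measurable_fun setT Y -> measurable_fun setT X -> measurable_fun setT F ->
  (forall x, `|F x| <= 1) -> 0 <= K -> 0 < w ->
  (forall y, \int[P]_x (cos (Y x + y * X x) * F x) <=
             K * expR (- ((c + w * y) ^+ 2 / 2))) ->
  \int[P]_x (cos (Y x) * F x * expR (- (X x ^+ 2 / 2))) <= K / w.
Proof.
move=> mY mX mF F1 K0 w0 H.
have mcos : measurable_fun setT (@cos R).
  by apply: continuous_measurable_fun; exact: continuous_cos.
have cosF1 y x : `|cos y * F x| <= 1.
  by rewrite normrM mulr_ile1// ler_norml cos_geN1 cos_le1.
have mYX y : measurable_fun setT (fun x => Y x + y * X x).
  by apply: measurable_funD => //; apply: measurable_funM.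
have mcF y : measurable_fun setT (fun x => cos (Y x + y * X x) * F x).
  by apply: measurable_funM => //; apply: measurableT_comp.
have iF y : P.-integrable setT (EFin \o (fun x => cos (Y x + y * X x) * F x)).
  by apply: (@bounded_RV_integrable _ 1).
pose h y := K * expR (- ((c + w * y) ^+ 2 / 2)).
have inner y : (\int[P]_x (cos (Y x) * F x * cos (y * X x) * pdf y)%:E <=
    (2^-1 * (h y + h (- y)) * pdf y)%:E)%E.
  have E x : cos (Y x) * F x * cos (y * X x) * pdf y = 
     2^-1 * pdf y * (cos (Y x + y * X x) * F x + cos (Y x + - y * X x) * F x).
    by rewrite mulNr cosB cosD; field.
  under eq_integral do rewrite E EFinM EFinD.
  have iD := integrableD measurableT (iF y) (iF (- y)).
  rewrite integralZl// integralD//.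
  rewrite -[X in (_ * (X + _))%E]fineK; last exact/integrable_fin_num/iF.
  rewrite -[X in (_ * (_ + X))%E]fineK; last exact/integrable_fin_num/iF.
  rewrite -EFinD -EFinM lee_fin mulrAC ler_wpM2r ?normal_pdf_ge0// ler_wpM2l//.
  by rewrite lerD// H.
  exact: iF.
  exact: iF.
have h0 y : 0 <= h y by rewrite mulr_ge0 ?expR_ge0.
have mE (a b : R) : measurable_fun setT (fun y : R => expR (- ((a + b * y) ^+ 2 / 2))).
  apply: continuous_measurable_fun => y.
  apply: (@continuous_comp _ _ _ (fun y : R => - ((a + b * y) ^+ 2 / 2)) expR); last exact: continuous_expR.
  apply: cvgN; apply: cvgM; last exact: cvg_cst.
  apply: (@continuous_comp _ _ _ (fun y : R => a + b * y) (fun x => x ^+ 2)).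
    by apply: cvgD; [exact: cvg_cst|apply: cvgM; [exact: cvg_cst|exact: cvg_id]].
  exact: exprn_continuous.
rewrite [leLHS]/Rintegral.
have mG : measurable_fun setT (fun x => cos (Y x) * F x).
  by apply: measurable_funM => //; apply: measurableT_comp.
have iL : P.-integrable setT (EFin \o (fun x => cos (Y x) * F x * expR (- (X x ^+ 2 / 2)))).
  apply: (@bounded_RV_integrable _ 1).
    apply: measurable_funM => //.
    have := mE 0 1; under eq_fun do rewrite add0r mul1r.
    by move=> /measurableT_comp; apply.
  move=> x; rewrite normrM mulr_ile1// ger0_norm ?expR_ge0//.
  by rewrite expR_le1 oppr_le0 divr_ge0 ?sqr_ge0.
rewrite -lee_fin fineK; last exact: integrable_fin_num.
have [iS ->] := gauss_smoothing mG mX (fun x => cosF1 _ _).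
pose e (a y : R) := normal_peak 1 * expR (- ((a + w * y) ^+ 2 / 2)).
have me a : measurable_fun setT (fun y => (e a y)%:E).
  by apply/measurable_EFinP/measurable_funM.
have e0 a y : (0 <= (e a y)%:E)%E by rewrite lee_fin mulr_ge0 ?normal_peak_ge0 ?expR_ge0.
have ie a : mu.-integrable setT (fun y => (e a y)%:E).
  apply/integrableP; split; first exact: me.
  under eq_integral do rewrite gee0_abs//.
  by rewrite integral_expR_sqr// ltry.
have iee := integrableD measurableT (ie c) (ie (- c)).
apply: (@le_trans _ _ (\int[mu]_y ((K / 2)%:E * ((e c y)%:E + (e (- c) y)%:E)))%E).
  apply: le_integral => //; first exact: (integrableZl measurableT _ iee).
  move=> y _; apply: (le_trans (inner y)).
  rewrite -EFinD -EFinM lee_fin /h /e.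
  have -> : (- c + w * y) ^+ 2 = (c + w * - y) ^+ 2 by ring.
  set E1 := expR (- ((c + w * y) ^+ 2 / 2)); set E2 := expR _.
  have -> : 2^-1 * (K * E1 + K * E2) * pdf y = K / 2 * (pdf y * (E1 + E2)) by field.
  rewrite -mulrDr ler_wpM2l ?divr_ge0// ler_wpM2r ?addr_ge0 ?expR_ge0//.
  exact: normal_pdf_ub.
rewrite integralZl// integralD// !integral_expR_sqr// -EFinD -EFinM lee_fin.
by rewrite le_eqVlt; apply/orP; left; apply/eqP; field; rewrite gt_eqF.
Qed.
End smoothing.

Section triangular.
Context {R : realType} {d : measure_display} {T : measurableType d}.
Variable P : probability T R.

Lemma measurable_expR_sqr (X : T -> R) : measurable_fun setT X ->
  measurable_fun setT (fun x => expR (- (X x ^+ 2 / 2))).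
Proof.
move=> mX; apply: measurableT_comp => //; apply: measurableT_comp => //.
by apply: measurable_funM => //; exact: measurable_funX.
Qed.

Lemma measurable_prod_ord k (p : pred 'I_k) (F : 'I_k -> T -> R) :
  (forall i, measurable_fun setT (F i)) ->
  measurable_fun setT (fun x => \prod_(i < k | p i) F i x).
Proof.
move=> mF; under eq_fun do rewrite -big_filter.
by apply: measurable_prod => i _; exact: mF.
Qed.

(** Induction on the number [l] of coordinates that carry a Gaussian weight, the
    others being present through a cosine only. Moving the coefficient [a l] by [y]
    moves the [l]-th linear form by [w l l * y] and, by triangularity, none of the
    later ones; smoothing then removes the [l]-th square and produces a factor
    [(w l l)^-1]. *)
Lemma triangular_gaussian_bound k (X : 'I_k -> T -> R) (w : 'I_k -> 'I_k -> R) :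
  (forall i, measurable_fun setT (X i)) ->
  (forall j, 0 < w j j) ->
  (forall i j : 'I_k, (i < j)%N -> w j i = 0) ->
  (forall a : 'I_k -> R, \int[P]_x cos (\sum_(i < k) a i * X i x) <=
     expR (- ((\sum_(j < k) (\sum_(i < k) w j i * a i) ^+ 2) / 2))) ->
  \int[P]_x (\prod_(i < k) expR (- (X i x ^+ 2 / 2))) <= \prod_(i < k) (w i i)^-1.
Proof.
move=> mX w0 wt Hcos.
suff H l : (l <= k)%N -> forall a : 'I_k -> R,
  \int[P]_x (cos (\sum_(i < k) a i * X i x) *
             \prod_(i < k | (i < l)%N) expR (- (X i x ^+ 2 / 2))) <=
  \prod_(i < k | (i < l)%N) (w i i)^-1 *
    expR (- ((\sum_(j < k | (l <= j)%N) (\sum_(i < k) w j i * a i) ^+ 2) / 2)).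
  have := H k (leqnn k) (fun=> 0).
  rewrite [X in _ <= _ * expR (- (X / 2))]big_pred0; last first.
    by move=> j; rewrite leqNgt ltn_ord.
  rewrite mul0r oppr0 expR0 mulr1 [leRHS](eq_bigl predT)//; last by move=> i; rewrite ltn_ord.
  under eq_Rintegral => x _.
    rewrite big1 ?cos0 ?mul1r; last by move=> i _; rewrite mul0r.
    rewrite (eq_bigl predT); last by move=> i; rewrite ltn_ord.
    over.
  exact.
elim: l => [_ a|l IH lk a].
  rewrite [X in _ <= X * _]big_pred0_eq mul1r.
  by under eq_Rintegral do rewrite big_pred0_eq mulr1; exact: Hcos.
pose L := Ordinal lk.
have ltS (i : 'I_k) : (i < l.+1)%N && (i != L) = (i < l)%N.
  by rewrite -val_eqE/= ltnS andbC -ltn_neqAle.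
have leS (i : 'I_k) : (l <= i)%N && (i != L) = (l < i)%N.
  by rewrite -val_eqE/= eq_sym andbC -ltn_neqAle.
pose F x := \prod_(i < k | (i < l)%N) expR (- (X i x ^+ 2 / 2)).
have mexp i : measurable_fun setT (fun x => expR (- (X i x ^+ 2 / 2))).
  exact: measurable_expR_sqr.
have mF : measurable_fun setT F by exact: measurable_prod_ord.
have F1 x : `|F x| <= 1.
  rewrite ger0_norm; last by apply: prodr_ge0 => i _; exact: expR_ge0.
  apply: Num.Theory.prodr_ile1 => i _; rewrite expR_ge0/=.
  by rewrite expR_le1 oppr_le0 divr_ge0 ?sqr_ge0.
have mY : measurable_fun setT (fun x => \sum_(i < k) a i * X i x).
  by apply: measurable_sum => i; exact: measurable_funM.
set C := \prod_(i < k | (i < l)%N) (w i i)^-1.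
pose S := \sum_(j < k | (l < j)%N) (\sum_(i < k) w j i * a i) ^+ 2.
have C0 : 0 <= C by apply: prodr_ge0 => i _; rewrite invr_ge0 ltW.
have key : \int[P]_x (cos (\sum_(i < k) a i * X i x) * F x *
    expR (- (X L x ^+ 2 / 2))) <= C * expR (- (S / 2)) / w L L.
  apply: (@smoothing_step _ _ _ _ _ _ _ _ (\sum_(i < k) w L i * a i)) => //.
    by rewrite mulr_ge0 ?expR_ge0.
  move=> y; pose b i := a i + (if i == L then y else 0).
  have bE x : \sum_(i < k) b i * X i x = \sum_(i < k) a i * X i x + y * X L x.
    under eq_bigr do rewrite mulrDl.
    rewrite big_split/=; congr (_ + _).
    rewrite (bigD1 L)//= eqxx big1 ?addr0// => i /negbTE ->.
    by rewrite mul0r.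
  have bw j : \sum_(i < k) w j i * b i = \sum_(i < k) w j i * a i + w j L * y.
    under eq_bigr do rewrite mulrDr.
    rewrite big_split/=; congr (_ + _).
    rewrite (bigD1 L)//= eqxx big1 ?addr0// => i /negbTE ->.
    by rewrite mulr0.
  under eq_Rintegral do rewrite -bE.
  apply: (le_trans (IH (ltnW lk) b)); rewrite -mulrA ler_wpM2l// -expRD ler_expR.
  rewrite (bigD1 L)//= bw le_eqVlt; apply/orP; left; apply/eqP.
  rewrite [X in _ + X](_ : _ = S); first by ring.
  apply: eq_big => [j|j]; first exact: leS.
  by rewrite leS => lj; rewrite bw wt// mul0r addr0.
have -> : \prod_(i < k | (i < l.+1)%N) (w i i)^-1 = C / w L L.
  rewrite (bigD1 L)//= mulrC; congr (_ * _).
  by apply: eq_bigl => i; exact: ltS.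
rewrite [leRHS]mulrAC.
apply: le_trans key; rewrite le_eqVlt; apply/orP; left; apply/eqP.
apply: eq_Rintegral => x _; rewrite -mulrA [X in _ * X = _](bigD1 L)//=; congr (_ * _).
by rewrite mulrC; congr (_ * _); apply: eq_bigl => i; exact: ltS.
Qed.

(** The indicator of [|x| <= r] is at most [2 * exp (- (x / r)^2 / 2)]. *)
Lemma triangular_small_ball k (X : 'I_k -> T -> R) (w : 'I_k -> 'I_k -> R) (r : R) :
  (forall i, measurable_fun setT (X i)) ->
  (forall j, 0 < w j j) ->
  (forall i j : 'I_k, (i < j)%N -> w j i = 0) ->
  (forall a : 'I_k -> R, \int[P]_x cos (\sum_(i < k) a i * X i x) <=
     expR (- ((\sum_(j < k) (\sum_(i < k) w j i * a i) ^+ 2) / 2))) ->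
  0 < r ->
  (P [set x | forall i, (`|X i x| <= r)%R] <= (\prod_(i < k) (2 * r / w i i))%:E)%E.
Proof.
move=> mX w0 wt Hcos r0.
have mXr i : measurable_fun setT (fun x => r^-1 * X i x) by exact: measurable_funM.
have := @triangular_gaussian_bound k (fun i x => r^-1 * X i x) (fun j i => r^-1 * w j i) mXr.
move=> /(_ _ _ _)H.
have {}H : \int[P]_x (\prod_(i < k) expR (- ((r^-1 * X i x) ^+ 2 / 2))) <=
    \prod_(i < k) (r^-1 * w i i)^-1.
  apply: H.
  - by move=> j; rewrite mulr_gt0 ?invr_gt0.
  - by move=> i j ij; rewrite wt// mulr0.
  - move=> a; have := Hcos (fun i => a i / r).
    under eq_Rintegral => x _ do under eq_bigr do rewrite -mulrA.
    move=> /le_trans; apply; rewrite le_eqVlt; apply/orP; left; apply/eqP.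
    congr (expR (- (_ / 2))); apply: eq_bigr => j _; congr (_ ^+ 2).
    by apply: eq_bigr => i _; ring.
set A := [set x | _].
have mA : measurable A.
  rewrite (_ : A = \bigcap_(i in [set: 'I_k]) (X i @^-1` [set y | `|y| <= r])); last first.
    by apply/seteqP; split => [x Ax i _|x Ax i] /=; [exact: Ax|exact: Ax].
  apply: fin_bigcap_measurable; first exact: finite_finset.
  move=> i _; rewrite -[X in measurable X]setTI; apply: mX => //.
  rewrite (_ : [set y | _] = `[- r, r]%classic)//.
  by apply/seteqP; split => y /=; rewrite in_itv/= ler_norml.
pose G x := \prod_(i < k) expR (- ((r^-1 * X i x) ^+ 2 / 2)).
have G0 x : 0 <= G x by apply: prodr_ge0 => i _; exact: expR_ge0.
have mG : measurable_fun setT G.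
  by apply: measurable_prod_ord => i; exact: measurable_expR_sqr.
have G1 x : `|G x| <= 1.
  rewrite ger0_norm//; apply: Num.Theory.prodr_ile1 => i _; rewrite expR_ge0/=.
  by rewrite expR_le1 oppr_le0 divr_ge0 ?sqr_ge0.
have iG := bounded_RV_integrable P mG G1.
have {}H : (\int[P]_x (G x)%:E <= (\prod_(i < k) (r^-1 * w i i)^-1)%:E)%E.
  rewrite -[leLHS]fineK; last exact: integrable_fin_num.
  by rewrite lee_fin.
have -> : \prod_(i < k) (2 * r / w i i) = 2 ^+ k * \prod_(i < k) (r^-1 * w i i)^-1.
  rewrite -[X in 2 ^+ X]card_ord -prodr_const -big_split/=.
  by apply: eq_bigr => i _; rewrite invfM invrK mulrA.
rewrite EFinM; apply: (@le_trans _ _ ((2 ^+ k)%:E * \int[P]_x (G x)%:E)%E); last first.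
  by rewrite lee_wpmul2l// lee_fin exprn_ge0.
rewrite -ge0_integralZl//; last 2 first.
- by apply/measurable_EFinP; exact: mG.
- by move=> x _; rewrite lee_fin G0.
rewrite -(setIT A) -integral_indic//; apply: ge0_le_integral => //.
- by apply/measurable_EFinP; exact: measurable_indic.
- by apply/measurable_EFinP; exact: measurable_funM.
move=> x _; rewrite -EFinM lee_fin indicE.
have [|_] := boolP (x \in A); last by rewrite mulr_ge0 ?exprn_ge0.
rewrite inE => Ax /=.
rewrite /G -[X in 2 ^+ X]card_ord -prodr_const -big_split/=.
apply: (@le_trans _ _ (\prod_(i < k) (1 : R))); first by rewrite big1_eq.
apply: ler_prod => i _; rewrite ler01/=.
have X1 : (r^-1 * X i x) ^+ 2 <= 1.
  rewrite -real_normK ?num_real// expr_le1// normrM gtr0_norm ?invr_gt0//.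
  by rewrite ler_pdivrMl// mulr1; exact: Ax.
have : 1 - 2^-1 <= expR (- ((r^-1 * X i x) ^+ 2 / 2)).
  apply: le_trans (expR_ge1Dx _); lra.
lra.
Qed.
End triangular.

(** * The Mandelbrot-Van Ness kernel *)

Section affine_change_of_variable.
Context {R : realType}.
Notation mu := (@lebesgue_measure R).

Definition affine (a b : R) (x : measurableTypeR R) : measurableTypeR R := a * x + b.

Lemma measurable_affine (a b : R) : measurable_fun setT (affine a b).
Proof.
by apply: measurable_funD => //; exact: measurable_funM.
Qed.

(** Lebesgue measure is characterised by its values on half-open intervals. *)
Lemma lebesgue_measure_affine (a b : R) (A : set R) : 0 < a -> measurable A ->
  (mu A = a%:E * pushforward mu (affine a b) A)%E.
Proof.
move=> a0 mA.
pose pf : {measure set (measurableTypeR R) -> \bar R} :=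
  measure_function_pushforward__canonical__measure_function_Measure
    mu (measurable_affine a b).
rewrite -[RHS]/(mscale (NngNum (ltW a0)) pf A).
apply: lebesgue_measure_unique => //= _ [[x y]] _ <-.
rewrite /mscale/= /pushforward.
have -> : affine a b @^-1` `]x, y] = `](x - b) / a, (y - b) / a]%classic.
  apply/seteqP; split => z /=; rewrite !in_itv/= /affine.
    by rewrite ltr_pdivrMr// ler_pdivlMr// ltrBlDr lerBrDr mulrC.
  by rewrite ltr_pdivrMr// ler_pdivlMr// ltrBlDr lerBrDr mulrC.
rewrite !lebesgue_measure_itv/= !lte_fin ltr_pM2r ?invr_gt0// ltrD2r.
case: ifPn => _; last by rewrite mule0.
by rewrite -!EFinB -EFinM; congr EFin; field; rewrite gt_eqF.
Qed.

Lemma ge0_integral_affine (a b : R) (f : R -> \bar R) : 0 < a ->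
  measurable_fun setT f -> (forall x, 0 <= f x)%E ->
  (\int[mu]_x f x = a%:E * \int[mu]_x f (a * x + b)%R)%E.
Proof.
move=> a0 mf f0.
pose pf : {measure set (measurableTypeR R) -> \bar R} :=
  measure_function_pushforward__canonical__measure_function_Measure
    mu (measurable_affine a b).
transitivity (a%:E * \int[pf]_x f x)%E; last first.
  congr (_ * _)%E; rewrite (ge0_integral_pushforward (measurable_affine a b))//.
rewrite -(ge0_integral_mscale pf measurableT (NngNum (ltW a0)))//.
by apply: eq_measure_integral => A mA _; exact: lebesgue_measure_affine.
Qed.
End affine_change_of_variable.

Section power_integrals.
Context {R : realType}.
Notation mu := (@lebesgue_measure R).

Lemma ge0_integral_bigcup_le (F : nat -> set (measurableTypeR R))
    (f : measurableTypeR R -> \bar R) (K : \bar R) :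
  (forall n, measurable (F n)) -> nondecreasing_seq F ->
  measurable_fun setT f -> (forall x, (0 <= f x)%E) ->
  (forall n, (\int[mu]_(x in F n) f x <= K)%E) ->
  (\int[mu]_(x in \bigcup_n F n) f x <= K)%E.
Proof.
move=> mF ndF mf f0 FK.
have /cvg_lim <- // : (\int[mu]_(x in F n) f x @[n --> \oo] -->
    \int[mu]_(x in \bigcup_n F n) f x)%E.
  apply: ge0_nondecreasing_set_cvg_integral => //.
  by move=> n; exact: measurable_funTS.
apply: lime_le; last by apply: nearW => n; exact: FK.
apply: ereal_nondecreasing_is_cvgn => m n mn.
apply: ge0_subset_integral => //.
  exact: (measurable_funS measurableT (@subsetT _ _) mf).
by apply/subsetPset; exact: ndF.
Qed.

Lemma integral_powR_itv (a b p : R) : 0 < a -> a < b -> p != -1 ->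
  (\int[mu]_(x in `[a, b]) (x `^ p)%:E = ((b `^ (p + 1) - a `^ (p + 1)) / (p + 1))%:E)%E.
Proof.
move=> a0 ab p1.
have p10 : p + 1 != 0 by rewrite addr_eq0.
pose F (x : R) := x `^ (p + 1) / (p + 1).
have dF (x : R) : 0 < x -> is_derive x (1 : R) F (x `^ p).
  move=> x0.
  have dd := is_derive1_powR (p + 1) x0.
  have -> : F = (fun y : R => y `^ (p + 1)) * cst (p + 1)^-1 by [].
  by apply: is_derive_eq; rewrite /GRing.scale/= /cst/= addrK; field.
have pc q x : 0 < x -> {for x, continuous (fun y : R => y `^ q)}.
  move=> x0; apply: differentiable_continuous; apply/derivable1_diffP.
  by apply: derivable_powR; rewrite in_itv/= x0.
rewrite (@continuous_FTC2 _ _ F)//; last 3 first.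
- apply: continuous_in_subspaceT => x; rewrite inE/= in_itv/= => /andP[ax _].
  by apply: pc; exact: lt_le_trans ax.
- have cF x : 0 < x -> {for x, continuous F}.
    move=> x0; apply: differentiable_continuous; apply/derivable1_diffP.
    exact: (@ex_derive _ _ _ _ _ _ _ (dF x x0)).
  split.
  + move=> x; rewrite in_itv/= => /andP[ax _].
    by apply: (@ex_derive _ _ _ _ _ _ _ (dF x _)); exact: lt_trans ax.
  + exact/cvg_at_right_filter/cF.
  + by apply/cvg_at_left_filter/cF; exact: lt_trans ab.
- move=> x; rewrite in_itv/= => /andP[ax _]; rewrite derive1E.
  by apply: (@derive_val _ _ _ _ _ _ _ (dF x _)); exact: lt_trans ax.
by rewrite -EFinB /F -mulrBl.
Qed.

Lemma measurable_powE (p : R) : measurable_fun setT (fun x : R => (x `^ p)%:E).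
Proof. by apply/measurable_EFinP; exact: measurable_powR. Qed.

Lemma integral_powR_near0 (p : R) : -1 < p ->
  (\int[mu]_(x in `]0%R, 1%R]) (x `^ p)%:E < +oo)%E.
Proof.
move=> p1; apply: (@le_lt_trans _ _ ((p + 1)^-1)%:E); last exact: ltry.
rewrite (_ : `]0, 1]%classic = \bigcup_n `[n.+2%:R^-1, (1:R)]%classic); last first.
  apply/seteqP; split => [x|x [n _]] /=; rewrite !in_itv/=.
    move=> /andP[x0 x1]; exists (Num.truncn x^-1) => //=.
    rewrite in_itv/= x1 andbT invf_ple// ?posrE//.
    have := truncnS_gt x^-1 => /ltW/le_trans; apply.
    by rewrite ler_nat.
  by move=> /andP[nx ->]; rewrite andbT (lt_le_trans _ nx).
apply: ge0_integral_bigcup_le => //.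
- move=> m n mn; apply/subsetPset => x /=; rewrite !in_itv/= => /andP[h ->].
  by rewrite andbT (le_trans _ h)// lef_pV2 ?posrE// ler_nat.
- exact: measurable_powE.
- by move=> x; rewrite lee_fin powR_ge0.
move=> n; rewrite integral_powR_itv//; last 2 first.
- by rewrite invf_lt1// ltr1n.
- by rewrite gt_eqF.
rewrite lee_fin ler_piMl//; first by rewrite invr_ge0 -lerBlDr sub0r ltW.
by rewrite powR1 gerBl powR_ge0.
Qed.

Lemma integral_powR_tail (p : R) : p < -1 ->
  (\int[mu]_(x in `[1%R, +oo[) (x `^ p)%:E < +oo)%E.
Proof.
move=> p1; apply: (@le_lt_trans _ _ (- (p + 1)^-1)%:E); last exact: ltry.
rewrite (_ : `[1, +oo[%classic = \bigcup_n `[(1:R), n.+2%:R]%classic); last first.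
  apply/seteqP; split => [x|x [n _]] /=; rewrite !in_itv/=.
    rewrite andbT => x1; exists (Num.truncn x) => //=.
    rewrite in_itv/= x1/=.
    have := truncnS_gt x => /ltW/le_trans; apply.
    by rewrite ler_nat.
  by move=> /andP[->].
apply: ge0_integral_bigcup_le => //.
- move=> m n mn; apply/subsetPset => x /=; rewrite !in_itv/= => /andP[-> h].
  by rewrite (le_trans h)// ler_nat.
- exact: measurable_powE.
- by move=> x; rewrite lee_fin powR_ge0.
move=> n; rewrite integral_powR_itv//; last 2 first.
- by rewrite ltr1n.
- by rewrite lt_eqF.
have p10 : p + 1 < 0 by lra.
by rewrite lee_fin powR1 mulrBl mul1r gerDr mulr_ge0_le0 ?powR_ge0// invr_le0 ltW.
Qed.

End power_integrals.

Section mandelbrot_van_ness.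
Context {R : realType}.
Notation mu := (@lebesgue_measure R).
Variable H : R.
Hypothesis H2 : -2^-1 < H < 2^-1.

(** With [H = alpha - 1 / 2], the Wiener integral of [mvn_kernel t - mvn_kernel 0]
    is a multiple of fractional Brownian motion at time [t]; the variable is the
    opposite of the usual time of the white noise. Only the [L^2] geometry of these
    kernels matters below, no stochastic integral is formed. *)
Definition mvn_kernel (t v : R) : R := if - t < v then (t + v) `^ H else 0.

Lemma measurable_mvn_kernel (t : R) : measurable_fun setT (mvn_kernel t).
Proof.
apply: measurable_fun_if => //.
  by apply: measurable_fun_ltr.
apply: measurable_funTS.
apply: (@measurableT_comp _ _ _ _ _ _ (@powR R ^~ H)) => //.
by apply: measurable_funD.
Qed.

Let sqr_powR (x : R) : 0 <= x -> (x `^ H) ^+ 2 = x `^ (2 * H).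
Proof. by move=> x0; rewrite mulrC powRrM powR_mulrn// powR_ge0. Qed.

(** As [-1 <= H <= 1], the power lies between [(1 + x)^-1] and [1 + x]. *)
Let pow1_le (x : R) : 0 <= x -> `|(1 + x) `^ H - 1| <= x.
Proof.
move=> x0; have x1 : 1 <= 1 + x by rewrite lerDl.
have x1_gt0 : 0 < 1 + x by rewrite (lt_le_trans _ x1).
have ub : (1 + x) `^ H <= 1 + x.
  by apply: ler1_powR => //; case/andP: H2 => _ ?; lra.
have lb : 1 - x <= (1 + x) `^ H.
  apply: (@le_trans _ _ ((1 + x) `^ (-1))).
    rewrite powR_inv1 ?(ltW x1_gt0)//.
    rewrite -[leLHS](mulfK (lt0r_neq0 x1_gt0)) ler_piMl ?invr_ge0 ?(ltW x1_gt0)//.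
    by rewrite -subr_sqr expr1n gerBl sqr_ge0.
  by apply: ler_powR => //; case/andP: H2 => ? _; lra.
by rewrite ler_norml; apply/andP; split; lra.
Qed.

(** The squared increment has singularities of order [2 * H > -1] at the two points
    where the kernels start, and decays like [v ^ (2 * H - 2)] at infinity, with
    [2 * H - 2 < -1]. The four terms cover these regions, and each of them is
    integrable. *)
Lemma mvn_increment_bound (v : R) :
  (mvn_kernel 1 v - mvn_kernel 0 v) ^+ 2 <=
    (1 + v) `^ (2 * H) * \1_(`]0, 1]) (1 + v)
    + (4 * \1_(`]0, 1]) v + 2 * (v `^ (2 * H) * \1_(`]0, 1]) v)
    + v `^ (2 * H - 2) * \1_(`[1, +oo[) v).
Proof.
have t1 : 0 <= (1 + v) `^ (2 * H) * \1_(`]0, 1]) (1 + v) by rewrite mulr_ge0 ?powR_ge0.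
have t2 : 0 <= 4 * \1_(`]0, 1]) v :> R by rewrite mulr_ge0.
have t3 : 0 <= 2 * (v `^ (2 * H) * \1_(`]0, 1]) v) by rewrite !mulr_ge0 ?powR_ge0.
have t4 : 0 <= v `^ (2 * H - 2) * \1_(`[1, +oo[) v by rewrite mulr_ge0 ?powR_ge0.
rewrite /mvn_kernel oppr0 add0r; case: ifPn => v1; last first.
  rewrite -leNgt in v1.
  by rewrite ifF; [rewrite subr0 expr0n/= !addr_ge0|apply/negbTE; rewrite -leNgt; lra].
have [v0|v0] := ltP 0 v; last first.
  rewrite subr0 sqr_powR; last lra.
  rewrite [X in _ <= X + _](_ : _ = (1 + v) `^ (2 * H)) ?lerDl ?addr_ge0//.
  by rewrite indicE mem_set ?mulr1//= in_itv/=; apply/andP; split; lra.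
have [v1'|v1'] := leP v 1.
  apply: (@le_trans _ _ (4 + 2 * v `^ (2 * H))); last first.
    rewrite (_ : \1_`]0, 1] v = 1 :> R); last by rewrite indicE mem_set//= in_itv/= v0.
    by rewrite !mulr1; lra.
  rewrite -sqr_powR ?(ltW v0)//.
  have : ((1 + v) `^ H) ^+ 2 <= 2.
    rewrite sqr_powR; last lra.
    apply: (@le_trans _ _ (1 + v)); last lra.
    by apply: ler1_powR; case/andP: H2 => ? ?; lra.
  move: ((1 + v) `^ H) (v `^ H) => a b h.
  by rewrite -subr_ge0 (_ : _ - _ = 2 * (2 - a ^+ 2) + (a + b) ^+ 2); [rewrite addr_ge0 ?sqr_ge0// mulr_ge0// subr_ge0|ring].
apply: (@le_trans _ _ (v `^ (2 * H - 2))); last first.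
  rewrite (_ : \1_`[1, +oo[ v = 1 :> R); last by rewrite indicE mem_set//= in_itv/= ltW.
  by rewrite !mulr1; lra.
have vE : (1 + v) `^ H - v `^ H = v `^ H * ((1 + v^-1) `^ H - 1).
  rewrite mulrBr mulr1 -powRM ?(ltW v0)//; last by rewrite addr_ge0// invr_ge0 ltW.
  by rewrite mulrDr mulr1 mulfV ?gt_eqF// (addrC v).
rewrite vE exprMn powRB; last by rewrite (gt_eqF v0) implybT.
rewrite -sqr_powR ?(ltW v0)// ler_wpM2l ?sqr_ge0//.
rewrite powR_mulrn ?(ltW v0)// -exprVn -real_normK ?num_real//.
have vV0 : 0 <= v^-1 by rewrite invr_ge0 ltW.
by rewrite ler_pXn2r ?nnegrE//; exact: pow1_le.
Qed.

Definition mvn_constant : \bar R :=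
  (\int[mu]_v ((mvn_kernel 1 v - mvn_kernel 0 v) ^+ 2)%:E)%E.

Lemma measurable_mvn_sqr (t s : R) :
  measurable_fun setT (fun v => ((mvn_kernel t v - mvn_kernel s v) ^+ 2)%:E).
Proof.
by apply/measurable_EFinP/measurable_funX/measurable_funB; exact: measurable_mvn_kernel.
Qed.

Lemma mvn_constant_lty : (mvn_constant < +oo)%E.
Proof.
have mI (i : interval R) : measurable_fun setT (fun v : R => \1_[set` i] v : R).
  by apply: measurable_indic; exact: measurable_itv.
have m2 p (i : interval R) : measurable_fun setT (fun v => (v `^ p * \1_[set` i] v)%:E).
  by apply/measurable_EFinP/measurable_funM => //; exact: measurable_powR.
have ind p (i : interval R) : (\int[mu]_v (v `^ p * \1_[set` i] v)%:E =
    \int[mu]_(v in [set` i]) (v `^ p)%:E)%E.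
  rewrite [RHS]integral_mkcond; apply: eq_integral => v _.
  by rewrite patchE indicE; case: ifPn; rewrite ?mulr1 ?mulr0.
have ge p (i : interval R) v : (0 <= (v `^ p * \1_[set` i] v)%:E)%E.
  by rewrite lee_fin mulr_ge0 ?powR_ge0.
pose A (v : R) : \bar R := ((1 + v) `^ (2 * H) * \1_(`]0, 1]) (1 + v))%:E.
pose B (v : R) : \bar R := (4 * \1_(`]0, 1]) v)%:E.
pose C (v : R) : \bar R := (2%:E * (v `^ (2 * H) * \1_(`]0, 1]) v)%:E)%E.
pose D (v : R) : \bar R := (v `^ (2 * H - 2) * \1_(`[1, +oo[) v)%:E.
have A0 v : (0 <= A v)%E by exact: ge.
have B0 v : (0 <= B v)%E by rewrite lee_fin mulr_ge0.
have C0 v : (0 <= C v)%E by rewrite mule_ge0// ge.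
have D0 v : (0 <= D v)%E by exact: ge.
have mA : measurable_fun setT A.
  apply: (@measurableT_comp _ _ _ _ _ _ (fun v => (v `^ (2 * H) * \1_(`]0, 1]) v)%:E)).
    exact: m2.
  by apply: measurable_funD.
have mB : measurable_fun setT B by apply/measurable_EFinP/measurable_funM.
have mC : measurable_fun setT C by apply: emeasurable_funM => //; exact: m2.
have mD : measurable_fun setT D by exact: m2.
have HH : -1 < 2 * H by case/andP: H2 => ? ?; lra.
have IA : (\int[mu]_v A v < +oo)%E.
  have := @ge0_integral_affine _ 1 1 (fun v => (v `^ (2 * H) * \1_(`]0, 1]) v)%:E).
  rewrite mul1e => /(_ ltr01 (m2 _ _) (ge _ _)); rewrite ind => IE.
  apply: le_lt_trans (integral_powR_near0 HH); rewrite IE le_eqVlt.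
  apply/orP; left; apply/eqP; apply: eq_integral => v _.
  by rewrite /A mul1r (addrC v).
have IB : (\int[mu]_v B v < +oo)%E.
  rewrite /B; under eq_integral do rewrite EFinM.
  rewrite ge0_integralZl//; last by apply/measurable_EFinP.
  rewrite integral_indic// setIT -[X in (_ * X)%E]/(lebesgue_measure _).
  rewrite lebesgue_measure_itv/= lte01.
  by rewrite -EFinB -EFinM ltry.
have IC : (\int[mu]_v C v < +oo)%E.
  rewrite /C ge0_integralZl//; last exact: m2.
  rewrite ind lte_mul_pinfty//; exact: integral_powR_near0.
have ID : (\int[mu]_v D v < +oo)%E.
  rewrite /D ind; apply: integral_powR_tail; case/andP: H2 => ? ?; lra.
apply: (@le_lt_trans _ _ (\int[mu]_v (A v + (B v + C v + D v)))%E).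
  apply: ge0_le_integral => //.
  - by move=> v _; rewrite lee_fin sqr_ge0.
  - exact: measurable_mvn_sqr.
  - by apply: emeasurable_funD => //; apply: emeasurable_funD => //; apply: emeasurable_funD.
  - move=> v _; rewrite /A /B /C /D -EFinM -!EFinD lee_fin.
    exact: mvn_increment_bound.
rewrite ge0_integralD//; last 2 first.
- by move=> v _; rewrite !adde_ge0.
- by apply: emeasurable_funD => //; apply: emeasurable_funD.
rewrite ge0_integralD//; last 2 first.
- by move=> v _; rewrite !adde_ge0.
- by apply: emeasurable_funD.
rewrite ge0_integralD//.
by do 3 (apply: lte_add_pinfty => //).
Qed.

Lemma mvn_constant_fin : mvn_constant \is a fin_num.
Proof.
rewrite ge0_fin_numE ?mvn_constant_lty//.
by apply: integral_ge0 => v _; rewrite lee_fin sqr_ge0.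
Qed.

(** The kernel is homogeneous of degree [H]: substitute [(t - s) * v - s] for [v]. *)
Lemma mvn_scaling (s t : R) : s < t ->
  (\int[mu]_v ((mvn_kernel t v - mvn_kernel s v) ^+ 2)%:E =
    ((t - s) `^ (2 * H + 1))%:E * mvn_constant)%E.
Proof.
move=> st; have r0 : 0 < t - s by rewrite subr_gt0.
rewrite (@ge0_integral_affine _ (t - s) (- s))//; last 2 first.
- exact: measurable_mvn_sqr.
- by move=> v; rewrite lee_fin sqr_ge0.
have E v : (mvn_kernel t ((t - s) * v - s) - mvn_kernel s ((t - s) * v - s)) =
    (t - s) `^ H * (mvn_kernel 1 v - mvn_kernel 0 v).
  rewrite /mvn_kernel oppr0 add0r mulrBr; congr (_ - _).
    have -> : (- t < (t - s) * v - s) = (- 1 < v).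
      have -> : (t - s) * v - s = (t - s) * (v + 1) - t by ring.
      by rewrite -[X in X < _]add0r ltrD2r pmulr_rgt0// -ltrBlDr sub0r.
    case: ifPn => v1; last by rewrite mulr0.
    rewrite -powRM ?(ltW r0)//; first by congr (_ `^ _); ring.
    lra.
  have -> : (- s < (t - s) * v - s) = (0 < v).
    by rewrite -[X in X < _]add0r ltrD2r pmulr_rgt0.
  case: ifPn => v1; last by rewrite mulr0.
  by rewrite -powRM ?(ltW r0)// ?(ltW v1)//; congr (_ `^ _); ring.
under eq_integral do rewrite E exprMn EFinM.
rewrite ge0_integralZl//; last 3 first.
- exact: measurable_mvn_sqr.
- by move=> v _; rewrite lee_fin sqr_ge0.
- by rewrite lee_fin sqr_ge0.
rewrite muleA -EFinM; congr (_%:E * _)%E.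
rewrite sqr_powR ?(ltW r0)// powRD; last by rewrite (gt_eqF r0) implybT.
by rewrite powRr1 ?(ltW r0)// mulrC.
Qed.

End mandelbrot_van_ness.

(** * Local nondeterminism *)

Section L2_quadratic_forms.
Context {R : realType} {d : measure_display} {T : measurableType d}.
Variable mu : {measure set T -> \bar R}.

Lemma Rintegral_fsum (I : Type) (s : seq I) (F : I -> T -> R) (D : set T) :
  measurable D -> (forall i, mu.-integrable D (EFin \o F i)) ->
  mu.-integrable D (EFin \o (fun x => \sum_(i <- s) F i x)) /\
  \int[mu]_(x in D) (\sum_(i <- s) F i x) = \sum_(i <- s) \int[mu]_(x in D) F i x.
Proof.
move=> mD iF; elim: s => [|i s [IH1 IH2]].
  split; last by rewrite big_nil; under eq_Rintegral do rewrite big_nil; rewrite /Rintegral integral0.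
  by have := integrable0 mu D; apply: eq_integrable => // x _; rewrite /= big_nil.
split.
  have := integrableD mD (iF i) IH1; apply: eq_integrable => // x _.
  by rewrite /= big_cons EFinD.
by under eq_Rintegral do rewrite big_cons; rewrite RintegralD// IH2 big_cons.
Qed.

Lemma integrable_sqrB (f g : T -> R) :
  measurable_fun setT f -> measurable_fun setT g ->
  mu.-integrable setT (EFin \o (fun x => f x ^+ 2)) ->
  mu.-integrable setT (EFin \o (fun x => g x ^+ 2)) ->
  mu.-integrable setT (EFin \o (fun x => (f x - g x) ^+ 2)).
Proof.
move=> mf mg if2 ig2.
have i2 := integrableZl measurableT 2 (integrableD measurableT if2 ig2).
apply: (le_integrable measurableT _ _ i2).
  by apply/measurable_EFinP/measurable_funX/measurable_funB.
move=> x _ /=; rewrite !lee_fin !ger0_norm ?sqr_ge0 ?mulr_ge0 ?addr_ge0 ?sqr_ge0//.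
by have := sqr_ge0 (f x + g x); nra.
Qed.

(** Polarisation. The point is that the form depends only on the norms of the
    [g i] and of their differences, so that two families for which these agree have
    the same quadratic form even if they live on different spaces. *)
Lemma L2_quadratic_form k (g : 'I_k -> T -> R) (a : 'I_k -> R) :
  (forall i, measurable_fun setT (g i)) ->
  (forall i, mu.-integrable setT (EFin \o (fun x => g i x ^+ 2))) ->
  mu.-integrable setT (EFin \o (fun x => (\sum_(i < k) a i * g i x) ^+ 2)) /\
  \int[mu]_x (\sum_(i < k) a i * g i x) ^+ 2 =
  \sum_(i < k) \sum_(j < k) a i * a j / 2 *
    (\int[mu]_x (g i x ^+ 2) + \int[mu]_x (g j x ^+ 2) -
     \int[mu]_x (g i x - g j x) ^+ 2).
Proof.
move=> mg ig.
pose q i j x := a i * a j / 2 * (g i x ^+ 2 + g j x ^+ 2 - (g i x - g j x) ^+ 2).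
have iB i j := integrable_sqrB (mg i) (mg j) (ig i) (ig j).
have iq0 i j : mu.-integrable setT
    (EFin \o (fun x => g i x ^+ 2 + g j x ^+ 2 - (g i x - g j x) ^+ 2)).
  exact: (integrableB measurableT (integrableD measurableT (ig i) (ig j)) (iB i j)).
have iq i j : mu.-integrable setT (EFin \o q i j).
  exact: (integrableZl measurableT _ (iq0 i j)).
have qE x : (\sum_(i < k) a i * g i x) ^+ 2 = \sum_(i < k) \sum_(j < k) q i j x.
  rewrite expr2 big_distrlr/=; apply: eq_bigr => i _; apply: eq_bigr => j _.
  by rewrite /q; field.
have [i1 E1] := @Rintegral_fsum _ (index_enum 'I_k) (fun i x => \sum_(j < k) q i j x) _ measurableT
  (fun i => (@Rintegral_fsum _ (index_enum 'I_k) (q i) _ measurableT (iq i)).1).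
split; first by move: i1; apply: eq_integrable => // x _; rewrite /= qE.
under eq_Rintegral do rewrite qE.
rewrite E1; apply: eq_bigr => i _.
rewrite (@Rintegral_fsum _ (index_enum 'I_k) (q i) _ measurableT (iq i)).2.
apply: eq_bigr => j _; rewrite RintegralZl//; congr (_ * _).
rewrite RintegralB//; last first.
  exact: (integrableD measurableT (ig i) (ig j)).
by rewrite RintegralD.
Qed.

(** The variance of [h] under the uniform law on [D] is nonnegative. *)
Lemma Rintegral_Cauchy_Schwarz (D : set T) (m : R) (h : T -> R) :
  measurable D -> mu D = m%:E -> 0 < m ->
  mu.-integrable D (EFin \o h) ->
  mu.-integrable D (EFin \o (fun x => h x ^+ 2)) ->
  (\int[mu]_(x in D) h x) ^+ 2 / m <= \int[mu]_(x in D) (h x ^+ 2).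
Proof.
move=> mD muD m0 ih ih2.
pose c := (\int[mu]_(x in D) h x) / m.
have icst (r : R) : mu.-integrable D (EFin \o cst r).
  apply/integrableP; split; first by apply/measurable_EFinP; exact: measurable_cst.
  rewrite (eq_integral (cst `|r|%:E)) ?integral_cst//.
  by rewrite [X in (_ * X)%E]muD -EFinM ltry.
have E : forall x, (h x - c) ^+ 2 = h x ^+ 2 - (2 * c * h x - c ^+ 2) by move=> x; ring.
have : 0 <= \int[mu]_(x in D) ((h x - c) ^+ 2).
  by apply: Rintegral_ge0 => // x _; exact: sqr_ge0.
under eq_Rintegral do rewrite E.
have i2ch : mu.-integrable D (EFin \o (fun x => 2 * c * h x)).
  exact: (integrableZl mD _ ih).
rewrite RintegralB//; last exact: (integrableB mD i2ch (icst (c ^+ 2))).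
rewrite RintegralB//; last exact: (icst (c ^+ 2)).
rewrite RintegralZl// Rintegral_cst// muD/= subr_ge0; apply: le_trans.
rewrite le_eqVlt; apply/orP; left; apply/eqP.
by rewrite /c; field; rewrite gt_eqF.
Qed.

End L2_quadratic_forms.

Section kernel_lower_bounds.
Context {R : realType}.
Notation mu := (@lebesgue_measure R).
Variable H : R.
Hypothesis H2 : -2^-1 < H < 2^-1.
Local Notation f := (mvn_kernel H).
Local Notation K := (fine (mvn_constant H)).

Lemma mvn_sqr_integrable (s t : R) : s <= t ->
  mu.-integrable setT (EFin \o (fun v => (f t v - f s v) ^+ 2)) /\
  \int[mu]_v ((f t v - f s v) ^+ 2) = (t - s) `^ (2 * H + 1) * K.
Proof.
have HH : 0 < 2 * H + 1 by case/andP: H2 => ? ?; lra.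
rewrite le_eqVlt => /predU1P[->|st].
  split.
    have := integrable0 mu setT; apply: eq_integrable => // v _.
    by rewrite /= subrr expr0n.
  rewrite subrr powR0 ?gt_eqF// mul0r.
  under eq_Rintegral do rewrite subrr expr0n/=.
  by rewrite /Rintegral integral0.
have E := mvn_scaling H st.
have fin := mvn_constant_fin H2.
split; last by rewrite /Rintegral E fineM.
apply/integrableP; split; first exact: measurable_mvn_sqr.
under eq_integral => v _ do rewrite /= ger0_norm ?sqr_ge0//.
by rewrite E -(fineK fin) -EFinM ltry.
Qed.

(** The kernel of time [t] is supported to the right of [- t] and that of time [s]
    to the right of [- s]; between the two points only the former is present. For
    [H > 0] it vanishes at [- t], whence the restriction to the half of the interval
    away from that point. *)
Definition mvn_itv (s t : R) : set (measurableTypeR R) := `] - t + (t - s) / 2, - s[%classic.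

Lemma mvn_itv_measure (s t : R) : s < t -> mu (mvn_itv s t) = ((t - s) / 2)%:E.
Proof.
move=> st; rewrite /mvn_itv lebesgue_measure_itv/= lte_fin ifT; last lra.
by rewrite -EFinB; congr EFin; field.
Qed.

Lemma mvn_kernel_lower (s t v : R) : s < t -> mvn_itv s t v ->
  (t - s) `^ H / 2 <= f t v.
Proof.
move=> st; rewrite /mvn_itv/= in_itv/= => /andP[v1 v2].
rewrite /mvn_kernel ifT; last lra.
have r0 : 0 < t - s by rewrite subr_gt0.
have [H0|H0] := leP 0 H.
  apply: (@le_trans _ _ (((t - s) / 2) `^ H)); last first.
    by apply: ge0_ler_powR => //; rewrite ?nnegrE; lra.
  rewrite powRM ?(ltW r0)// ler_wpM2l ?powR_ge0//.
  rewrite -[leLHS]powR_inv1//.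
  rewrite -(powR_inv1 (_ : 0 <= 2))// -powRrM mulN1r.
  by apply: ler_powR; [lra|case/andP: H2 => ? ?; lra].
apply: (@le_trans _ _ ((t - s) `^ H)).
  by rewrite ler_pdivrMr// ler_peMr ?powR_ge0// ler1n.
have E (x : R) : x `^ H = (x `^ (- H))^-1 by rewrite powRN invrK.
rewrite E [leRHS]E lef_pV2 ?posrE ?powR_gt0//; last lra.
by apply: ge0_ler_powR => //; rewrite ?nnegrE; lra.
Qed.

End kernel_lower_bounds.

Section local_nondeterminism.
Context {R : realType}.
Notation mu := (@lebesgue_measure R).
Variable H : R.
Hypothesis H2 : -2^-1 < H < 2^-1.
Local Notation f := (mvn_kernel H).
Local Notation K := (fine (mvn_constant H)).

Lemma integrable_of_sqr (D : set (measurableTypeR R)) (m : R) (h : R -> R) :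
  measurable D -> mu D = m%:E -> measurable_fun setT h ->
  mu.-integrable D (EFin \o (fun x => h x ^+ 2)) ->
  mu.-integrable D (EFin \o h).
Proof.
move=> mD muD mh ih2.
have i1 : mu.-integrable D (EFin \o cst 1).
  apply/integrableP; split; first by apply/measurable_EFinP; exact: measurable_cst.
  rewrite (eq_integral (cst 1%E)) ?integral_cst//; last by move=> x _; rewrite /= normr1.
  by rewrite [X in (_ * X)%E]muD -EFinM ltry.
apply: (le_integrable mD _ _ (integrableD mD i1 ih2)).
  by apply/measurable_EFinP; apply: measurable_funTS.
move=> x _; rewrite lee_fin /= [leRHS]ger0_norm ?addr_ge0 ?sqr_ge0//.
have := sqr_ge0 (`|h x| - 1).
by rewrite sqrrB1 real_normK ?num_real//; have := sqr_ge0 (h x); lra.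
Qed.

Lemma measurable_mvn_itv (s t : R) : measurable (mvn_itv s t).
Proof. exact: measurable_itv. Qed.

Lemma mvn_kernel_vanish (s v : R) : v < - s -> f s v = 0.
Proof. by move=> vs; rewrite /mvn_kernel ifF//; apply/negbTE; rewrite -leNgt ltW. Qed.

Lemma mvn_increment_itv_lower (s t : R) : 0 <= s -> s < t ->
  (t - s) / 2 * ((t - s) `^ H / 2) <= \int[mu]_(v in mvn_itv s t) (f t v - f 0 v).
Proof.
move=> s0 st; have [t0 i0] : 0 <= t /\ 0 <= s by split; lra.
have [i2 _] := mvn_sqr_integrable H2 t0.
have mg : measurable_fun setT (fun v => f t v - f 0 v).
  by apply: measurable_funB; exact: measurable_mvn_kernel.
have ig : mu.-integrable (mvn_itv s t) (EFin \o (fun v => f t v - f 0 v)).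
  apply: integrable_of_sqr (mvn_itv_measure st) mg _; first exact: measurable_mvn_itv.
  by apply: integrableS i2 => //; exact: measurable_mvn_itv.
have ic : mu.-integrable (mvn_itv s t) (EFin \o cst ((t - s) `^ H / 2)).
  apply: integrable_of_sqr (mvn_itv_measure st) _ _ => //; first exact: measurable_mvn_itv.
  apply/integrableP; split.
    by apply/measurable_EFinP; apply: measurable_funX; exact: measurable_cst.
  rewrite (eq_integral (cst `|((t - s) `^ H / 2) ^+ 2|%:E))//.
  rewrite integral_cst//; last exact: measurable_mvn_itv.
  by rewrite [X in (_ * X)%E]mvn_itv_measure// -EFinM ltry.
have := le_Rintegral (measurable_mvn_itv s t) ic ig.
rewrite Rintegral_cst; last exact: measurable_mvn_itv.
rewrite [X in fine X]mvn_itv_measure//=.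
rewrite [leLHS]mulrC; apply => v Jv /=.
rewrite (@mvn_kernel_vanish 0) ?subr0; first exact: (mvn_kernel_lower H2).
by move: Jv; rewrite /mvn_itv/= in_itv/= => /andP[_]; lra.
Qed.

Lemma mvn_constant_gt0 : 0 < K.
Proof.
have [i2] := mvn_sqr_integrable H2 (ler01 : 0 <= 1 :> R).
rewrite subr0 powR1 mul1r => E.
have lb := mvn_increment_itv_lower (lexx 0) ltr01.
have muJ := mvn_itv_measure (ltr01 : 0 < 1 :> R).
have iJ : mu.-integrable (mvn_itv 0 1) (EFin \o (fun v => (f 1 v - f 0 v) ^+ 2)).
  by apply: integrableS i2 => //; exact: measurable_mvn_itv.
have mg : measurable_fun setT (fun v => f 1 v - f 0 v).
  by apply: measurable_funB; exact: measurable_mvn_kernel.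
have := Rintegral_Cauchy_Schwarz (measurable_mvn_itv 0 1) muJ _
  (integrable_of_sqr (measurable_mvn_itv 0 1) muJ mg iJ) iJ.
rewrite -E subr0 => /(_ _)CS.
apply: (@lt_le_trans _ _ (\int[mu]_(v in mvn_itv 0 1) (f 1 v - f 0 v) ^+ 2)).
  apply: lt_le_trans (CS _); last lra.
  rewrite divr_gt0// exprn_gt0//; apply: lt_le_trans lb.
  by rewrite subr0 powR1; lra.
rewrite /Rintegral fine_le//.
- exact: (integrable_fin_num (measurable_mvn_itv 0 1) iJ).
- exact: integrable_fin_num i2.
- apply: ge0_subset_integral => //; first exact: measurable_mvn_itv.
  + exact: measurable_mvn_sqr.
  + by move=> v _; rewrite lee_fin sqr_ge0.
Qed.

(** On the interval attached to the step from [s j] to [s j.+1] the kernels of the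
    times up to [s j] vanish. Cauchy-Schwarz on each of these disjoint intervals
    bounds the squared norm from below by the square of a linear form in the
    coefficients of the times [s j.+1] and later, normalised by the length of the
    interval; the coefficient of [s j.+1] is of the order of the standard deviation
    of the step. *)
Lemma mvn_local_nondeterminism : exists2 c : R, 0 < c &
  forall k (s : nat -> R), s 0 = 0 -> (forall i, s i < s i.+1) ->
  exists w : 'I_k -> 'I_k -> R,
    [/\ forall j : 'I_k, c * (s j.+1 - s j) `^ (H + 2^-1) <= w j j,
        forall i j : 'I_k, (i < j)%N -> w j i = 0 &
        forall a : 'I_k -> R,
          \sum_(j < k) (\sum_(i < k) w j i * a i) ^+ 2 <=
          (\int[mu]_v (\sum_(i < k) a i * (f (s i.+1) v - f 0 v)) ^+ 2) / K].
Proof.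
have K0 := mvn_constant_gt0.
exists ((Num.sqrt (2 * K))^-1 / 2).
  by rewrite divr_gt0// invr_gt0 sqrtr_gt0 mulr_gt0.
move=> k s s0 sS.
have s_mono : {homo s : i j / (i <= j)%N >-> i <= j}.
  by apply: homo_leq => [x|x y z|i]; [exact: lexx|exact: le_trans|exact: ltW].
have aux (p q r v : R) : p < q -> q <= r -> - q + (q - p) / 2 < v -> v < - r -> False.
  by move=> *; lra.
have s_ge0 i : 0 <= s i by rewrite -s0; exact: s_mono.
pose J j := mvn_itv (s j) (s j.+1).
pose m j := (s j.+1 - s j) / 2.
have m0 j : 0 < m j by rewrite divr_gt0// subr_gt0.
have mJ j : measurable (J j) by exact: measurable_mvn_itv.
have muJ j : mu (J j) = (m j)%:E by exact: mvn_itv_measure.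
pose g (i : 'I_k) (v : measurableTypeR R) := f (s i.+1) v - f 0 v.
have mg i : measurable_fun setT (g i).
  by apply: measurable_funB; exact: measurable_mvn_kernel.
have ig i : mu.-integrable setT (EFin \o (fun v => g i v ^+ 2)).
  exact: (mvn_sqr_integrable H2 (s_ge0 i.+1)).1.
have igJ i j : mu.-integrable (J j) (EFin \o g i).
  apply: integrable_of_sqr (mJ j) (muJ j) (mg i) _.
  exact: (integrableS measurableT).
exists (fun j i => (Num.sqrt (K * m j))^-1 * \int[mu]_(v in J j) g i v); split.
- move=> j.
  have := mvn_increment_itv_lower (s_ge0 j) (sS j).
  have Km : 0 < (Num.sqrt (K * m j))^-1.
    by rewrite invr_gt0 sqrtr_gt0; exact: mulr_gt0 K0 (m0 j).
  rewrite -(ler_pM2l Km).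
  apply: le_trans.
  have r0 : 0 < s j.+1 - s j by rewrite subr_gt0.
  rewrite -/(m j) powRD; last by rewrite (gt_eqF r0) implybT.
  rewrite powR12_sqrt ?(ltW r0)//; set p := _ `^ H.
  have -> : s j.+1 - s j = 2 * m j by rewrite /m; field.
  have -> : m j * (p / 2) = Num.sqrt (m j) ^+ 2 * (p / 2) by rewrite sqr_sqrtr ?(ltW (m0 j)).
  move: (m j) (m0 j) => mj mj0; rewrite le_eqVlt; apply/orP; left; apply/eqP.
  rewrite sqrtrM// sqrtrM// sqrtrM ?(ltW K0)//; field.
  by rewrite !gt_eqF ?sqrtr_gt0 ?subr_gt0.
- move=> i j ij; rewrite (_ : \int[mu]_(v in J j) _ = 0) ?mulr0//.
  rewrite (@eq_Rintegral _ _ _ mu (J j) (cst 0)); last first.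
    move=> v; rewrite inE /J /mvn_itv/= in_itv/= => /andP[_ vs].
    rewrite /g !mvn_kernel_vanish ?subr0//.
      by rewrite oppr0 (lt_le_trans vs)// oppr_le0.
    by rewrite (lt_le_trans vs)// lerN2 s_mono.
  by rewrite Rintegral_cst// mul0r.
move=> a; pose h v := \sum_(i < k) a i * g i v.
have [ih2 _] := L2_quadratic_form a mg ig.
have ih2J j : mu.-integrable (J j) (EFin \o (fun v => h v ^+ 2)).
  exact: (integrableS measurableT).
have iag i j : mu.-integrable (J j) (EFin \o (fun v => a i * g i v)).
  exact: (integrableZl (mJ j) (a i) (igJ i j)).
have hJ j := Rintegral_fsum (index_enum 'I_k) (mJ j) (iag ^~ j).
have step (j : 'I_k) : (\sum_(i < k) (Num.sqrt (K * m j))^-1 *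
    (\int[mu]_(v in J j) g i v) * a i) ^+ 2 <= (\int[mu]_(v in J j) (h v ^+ 2)) / K.
  have -> : \sum_(i < k) (Num.sqrt (K * m j))^-1 * (\int[mu]_(v in J j) g i v) * a i =
      (Num.sqrt (K * m j))^-1 * \int[mu]_(v in J j) h v.
    rewrite /h (hJ j).2 mulr_sumr; apply: eq_bigr => i _.
    by rewrite RintegralZl// -mulrA; congr (_ * _); rewrite mulrC.
  have := Rintegral_Cauchy_Schwarz (mJ j) (muJ j) (m0 j) (hJ j).1 (ih2J j).
  rewrite -(@ler_pM2r _ K^-1) ?invr_gt0//; apply: le_trans.
  rewrite exprMn exprVn sqr_sqrtr; last by rewrite mulr_ge0// ltW.
  by rewrite le_eqVlt; apply/orP; left; apply/eqP; rewrite invfM; ring.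
apply: (le_trans (ler_sum _ (fun j _ => step j))).
rewrite -mulr_suml ler_wpM2r ?invr_ge0 ?(ltW K0)//.
have ge0h v : (0 <= (h v ^+ 2)%:E)%E by rewrite lee_fin sqr_ge0.
have mh : measurable_fun setT (fun v => (h v ^+ 2)%:E) by have /measurable_int := ih2.
have tJ : trivIset [set` index_enum 'I_k] (fun j : 'I_k => J j).
  move=> i j _ _ [v []]; rewrite /J /mvn_itv/= !in_itv/= => /andP[i1 i2] /andP[j1 j2].
  have [ij|ji|/val_inj//] := ltngtP i j.
    by case: (aux _ _ _ _ (sS i) (s_mono _ _ ij) i1 j2).
  by case: (aux _ _ _ _ (sS j) (s_mono _ _ ji) j1 i2).
rewrite -lee_fin.
have -> : (\sum_(j < k) \int[mu]_(v in J j) (h v ^+ 2))%:E =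
  (\int[mu]_(v in \big[setU/set0]_(j < k) J j) (h v ^+ 2)%:E)%E.
  rewrite ge0_integral_bigsetU//.
  - rewrite -sumEFin; apply: eq_bigr => j _; rewrite /Rintegral fineK//.
    exact: (integrable_fin_num (mJ j) (ih2J j)).
  - exact: index_enum_uniq.
  - by apply: measurable_funTS.
rewrite /Rintegral fineK; last exact: integrable_fin_num ih2.
apply: ge0_subset_integral => //.
by apply: bigsetU_measurable.
Qed.

End local_nondeterminism.

(** * Laws of Gaussian variables *)

Section gaussian_laws.
Context {R : realType} {d : measure_display} {T : measurableType d}.
Variable P : probability T R.
Notation mu := (@lebesgue_measure R).
Local Notation pdf := (@normal_pdf R 0 1).

Lemma ge0_integral_law (Y : T -> R) (nu : {measure set (measurableTypeR R) -> \bar R}) (f : R -> R) :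
  measurable_fun setT Y ->
  (forall U : set R, measurable U -> P (Y @^-1` U) = nu U) ->
  measurable_fun setT f -> (forall x, 0 <= f x) ->
  (\int[P]_w (f (Y w))%:E = \int[nu]_x (f x)%:E)%E.
Proof.
move=> mY law mf f0.
have <- := @ge0_integral_pushforward _ _ T (measurableTypeR R) R Y mY P setT
  (EFin \o f) measurableT _ _.
- by apply: eq_measure_integral => A mA _; exact: law.
- exact/measurable_EFinP.
- by move=> x _; rewrite lee_fin.
Qed.

Lemma ge0_integral_normal_law (m s : R) (f : R -> R) : 0 < s ->
  measurable_fun setT f -> (forall x, 0 <= f x) ->
  (\int[normal_prob m s]_x (f x)%:E = \int[mu]_x (f (m + s * x) * pdf x)%:E)%E.
Proof.
move=> s0 mf f0.
rewrite ge0_integral_normal_prob//; last first.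
  exact/measurable_EFinP.
rewrite (@ge0_integral_affine _ s m)//; last 2 first.
- apply: emeasurable_funM; apply/measurable_EFinP => //; exact: measurable_normal_pdf.
- by move=> x; rewrite mule_ge0// lee_fin// normal_pdf_ge0.
rewrite -ge0_integralZl//; last 3 first.
- apply: emeasurable_funM; apply/measurable_EFinP.
    apply: (@measurableT_comp _ _ _ _ _ _ f) => //.
    exact: measurable_affine.
  apply: (@measurableT_comp _ _ _ _ _ _ (normal_pdf m s)) => //.
    exact: measurable_normal_pdf.
  exact: measurable_affine.
- by move=> x _; rewrite mule_ge0// lee_fin// normal_pdf_ge0.
- by rewrite lee_fin ltW.
apply: eq_integral => x _; rewrite -!EFinM addrC; congr EFin.
rewrite mulrCA; congr (_ * _).
rewrite !normal_pdfE ?oner_eq0 ?gt_eqF// /normal_fun /normal_peak subr0 addrAC subrr add0r.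
rewrite expr1n mul1r -(mulrnAr (_ ^+ 2)) sqrtrM ?sqr_ge0// sqrtr_sqr gtr0_norm//.
rewrite invfM mulrA mulrA mulfV ?gt_eqF// mul1r; congr (_ * expR _).
by rewrite -mulr_natr -[1 *+ 2]mulr_natr; field; rewrite gt_eqF.
Qed.

(** The law of [m + s * x] for a standard normal [x]. Allowing [s = 0] treats the
    point masses and the nondegenerate Gaussian laws together; testing on
    nonnegative functions avoids any integrability condition. *)
Definition affine_standard (Y : T -> R) (m s : R) :=
  forall f : R -> R, measurable_fun setT f -> (forall x, 0 <= f x) ->
    (\int[P]_w (f (Y w))%:E = \int[mu]_x (f (m + s * x) * pdf x)%:E)%E.

Lemma gaussian_affine_standard (Y : {RV P >-> R}) : gaussian_rv Y ->
  exists m s, affine_standard Y m s.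
Proof.
case=> [[m law]|[m [s [s0 law]]]].
  exists m, 0 => f mf f0.
  rewrite (@ge0_integral_law Y (dirac (m : measurableTypeR R)) f)//.
  rewrite integral_dirac//; last exact/measurable_EFinP.
  rewrite diracT mul1e.
  under eq_integral do rewrite mul0r addr0 EFinM.
  rewrite ge0_integralZl//.
  - by rewrite integral_normal_pdf mule1.
  - by apply/measurable_EFinP; exact: measurable_normal_pdf.
  - by move=> x _; rewrite lee_fin normal_pdf_ge0.
  - by rewrite lee_fin.
exists m, s => f mf f0.
by rewrite (@ge0_integral_law Y (normal_prob m s) f)// ge0_integral_normal_law.
Qed.

Lemma standard_affine (Y : T -> R) : measurable_fun setT Y ->
  (forall U : set R, measurable U -> P (Y @^-1` U) = normal_prob 0 1 U) ->
  affine_standard Y 0 1.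
Proof.
move=> mY law f mf f0.
by rewrite (@ge0_integral_law Y (normal_prob 0 1) f)// ge0_integral_normal_law.
Qed.

Lemma integral_shifted_square (c m s : R) :
  (\int[mu]_x ((c + (m + s * x)) ^+ 2 * pdf x)%:E = ((c + m) ^+ 2 + s ^+ 2)%:E)%E.
Proof.
have i0 : mu.-integrable setT (EFin \o (fun x => pdf x)).
  exact: integrable_normal_pdf.
have i1 : mu.-integrable setT (EFin \o (fun x => x * pdf x)).
  apply: (@integrable_quadratic_pdf _ id 1) => // x /=.
  have := sqr_ge0 (`|x| - 1).
  by rewrite sqrrB1 real_normK ?num_real//; have := sqr_ge0 x; lra.
have i2 : mu.-integrable setT (EFin \o (fun x => x ^+ 2 * pdf x)).
  apply: (@integrable_quadratic_pdf _ (fun x => x ^+ 2) 1) => // x.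
  by rewrite ger0_norm ?sqr_ge0// mul1r lerDr.
have E x : (c + (m + s * x)) ^+ 2 * pdf x =
    (c + m) ^+ 2 * pdf x + 2 * (c + m) * s * (x * pdf x) + s ^+ 2 * (x ^+ 2 * pdf x).
  by ring.
have j0 := integrableZl measurableT ((c + m) ^+ 2) i0.
have j1 := integrableZl measurableT (2 * (c + m) * s) i1.
have j2 := integrableZl measurableT (s ^+ 2) i2.
have j01 := integrableD measurableT j0 j1.
have jall := integrableD measurableT j01 j2.
have R1 : \int[mu]_x ((c + (m + s * x)) ^+ 2 * pdf x) = (c + m) ^+ 2 + s ^+ 2.
  under eq_Rintegral do rewrite E.
  rewrite RintegralD// RintegralD// !RintegralZl//.
  by rewrite std_mean std_second_moment Rintegral_std_pdf; ring.
have jE : mu.-integrable setT (EFin \o (fun x => (c + (m + s * x)) ^+ 2 * pdf x)).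
  by move: jall; apply: eq_integrable => // x _; rewrite /= E !EFinD !EFinM.
by rewrite -R1 /Rintegral fineK//; exact: integrable_fin_num jE.
Qed.

(** The first moment is obtained from the second moments of [Y] and [1 + Y], which
    are integrals of nonnegative functions. *)
Lemma affine_standard_moments (Y : T -> R) (m s : R) :
  measurable_fun setT Y -> affine_standard Y m s ->
  [/\ P.-integrable setT (EFin \o (fun w => Y w ^+ 2)),
      P.-integrable setT (EFin \o Y),
      \int[P]_w (Y w ^+ 2) = m ^+ 2 + s ^+ 2 &
      \int[P]_w Y w = m].
Proof.
move=> mY YE.
have sq c : (\int[P]_w ((c + Y w) ^+ 2)%:E = ((c + m) ^+ 2 + s ^+ 2)%:E)%E.
  rewrite -integral_shifted_square (YE (fun x => (c + x) ^+ 2))//.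
    by apply: measurable_funX; exact: measurable_funD.
  by move=> x; exact: sqr_ge0.
have isq c : P.-integrable setT (EFin \o (fun w => (c + Y w) ^+ 2)).
  apply/integrableP; split.
    by apply/measurable_EFinP; apply: measurable_funX; exact: measurable_funD.
  under eq_integral => w _ do rewrite /= ger0_norm ?sqr_ge0//.
  by rewrite sq ltry.
have i0 : P.-integrable setT (EFin \o (fun w => Y w ^+ 2)).
  by have := isq 0; apply: eq_integrable => // w _; rewrite /= add0r.
have YE2 w : Y w = 2^-1 * ((1 + Y w) ^+ 2 - Y w ^+ 2 - 1) by field.
have ic : P.-integrable setT (EFin \o cst 1).
  by apply: (@bounded_RV_integrable _ _ _ P (cst 1) 1) => // w; rewrite normr1.
have i12 := integrableB measurableT (isq 1) i0.
have i3 := integrableB measurableT i12 ic.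
have E0 : \int[P]_w (Y w ^+ 2) = m ^+ 2 + s ^+ 2.
  have := sq 0; under eq_integral do rewrite add0r.
  by rewrite add0r /Rintegral => ->.
split => //.
- have := integrableZl measurableT 2^-1 i3.
  by apply: eq_integrable => // w _; rewrite /= [X in _ = X%:E]YE2.
- under eq_Rintegral do rewrite YE2.
  rewrite RintegralZl// RintegralB// RintegralB// E0 /Rintegral sq/=.
  rewrite integral_cst// [X in (_ * X)%E](@probability_setT _ _ _ P) mule1/=.
  by field.
Qed.

Lemma affine_standard_cos (Y : T -> R) (s : R) :
  measurable_fun setT Y -> affine_standard Y 0 s ->
  \int[P]_w cos (Y w) = expR (- (s ^+ 2 / 2)).
Proof.
move=> mY YE.
have mcos : measurable_fun setT (@cos R).
  by apply: continuous_measurable_fun; exact: continuous_cos.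
(* The cosine is shifted by 1 to become nonnegative. *)
have := YE (fun x => 1 + cos x).
have m1 : measurable_fun setT (fun x : R => 1 + cos x) by exact: measurable_funD.
move=> /(_ m1); have p0 x : 0 <= 1 + cos x :> R by have := cos_geN1 x; lra.
move=> /(_ p0) E.
have icos : P.-integrable setT (EFin \o (fun w => cos (Y w))).
  apply: (@bounded_RV_integrable _ _ _ P _ 1); first exact: measurableT_comp.
  by move=> w; rewrite ler_norml cos_geN1 cos_le1.
have ic : P.-integrable setT (EFin \o cst 1).
  by apply: (@bounded_RV_integrable _ _ _ P (cst 1) 1) => // w; rewrite normr1.
have : \int[P]_w (1 + cos (Y w)) = \int[mu]_x ((1 + cos (s * x)) * pdf x).
  rewrite /Rintegral; congr fine; rewrite E; apply: eq_integral => x _.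
  by rewrite add0r.
rewrite RintegralD//.
under [X in _ = X -> _]eq_Rintegral do rewrite mulrDl mul1r.
rewrite RintegralD//; last 2 first.
- exact: integrable_normal_pdf.
- exact: integrable_cos_pdf.
rewrite std_charf Rintegral_std_pdf Rintegral_cst//.
by rewrite [X in fine X](@probability_setT _ _ _ P)/= mulr1 => /addrI.
Qed.

Lemma gaussian_cos (Y : {RV P >-> R}) : gaussian_rv Y ->
  \int[P]_w Y w = 0 -> \int[P]_w cos (Y w) = expR (- (\int[P]_w (Y w ^+ 2) / 2)).
Proof.
move=> /gaussian_affine_standard[m [s YE]] Y0.
have [_ _ E2 E1] := affine_standard_moments (measurable_funP Y) YE.
have m0 : m = 0 by rewrite -E1.
move: YE E2; rewrite m0 => YE ->; rewrite expr0n/= add0r.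
exact: affine_standard_cos.
Qed.

(** Where [|y| > x], the standard density is at most [2 * exp (- x^2 / 4)] times the
    normal density of variance 2. *)
Lemma standard_tail (Y : T -> R) (x : R) : measurable_fun setT Y ->
  affine_standard Y 0 1 -> 0 <= x ->
  (P [set w | (x < `|Y w|)%R] <= (2 * expR (- (x ^+ 2 / 4)))%:E)%E.
Proof.
move=> mY YE x0.
pose f (y : R) : R := \1_[set y : R | x < `|y|] y.
have mS : measurable [set y : R | x < `|y|].
  rewrite (_ : [set y : R | _] = ~` `[- x, x]%classic); last first.
    by apply/seteqP; split => y /=; rewrite in_itv/= -ler_norml real_ltNge ?num_real// => /negP.
  exact: measurableC.
have mA : measurable [set w | x < `|Y w|].
  by rewrite -[X in measurable X]setTI; exact: (mY measurableT _ mS).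
rewrite -(setIT [set w | _]) -integral_indic//.
have := YE f; rewrite {1}/f.
rewrite (_ : (\int[P]_w (\1_[set y : R | x < `|y|] (Y w))%:E = \int[P]_w (\1_[set w | x < `|Y w|] w)%:E)%E).
  move=> ->; last 2 first.
  - exact: measurable_indic.
  - by move=> y; rewrite /f.
  apply: (@le_trans _ _ (\int[mu]_y ((2 * expR (- (x ^+ 2 / 4)))%:E * (normal_pdf 0 (Num.sqrt 2) y)%:E))%E); last first.
    rewrite integralZl//; last exact: integrable_normal_pdf.
    by rewrite integral_normal_pdf mule1.
  apply: ge0_le_integral => //.
  - by move=> y _; rewrite lee_fin mulr_ge0 ?normal_pdf_ge0.
  - apply/measurable_EFinP/measurable_funM; last exact: measurable_normal_pdf.
    under eq_fun do rewrite add0r mul1r.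
    exact: measurable_indic.
  - apply: emeasurable_funM => //; apply/measurable_EFinP; exact: measurable_normal_pdf.
  move=> y _; rewrite -EFinM lee_fin add0r mul1r /f indicE.
  have [|_] := boolP (y \in _); last by rewrite mul0r !mulr_ge0 ?expR_ge0 ?normal_pdf_ge0.
  rewrite inE/= mul1r => xy.
  have s2 : Num.sqrt 2 != 0 :> R by rewrite gt_eqF// sqrtr_gt0.
  rewrite std_pdfE normal_pdfE// /normal_fun subr0 sqr_sqrtr// mulrACA.
  rewrite -expRD.
  have pk : normal_peak (1 : R) <= 2 * normal_peak (Num.sqrt 2).
    rewrite /normal_peak expr1n mul1r sqr_sqrtr// -mulrnAr sqrtrM// invfM mulrA.
    rewrite ler_peMl ?invr_ge0//.
    rewrite ler_pdivlMr ?sqrtr_gt0// mul1r.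
    by rewrite -[leRHS]ger0_norm// -sqrtr_sqr ler_sqrt//; lra.
  apply: ler_pM; rewrite ?normal_peak_ge0 ?expR_ge0// ler_expR.
  have xy2 : x ^+ 2 <= y ^+ 2.
    by rewrite -[leRHS]real_normK ?num_real// ler_sqr ?nnegrE// ltW.
  rewrite -mulr_natr; lra.
by apply: eq_integral => w _; rewrite !indicE; congr (_%:R%:E); apply/idP/idP; rewrite !inE.
Qed.

End gaussian_laws.

(** * Increments of fractional Brownian motion *)

Section fbm_increments.
Context {R : realType} {d : measure_display} {T : measurableType d}.
Variables (P : probability T R) (alpha : R) (B : R -> {RV P >-> R}).
Hypothesis alpha01 : 0 < alpha < 1.
Hypothesis fbmB : fractional_brownian_motion alpha `[0, 1] B.
Notation mu := (@lebesgue_measure R).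
Local Notation pdf := (@normal_pdf R 0 1).

Lemma ae_eq_probability (A A' : set T) : measurable A -> measurable A' ->
  {ae P, forall w, A w <-> A' w} -> P A = P A'.
Proof.
move=> mA mA' AA'.
rewrite -(setIT A) -(setIT A') -!integral_indic//.
apply: ae_eq_integral => //.
- by apply/measurable_EFinP; exact: measurable_indic.
- by apply/measurable_EFinP; exact: measurable_indic.
apply: filterS AA' => w AA' _; rewrite !indicE.
suff -> : (w \in A) = (w \in A') by [].
by apply/idP/idP; rewrite !inE => /AA'.
Qed.

Lemma measurable_increment (s t : R) : measurable_fun setT (fun w => B t w - B s w).
Proof. by apply: measurable_funB; exact: measurable_funP. Qed.

(** Stationarity reduces the increment to [B (t - s) - B 0], and [B 0] vanishes
    almost surely. *)
Lemma fbm_increment_standard (s t : R) : 0 <= s -> s < t -> t <= 1 ->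
  affine_standard P (fun w => (t - s) `^ (- alpha) * (B t w - B s w)) 0 1.
Proof.
move=> s0 st t1; have r0 : 0 < t - s by rewrite subr_gt0.
set q := (t - s) `^ (- alpha).
have mZ : measurable_fun setT (fun w => q * (B t w - B s w)).
  by apply: measurable_funM => //; exact: measurable_increment.
apply: standard_affine => // U mU.
pose U' := [set x : 1.-tuple R | U (q * tnth x ord0)].
have mU' : measurable U'.
  have m1 : measurable_fun setT (fun x : 1.-tuple R => q * tnth x ord0).
    by apply: measurable_funM => //; exact: measurable_tnth.
  by have := m1 measurableT _ mU; rewrite setTI.
have I1 x : 0 <= x -> x <= 1 -> (`[0, 1]%classic : set R) x.
  by move=> x0 x1; rewrite /= in_itv/= x0.
have Is : (`[0, 1]%classic : set R) s by apply: I1; lra.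
have Ir (i : 'I_1) : (`[0, 1]%classic : set R) (t - s) by apply: I1; lra.
have It (i : 'I_1) : (`[0, 1]%classic : set R) (s + (t - s)) by apply: I1; lra.
have E : P [set w | U (q * (B t w - B s w))] = P [set w | U (q * (B (t - s) w - B 0 w))].
  have := @fbm_stationary _ _ _ _ _ _ _ fbmB 1 s (fun=> t - s) Is Ir It U' mU'.
  rewrite /U'/=; under eq_set do rewrite tnth_mktuple (addrC s (t - s)) subrK.
  by move=> ->; under eq_set do rewrite tnth_mktuple.
rewrite [LHS]E.
have <- := fbm_normal fbmB (I1 (t - s) ltac:(lra) ltac:(lra)) r0 mU.
apply: ae_eq_probability.
- have mZ0 : measurable_fun setT (fun w => q * (B (t - s) w - B 0 w)).
    by apply: measurable_funM => //; exact: measurable_increment.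
  by have := mZ0 measurableT _ mU; rewrite setTI.
- by rewrite -[X in measurable X]setTI; apply: (measurable_funP (_ : {mfun T >-> R})).
by apply: filterS (fbm_zero fbmB) => w B0; rewrite /= B0 subr0.
Qed.

Lemma fbm_increment_moments (s t : R) : 0 <= s <= 1 -> 0 <= t <= 1 ->
  [/\ P.-integrable setT (EFin \o (fun w => (B t w - B s w) ^+ 2)),
      P.-integrable setT (EFin \o (fun w => B t w - B s w)),
      \int[P]_w ((B t w - B s w) ^+ 2) = `|t - s| `^ (2 * alpha) &
      \int[P]_w (B t w - B s w) = 0].
Proof.
wlog st : s t / s <= t => [H|].
  have [st|ts] := leP s t; first exact: H.
  move=> s01 t01; have [i2 i1 E2 E1] := H t s (ltW ts) t01 s01.
  have EB w : B t w - B s w = -1 * (B s w - B t w) by ring.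
  split.
  - by move: i2; apply: eq_integrable => // w _; rewrite /= -sqrrN opprB.
  - have := integrableZl measurableT (-1) i1.
    by apply: eq_integrable => // w _; rewrite /= [in RHS]EB EFinM.
  - under eq_Rintegral do rewrite -sqrrN opprB.
    by rewrite E2 distrC.
  - under eq_Rintegral do rewrite EB.
    by rewrite RintegralZl// E1 mulr0.
move=> /andP[s0 s1] /andP[t0 t1]; move: st; rewrite le_eqVlt => /predU1P[<-|st].
  have i0 : P.-integrable setT (EFin \o (fun w => 0 : R)) by exact: integrable0.
  split.
  - by move: i0; apply: eq_integrable => // w _; rewrite /= subrr expr0n.
  - by move: i0; apply: eq_integrable => // w _; rewrite /= subrr.
  - under eq_Rintegral do rewrite subrr expr0n/=.
    rewrite subrr normr0 powR0 ?mulf_neq0 ?gt_eqF//; last by case/andP: alpha01.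
    by rewrite /Rintegral integral0.
  - by under eq_Rintegral do rewrite subrr; rewrite /Rintegral integral0.
have r0 : 0 < t - s by rewrite subr_gt0.
have st1 := fbm_increment_standard s0 st t1.
set q := (t - s) `^ (- alpha) in st1.
have q0 : 0 < q by rewrite powR_gt0.
have mZ : measurable_fun setT (fun w => q * (B t w - B s w)).
  by apply: measurable_funM => //; exact: measurable_increment.
have [i2 i1 E2 E1] := affine_standard_moments mZ st1.
have EZ w : B t w - B s w = q^-1 * (q * (B t w - B s w)) by rewrite mulKf ?gt_eqF.
have EZ2 w : (B t w - B s w) ^+ 2 = (q ^+ 2)^-1 * (q * (B t w - B s w)) ^+ 2.
  by rewrite exprMn mulKf// expf_neq0// gt_eqF.
split.
- have := integrableZl measurableT (q ^+ 2)^-1 i2.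
  by apply: eq_integrable => // w _; rewrite /= [in RHS]EZ2 EFinM.
- have := integrableZl measurableT q^-1 i1.
  by apply: eq_integrable => // w _; rewrite /= [in RHS]EZ EFinM.
- under eq_Rintegral do rewrite EZ2.
  rewrite RintegralZl// E2 expr0n/= add0r expr1n mulr1 gtr0_norm//.
  by rewrite /q powRN exprVn invrK -powR_mulrn ?powR_ge0// -powRrM mulrC.
- under eq_Rintegral do rewrite EZ.
  by rewrite RintegralZl// E1 mulr0.
Qed.

Lemma RV_lincombE n (a : 'I_n -> R) (X : 'I_n -> {RV P >-> R}) (w : T) :
  (\sum_(i < n) a i *: X i) w = \sum_(i < n) a i * X i w.
Proof.
by elim/big_rec2 : _ => // i x y _ <-.
Qed.

Lemma fbm_increments_gaussian k (t : 'I_k -> R) (t0 : R) (a : 'I_k -> R) :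
  0 <= t0 <= 1 -> (forall i, 0 <= t i <= 1) ->
  exists2 Y : {RV P >-> R}, gaussian_rv Y &
    forall w, Y w = \sum_(i < k) a i * (B (t i) w - B t0 w).
Proof.
move=> t01 ti1.
(* The base time [t0] becomes an additional index of the linear combination. *)
pose tau (i : 'I_k.+1) := if unlift ord0 i is Some j then t j else t0.
pose b (i : 'I_k.+1) := if unlift ord0 i is Some j then a j else - \sum_(j < k) a j.
exists (\sum_(i < k.+1) b i *: B (tau i)).
  apply: (fbm_gaussian fbmB) => i; rewrite /tau.
  by case: (unlift ord0 i) => [j|]; rewrite /= in_itv/=.
move=> w; rewrite RV_lincombE big_ord_recl/= /b /tau unlift_none.
under eq_bigr do rewrite liftK.
under [RHS]eq_bigr do rewrite mulrBr.
by rewrite big_split/= sumrN -mulr_suml mulNr addrC.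
Qed.

(** The process and the kernels have, up to the factor [mvn_constant], the same
    variances of differences, namely powers [2 * alpha] of the time lag. By
    polarisation the variances of all linear combinations are then proportional, so
    that the local nondeterminism of the kernels is a triangular lower bound for the
    process; its characteristic function is the exponential of minus half the variance. *)
Lemma fbm_small_ball : exists2 c : R, 0 < c &
  forall k (s : nat -> R) (t0 r : R), s 0 = 0 -> (forall i, s i < s i.+1) ->
    0 <= t0 -> t0 + s k <= 1 -> 0 < r ->
  (P [set w | forall i : 'I_k, (`|B (t0 + s i.+1) w - B t0 w| <= r)%R] <=
   (\prod_(i < k) (2 * r / (c * (s i.+1 - s i) `^ alpha)))%:E)%E.
Proof.
have H2 : - 2^-1 < alpha - 2^-1 < 2^-1 by case/andP: alpha01 => *; lra.
have [c c0 lnd] := mvn_local_nondeterminism H2.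
exists c => // k s t0 r s0 sS t00 t01 r0.
have s_mono : {homo s : i j / (i <= j)%N >-> i <= j}.
  by apply: homo_leq => [x|x y z|i]; [exact: lexx|exact: le_trans|exact: ltW].
have s_ge0 i : 0 <= s i by rewrite -s0; exact: s_mono.
have st i : (i <= k)%N -> 0 <= t0 + s i <= 1.
  move=> ik; rewrite addr_ge0//=; apply: le_trans t01; rewrite lerD2l.
  exact: s_mono.
have t0I : 0 <= t0 <= 1 by have := st 0%N (leq0n _); rewrite s0 addr0.
have [w [w_ge wt wQ]] := lnd k s s0 sS.
rewrite subrK in w_ge.
have wpos j : 0 < w j j.
  apply: lt_le_trans (w_ge j); rewrite mulr_gt0// powR_gt0// subr_gt0; exact: sS.
pose X (i : 'I_k) om := B (t0 + s i.+1) om - B t0 om.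
have mX i : measurable_fun setT (X i) by exact: measurable_increment.
have Hcos (a : 'I_k -> R) : \int[P]_x cos (\sum_(i < k) a i * X i x) <=
     expR (- ((\sum_(j < k) (\sum_(i < k) w j i * a i) ^+ 2) / 2)).
  have [Y gY YE] := @fbm_increments_gaussian k (fun i : 'I_k => t0 + s i.+1) t0 a t0I
    (fun i : 'I_k => st i.+1 (ltn_ord i)).
  have mom (i : 'I_k) := fbm_increment_moments t0I (st i.+1 (ltn_ord i)).
  have iX i : P.-integrable setT (EFin \o X i) by have [] := mom i.
  have iX2 i : P.-integrable setT (EFin \o (fun x => X i x ^+ 2)) by have [] := mom i.
  have EX i : \int[P]_x X i x = 0 by have [] := mom i.
  have EX2 i : \int[P]_x (X i x ^+ 2) = s i.+1 `^ (2 * alpha).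
    by have [_ _ -> _] := mom i; rewrite addrC addKr ger0_norm.
  have EXX (i j : 'I_k) : \int[P]_x ((X i x - X j x) ^+ 2) = `|s i.+1 - s j.+1| `^ (2 * alpha).
    have [_ _ E _] := fbm_increment_moments (st j.+1 (ltn_ord j)) (st i.+1 (ltn_ord i)).
    have -> : s i.+1 - s j.+1 = t0 + s i.+1 - (t0 + s j.+1) by ring.
    rewrite -E.
    by apply: eq_Rintegral => x _; rewrite /X; congr (_ ^+ 2); ring.
  have EY : \int[P]_x Y x = 0.
    under eq_Rintegral do rewrite YE.
    have iaX i : P.-integrable setT (EFin \o (fun x => a i * X i x)).
      exact: (integrableZl measurableT (a i) (iX i)).
    rewrite (Rintegral_fsum (index_enum 'I_k) measurableT iaX).2.
    by rewrite big1// => i _; rewrite RintegralZl// EX mulr0.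
  under eq_Rintegral do rewrite -YE.
  rewrite (gaussian_cos gY EY) ler_expR lerN2 ler_pM2r ?invr_gt0//.
  under eq_Rintegral do rewrite YE.
  rewrite (L2_quadratic_form a mX iX2).2.
  apply: (le_trans (wQ a)).
  pose K := fine (mvn_constant (alpha - 2^-1)).
  have K0 : 0 < K by exact: mvn_constant_gt0.
  pose g (i : 'I_k) (v : measurableTypeR R) :=
    mvn_kernel (alpha - 2^-1) (s i.+1) v - mvn_kernel (alpha - 2^-1) 0 v.
  have mg i : measurable_fun setT (g i).
    by apply: measurable_funB; exact: measurable_mvn_kernel.
  have aE : 2 * (alpha - 2^-1) + 1 = 2 * alpha by field.
  have ig i : mu.-integrable setT (EFin \o (fun v => g i v ^+ 2)).
    exact: (mvn_sqr_integrable H2 (s_ge0 i.+1)).1.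
  have Eg i : \int[mu]_v (g i v ^+ 2) = s i.+1 `^ (2 * alpha) * K.
    by rewrite (mvn_sqr_integrable H2 (s_ge0 i.+1)).2 subr0 aE.
  have Egg i j : \int[mu]_v ((g i v - g j v) ^+ 2) = `|s i.+1 - s j.+1| `^ (2 * alpha) * K.
    wlog ij : i j / (j <= i)%N => [W|].
      have [ji|ij] := leqP j i; first exact: W.
      under eq_Rintegral do rewrite -sqrrN opprB.
      by rewrite W 1?distrC// ltnW.
    have sji : s j.+1 <= s i.+1 by exact: s_mono.
    rewrite ger0_norm ?subr_ge0// -aE -(mvn_sqr_integrable H2 sji).2.
    by apply: eq_Rintegral => v _; congr (_ ^+ 2); rewrite /g; ring.
  rewrite (L2_quadratic_form a mg ig).2 -/K mulr_suml.
  apply: ler_sum => i _; rewrite mulr_suml; apply: ler_sum => j _.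
  rewrite !Eg !EX2 Egg EXX -mulrDl -mulrBl mulrA mulfK// gt_eqF//.
apply: (le_trans (triangular_small_ball mX wpos wt Hcos r0)).
rewrite lee_fin; apply: ler_prod => i _.
have r2 : 0 <= 2 * r by rewrite mulr_ge0// ltW.
have pos : 0 < c * (s i.+1 - s i) `^ alpha by rewrite mulr_gt0// powR_gt0// subr_gt0.
rewrite divr_ge0 ?(ltW (wpos i))//=.
by rewrite ler_wpM2l// lef_pV2 ?posrE.
Qed.

Lemma fbm_increment_tail (s t x : R) : 0 <= s -> s < t -> t <= 1 -> 0 <= x ->
  (P [set w | (x * (t - s) `^ alpha < `|B t w - B s w|)%R] <=
   (2 * expR (- (x ^+ 2 / 4)))%:E)%E.
Proof.
move=> s0 st t1 x0; have r0 : 0 < t - s by rewrite subr_gt0.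
have mZ : measurable_fun setT (fun w => (t - s) `^ (- alpha) * (B t w - B s w)).
  by apply: measurable_funM => //; exact: measurable_increment.
have := standard_tail mZ (fbm_increment_standard s0 st t1) x0.
apply: le_trans; rewrite le_eqVlt; apply/orP; left; apply/eqP; congr (P _).
apply/seteqP; split => w /=.
  by rewrite normrM (gtr0_norm (powR_gt0 _ r0)) powRN ltr_pdivlMl ?powR_gt0// mulrC.
by rewrite normrM (gtr0_norm (powR_gt0 _ r0)) powRN ltr_pdivlMl ?powR_gt0// mulrC.
Qed.

End fbm_increments.

(** * Returns of the path to a level *)

Section counting_chains.
Implicit Types (Z : pred nat) (a k m y : nat).

Definition points_above Z m a : nat := \sum_(a.+1 <= z < m.+1 | Z z) 1.

(** Subsets of cardinal [k.+1] of the points are sorted by their least element. *)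
Lemma bin_points_above Z m a k : 'C(points_above Z m a, k.+1) =
  \sum_(a.+1 <= z < m.+1 | Z z) 'C(points_above Z m z, k).
Proof.
have [n] := ubnP (m - a); elim: n a => // n IH a man.
have [am|ma] := ltnP a m; last by rewrite /points_above !big_geq.
rewrite [RHS]big_ltn_cond//= {1}/points_above big_ltn_cond//=.
rewrite -/(points_above Z m a.+1) -IH; last by lia.
by case: (Z a.+1); rewrite // add1n binS addnC.
Qed.

Lemma expn_le_bin k y : (0 < y)%N -> (y ^ k <= 'C(k * y, k))%N.
Proof.
move=> y0; elim: k => [|k IH]; first by rewrite bin0.
have := mul_bin_diag (k.+1 * y) k.
rewrite -mulnA => /eqP; rewrite eqn_pmul2l// => /eqP <-.
rewrite expnS leq_pmul2l//; apply: (leq_trans IH); apply: leq_bin2l.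
by rewrite mulSn; lia.
Qed.

End counting_chains.

Section close_returns.
Context {R : realType} {d : measure_display} {T : measurableType d}.
Variables (P : probability T R) (alpha : R) (B : R -> {RV P >-> R}).
Hypothesis alpha01 : 0 < alpha < 1.
Hypothesis fbmB : fractional_brownian_motion alpha `[0, 1] B.

Definition mesh_time (N p : nat) : R := p%:R / N%:R.

(** The offset [o] is counted from the mesh point [p]. *)
Definition close_return (N p : nat) (r : R) (w : T) (o : nat) : bool :=
  (p + o <= N)%N &&
  (`|B (mesh_time N (p + o)) w - B (mesh_time N p) w| <= r).

Lemma measurable_close_return N p r o :
  measurable [set w | close_return N p r w o].
Proof.
rewrite /close_return; case: (p + o <= N)%N => /=; last first.
  by rewrite (_ : [set w | _] = set0)//; apply/seteqP; split.
have mI : measurable (`[- r, r]%classic : set R) by exact: measurable_itv.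
have := measurable_increment B (mesh_time N p) (mesh_time N (p + o)) measurableT mI.
rewrite setTI; congr (measurable _); apply/seteqP.
by split => w /=; rewrite in_itv/= ler_norml.
Qed.

Lemma bin_points_aboveE N p r m a k w :
  'C(points_above (close_return N p r w) m a, k.+1)%:R =
  \sum_(a.+1 <= z < m.+1) \1_[set w | close_return N p r w z] w *
    'C(points_above (close_return N p r w) m z, k)%:R :> R.
Proof.
rewrite bin_points_above natr_sum big_mkcond; apply: eq_bigr => z _.
rewrite indicE; case: ifPn => h.
  by rewrite mem_set// mul1r.
by rewrite memNset ?mul0r//; exact/negP.
Qed.

Lemma measurable_bin_points_above N p r m a k :
  measurable_fun setT (fun w => 'C(points_above (close_return N p r w) m a, k)%:R : R).
Proof.
elim: k a => [|k IH] a; first by under eq_fun do rewrite bin0; exact: measurable_cst.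
under eq_fun do rewrite bin_points_aboveE.
apply: measurable_sum => z; apply: measurable_funM; last exact: IH.
apply: measurable_indic; exact: measurable_close_return.
Qed.

(** The entries of [gs] are the gaps between consecutive returns decreased by 1, so
    that every sequence of naturals codes a strictly increasing chain of offsets. *)
Definition offset (gs : seq nat) (i : nat) : nat := \sum_(j < i) (nth 0 gs j).+1.

Lemma offset_rcons gs g i : (i <= size gs)%N -> offset (rcons gs g) i = offset gs i.
Proof.
move=> igs; apply: eq_bigr => j _; rewrite nth_rcons ifT//.
by rewrite (leq_trans (ltn_ord j)).
Qed.

Lemma offset_rcons_last gs g :
  offset (rcons gs g) (size gs).+1 = (offset gs (size gs) + g.+1)%N.
Proof.
by rewrite /offset big_ord_recr/= nth_rcons ltnn eqxx -/(offset _ _) offset_rcons.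
Qed.

Definition close_chain N p r (gs : seq nat) : set T :=
  [set w | forall i, (i < size gs)%N -> close_return N p r w (offset gs i.+1)].

Lemma measurable_close_chain N p r gs : measurable (close_chain N p r gs).
Proof.
rewrite (_ : close_chain N p r gs = \bigcap_(i in [set i | (i < size gs)%N])
    [set w | close_return N p r w (offset gs i.+1)]); last first.
  by apply/seteqP; split => w /= h i; exact: h.
by apply: fin_bigcap_measurable => [|i _]; [exact: finite_II|exact: measurable_close_return].
Qed.

Lemma close_chain_rcons N p r gs g w :
  close_chain N p r (rcons gs g) w <->
  close_chain N p r gs w /\ close_return N p r w (offset gs (size gs) + g.+1).
Proof.
split => [h|[h1 h2] i].
  split=> [i igs|].
    have := h i; rewrite size_rcons offset_rcons//; apply.
    by rewrite ltnS ltnW.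
  have := h (size gs); rewrite size_rcons offset_rcons_last; exact.
rewrite size_rcons ltnS leq_eqVlt => /predU1P[->|igs].
  by rewrite offset_rcons_last.
by rewrite offset_rcons//; exact: h1.
Qed.

(** The list [gs] records the returns chosen so far and [k] is the number of those
    still to be chosen. Choosing the next one by its gap [j] turns the binomial
    coefficient over [k.+1] into a sum of binomial coefficients over [k] for the
    longer lists, and multiplies the bound by the factor of that gap; the sum over
    the gaps gives one factor [S]. For [k = 0] only the probability of the chain is
    left, which is the small-ball estimate. *)
Lemma expected_close_chains : exists2 K : R, 0 < K &
  forall (N p m k : nat) (r : R) (gs : seq nat), (0 < N)%N -> 0 < r ->
  let S := \sum_(j < m) K * r * N%:R `^ alpha * j.+1%:R `^ (- alpha) in
  (\int[P]_w (\1_(close_chain N p r gs) w *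
      'C(points_above (close_return N p r w) m (offset gs (size gs)), k)%:R)%:E <=
   ((\prod_(g <- gs) (K * r * N%:R `^ alpha * g.+1%:R `^ (- alpha))) * S ^+ k)%:E)%E.
Proof.
have [c c0 sb] := fbm_small_ball alpha01 fbmB.
exists (2 / c); first by rewrite divr_gt0.
move=> N p m k r gs N0 r0; cbv zeta.
set q := 2 / c * r * N%:R `^ alpha.
have N0r : 0 < N%:R :> R by rewrite ltr0n.
have q0 : 0 <= q by rewrite !mulr_ge0 ?powR_ge0 ?invr_ge0 ?(ltW c0) ?(ltW r0).
have mC gs' k' : measurable_fun setT (fun w => (\1_(close_chain N p r gs') w *
    'C(points_above (close_return N p r w) m (offset gs' (size gs')), k')%:R : R)).
  apply: measurable_funM; first by apply: measurable_indic; exact: measurable_close_chain.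
  exact: measurable_bin_points_above.
elim: k gs => [|k IH] gs.
  rewrite expr0 mulr1; under eq_integral do rewrite bin0 mulr1.
  rewrite integral_indic//; last exact: measurable_close_chain.
  rewrite setIT.
  have [pN|Np] := leqP (p + offset gs (size gs)) N; last first.
    have [gs0|gs0] := posnP (size gs).
      by rewrite (size0nil gs0) big_nil probability_le1//; exact: measurable_close_chain.
    rewrite (_ : close_chain N p r gs = set0) ?measure0.
      by rewrite lee_fin prodr_ge0// => i _; rewrite mulr_ge0 ?powR_ge0.
    apply/seteqP; split => // w /= /(_ (size gs).-1).
    by rewrite ltn_predL prednK// => /(_ gs0); rewrite /close_return leqNgt Np.
  pose s (i : nat) : R := (offset gs i)%:R / N%:R.
  have s0 : s 0%N = 0 by rewrite /s /offset big_ord0 mul0r.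
  have sE i : s i.+1 - s i = (nth 0%N gs i).+1%:R / N%:R.
    by rewrite /s /offset big_ord_recr/= natrD mulrDl addrAC subrr add0r.
  have sS i : s i < s i.+1.
    by rewrite -subr_gt0 sE divr_gt0// ltr0n.
  have tE i : mesh_time N p + s i = mesh_time N (p + offset gs i).
    by rewrite /mesh_time /s natrD mulrDl.
  have := sb (size gs) s (mesh_time N p) r s0 sS _ _ r0.
  rewrite tE => /(_ _ _)sb'.
  have {}sb' := sb' ltac:(by rewrite divr_ge0) ltac:(by rewrite /mesh_time ler_pdivrMr// mul1r ler_nat).
  rewrite (_ : \prod_(g <- gs) _ = \prod_(i < size gs) (2 * r / (c * (s i.+1 - s i) `^ alpha))); last first.
    rewrite (big_nth 0%N) big_mkord; apply: eq_bigr => i _.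
    rewrite sE powRM// ?invr_ge0// -(powR_inv1 (ltW N0r)) -powRrM mulN1r !powRN /q.
    by field; rewrite !gt_eqF ?powR_gt0//.
  apply: le_trans sb'; apply: le_measure; rewrite ?inE.
  - exact: measurable_close_chain.
  - rewrite (_ : mkset _ = \bigcap_(i in [set: 'I_(size gs)])
        [set w | `|B (mesh_time N p + s i.+1) w - B (mesh_time N p) w| <= r]); last first.
      by apply/seteqP; split => [w h i _|w h i] /=; exact: h.
    apply: fin_bigcap_measurable; first exact: finite_finset.
    move=> i _.
    have mI : measurable (`[- r, r]%classic : set R) by exact: measurable_itv.
    have := measurable_increment B (mesh_time N p) (mesh_time N p + s i.+1) measurableT mI.
    rewrite setTI; congr (measurable _); apply/seteqP.
    by split => w /=; rewrite in_itv/= ler_norml.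
  - move=> w /= h i; rewrite tE; have := h i (ltn_ord i).
    by rewrite /close_return => /andP[].
pose a := offset gs (size gs).
have step w : (\1_(close_chain N p r gs) w *
    'C(points_above (close_return N p r w) m a, k.+1)%:R : R) <=
  \sum_(j < m) \1_(close_chain N p r (rcons gs j)) w *
    'C(points_above (close_return N p r w) m (offset (rcons gs j) (size (rcons gs j))), k)%:R.
  rewrite bin_points_aboveE mulr_sumr.
  have mono : \sum_(a.+1 <= z < m.+1) \1_(close_chain N p r gs) w *
      (\1_[set w | close_return N p r w z] w *
       'C(points_above (close_return N p r w) m z, k)%:R) <=
     \sum_(j < m) \1_(close_chain N p r gs) w *
      (\1_[set w | close_return N p r w (a + j.+1)] w *
       'C(points_above (close_return N p r w) m (a + j.+1), k)%:R) :> R.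
    rewrite -[a.+1]add0n big_addn subSS -(big_mkord predT (fun j => _ * (\1_[set w |
      close_return N p r w (a + j.+1)] w * 'C(points_above _ m (a + j.+1), k)%:R))).
    rewrite [leRHS](@big_cat_nat _ _ _ (m - a)) ?leq_subr//=.
    rewrite [X in _ <= X + _](_ : _ = \sum_(0 <= i < m - a) \1_(close_chain N p r gs) w *
      (\1_[set w | close_return N p r w (i + a.+1)] w *
       'C(points_above (close_return N p r w) m (i + a.+1), k)%:R)).
      by rewrite lerDl sumr_ge0// => j _; rewrite !mulr_ge0.
    by apply: eq_bigr => j _; rewrite addnS -addSn addnC.
  apply: (le_trans mono); apply: ler_sum => j _.
  rewrite size_rcons offset_rcons_last -/a mulrA ler_wpM2r//.
  rewrite le_eqVlt; apply/orP; left; apply/eqP.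
  rewrite !indicE -natrM mulnb; congr (nat_of_bool _)%:R.
  by apply/andP/idP; rewrite !inE/= => /close_chain_rcons.
apply: (@le_trans _ _ (\int[P]_w (\sum_(j < m) (\1_(close_chain N p r (rcons gs j)) w *
    'C(points_above (close_return N p r w) m (offset (rcons gs j) (size (rcons gs j))), k)%:R)%:E))%E).
  apply: ge0_le_integral => //.
  - by apply/measurable_EFinP; exact: mC.
  - by apply: emeasurable_sum => j; apply/measurable_EFinP; exact: mC.
  - by move=> w _; rewrite sumEFin lee_fin; exact: step.
rewrite ge0_integral_sum//; last first.
  by move=> j; apply/measurable_EFinP; exact: mC.
apply: le_trans; first by apply: lee_sum => j _; exact: IH.
rewrite sumEFin lee_fin -mulr_suml exprS mulrA ler_wpM2r//.
  by rewrite exprn_ge0// sumr_ge0// => j _; rewrite mulr_ge0 ?powR_ge0.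
rewrite mulr_sumr le_eqVlt; apply/orP; left; apply/eqP; apply: eq_bigr => j _.
by rewrite -cats1 big_cat big_seq1.
Qed.

End close_returns.

Section many_returns.
Context {R : realType} {d : measure_display} {T : measurableType d}.
Variables (P : probability T R) (alpha : R) (B : R -> {RV P >-> R}).
Hypothesis alpha01 : 0 < alpha < 1.
Hypothesis fbmB : fractional_brownian_motion alpha `[0, 1] B.

(** Markov's inequality for the binomial coefficient of the number of returns over
    [k], which is at least [y ^ k] on the event. *)
Lemma many_returns_unlikely : exists2 K : R, 0 < K &
  forall (N p m k y : nat) (r : R), (0 < N)%N -> 0 < r -> (0 < y)%N ->
  (P [set w | (k * y <= points_above (close_return B N p r w) m 0)%N] <=
   (((\sum_(j < m) K * r * N%:R `^ alpha * j.+1%:R `^ (- alpha)) / y%:R) ^+ k)%:E)%E.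
Proof.
have [K K0 H] := expected_close_chains alpha01 fbmB.
exists K => // N p m k y r N0 r0 y0.
have := H N p m k r [::] N0 r0; cbv zeta; rewrite big_nil mul1r.
set S := \sum_(j < m) _.
have off0 : offset [::] 0 = 0%N by rewrite /offset big_ord0.
have chain0 w : close_chain B N p r [::] w by [].
have -> : (\int[P]_w (\1_(close_chain B N p r [::]) w *
    'C(points_above (close_return B N p r w) m (offset [::] (size (@nil nat))), k)%:R)%:E =
    \int[P]_w ('C(points_above (close_return B N p r w) m 0, k)%:R)%:E)%E.
  by apply: eq_integral => w _; rewrite off0 indicE mem_set// mul1r.
have mC := measurable_bin_points_above B N p r m 0.
move=> HS; set A := [set w | _].
have mA : measurable A.
  have := mC 1%N measurableT `[(k * y)%:R, +oo[%classic (measurable_itv _).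
  rewrite setTI; congr (measurable _); apply/seteqP.
  by split => w /=; rewrite bin1 in_itv/= andbT ler_nat.
have yk0 : 0 < y%:R ^+ k :> R by rewrite exprn_gt0// ltr0n.
rewrite expr_div_n EFinM -lee_pdivrMr//.
apply: le_trans HS; rewrite invrK.
rewrite -(setIT A) -integral_indic// -ge0_integralZr//; last first.
  by apply/measurable_EFinP; exact: measurable_indic.
apply: ge0_le_integral => //.
- by apply: emeasurable_funM => //; apply/measurable_EFinP; exact: measurable_indic.
- by apply/measurable_EFinP; exact: mC.
- move=> w _; rewrite -EFinM lee_fin indicE.
  have [|_] := boolP (w \in A); last by rewrite mul0r.
  rewrite inE /A/= => kyw; rewrite mul1r -natrX ler_nat.
  by apply: (leq_trans (expn_le_bin k y0)); exact: leq_bin2l.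
- by rewrite invr_gt0.
Qed.

(** Young's inequality for the product of [(1 - u) `^ b] and 1. *)
Lemma powR_bernoulli (b u : R) : 0 < b < 1 -> 0 <= u <= 1 -> (1 - u) `^ b <= 1 - b * u.
Proof.
move=> /andP[b0 b1] /andP[u0 u1].
have b1' : 0 < 1 - b by rewrite subr_gt0.
have := @conjugate_powR R ((1 - u) `^ b) 1 b^-1 (1 - b)^-1.
rewrite -powRrM mulfV ?gt_eqF// powRr1 ?subr_ge0// powR1 mulr1 !invrK.
move=> /(_ _ _ _ _ _)H; apply: le_trans (H _ _ _ _ _) _ => //.
- exact: powR_ge0.
- by rewrite invr_gt0.
- by rewrite invr_gt0.
- by rewrite addrCA subrr addr0.
- lra.
Qed.

(** Bernoulli's inequality bounds each term by an increment of the right-hand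
    side. *)
Lemma sum_powR_le (m : nat) :
  \sum_(j < m) (j.+1%:R : R) `^ (- alpha) <= m%:R `^ (1 - alpha) / (1 - alpha).
Proof.
have /andP[a0 a1] := alpha01; have b0 : 0 < 1 - alpha by rewrite subr_gt0.
rewrite ler_pdivlMr//; elim: m => [|m IH].
  by rewrite big_ord0 mul0r powR_ge0.
rewrite big_ord_recr/= mulrDl -lerBrDr; apply: (le_trans IH).
have x0 : 0 < m.+1%:R :> R by rewrite ltr0n.
have -> : m%:R = m.+1%:R * (1 - m.+1%:R^-1) :> R.
  by rewrite mulrBr mulr1 mulfV ?gt_eqF// -natr1 addrK.
have u1 : m.+1%:R^-1 <= 1 :> R by rewrite invf_le1// ler1n.
have u0 : 0 <= m.+1%:R^-1 :> R by rewrite invr_ge0.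
rewrite powRM ?subr_ge0//.
have -> : m.+1%:R `^ (1 - alpha) - m.+1%:R `^ (- alpha) * (1 - alpha) =
   m.+1%:R `^ (1 - alpha) * (1 - (1 - alpha) * m.+1%:R^-1) :> R.
  rewrite powRD ?powRr1//; last by rewrite (gt_eqF x0) implybT.
  by field; rewrite gt_eqF.
rewrite ler_wpM2l ?powR_ge0//; apply: powR_bernoulli; apply/andP; split => //; lra.
Qed.

Lemma Borel_Cantelli_geometric (F : nat -> set T) (C : R) :
  (forall n, measurable (F n)) -> (forall n, (P (F n) <= (C * 2^-1 ^+ n)%:E)%E) ->
  P.-negligible (lim_sup_set F).
Proof.
move=> mF FC.
have mlim : measurable (lim_sup_set F).
  by apply: bigcapT_measurable => n; apply: bigcup_measurable.
apply/negligibleP => //; apply: lim_sup_set_cvg0 => //.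
have C0 : 0 <= C.
  by have := FC 0%N; rewrite expr0 mulr1 => /(le_trans _); rewrite -lee_fin; apply.
apply: (@le_lt_trans _ _ (\sum_(0 <= n <oo) (C * 2^-1 ^+ n)%:E)%E).
  by apply: lee_nneseries => n *; [exact: measure_ge0|exact: FC].
have := @cvg_geometric_eseries_half R (2 * C) 0.
rewrite (_ : eseries _ = eseries (fun n => (C * 2^-1 ^+ n)%:E)); last first.
  apply/funext => n; rewrite /eseries/=; apply: eq_bigr => i _; congr EFin.
  by rewrite natrX addn1 exprS exprVn; field; rewrite expf_neq0.
by move=> /cvg_lim h; rewrite [X in (X < _)%E]h// ltry.
Qed.
End many_returns.

(** * Events of which only finitely many occur *)

Section exceptional_events.
Context {R : realType} {d : measure_display} {T : measurableType d}.
Variables (P : probability T R) (alpha : R) (B : R -> {RV P >-> R}) (M : nat).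
Hypothesis alpha01 : 0 < alpha < 1.
Hypothesis fbmB : fractional_brownian_motion alpha `[0, 1] B.
Hypothesis M_ge2 : (2 <= M)%N.

Lemma union_bound (A : nat -> set T) (N : nat) (c : R) :
  (forall p, measurable (A p)) -> (forall p, (p < N)%N -> (P (A p) <= c%:E)%E) ->
  (P (\big[setU/set0]_(p < N) A p) <= (N%:R * c)%:E)%E.
Proof.
move=> mA Ac; apply: le_trans; first by apply: Boole_inequality => p _; exact: mA.
apply: (@le_trans _ _ (\sum_(p < N) c%:E)%E).
  by apply: lee_sum => p _; exact: Ac.
by rewrite sumEFin sumr_const card_ord lee_fin mulr_natl.
Qed.

Lemma mesh_size_gt0 n : (0 < M ^ n)%N.
Proof. by rewrite expn_gt0; lia. Qed.

Lemma mesh_size_inv_le n : (M ^ n)%:R^-1 <= 2^-1 ^+ n :> R.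
Proof.
rewrite exprVn lef_pV2 ?posrE ?exprn_gt0// ?ltr0n ?mesh_size_gt0//.
by rewrite -natrX ler_nat; case: n => // n; rewrite leq_exp2r.
Qed.

(** One term of the exponential series. *)
Lemma expRN_le_power (j : nat) (u : R) : 0 < u -> expR (- u) <= j.+1`!%:R / u ^+ j.+1.
Proof.
move=> u0; rewrite expRN -[leRHS]invrK lef_pV2 ?posrE ?expR_gt0 ?invr_gt0 ?divr_gt0 ?exprn_gt0 ?ltr0n ?fact_gt0//.
rewrite invf_div; apply: le_trans (expR_ge1Dxn j (ltW u0)).
by rewrite lerDr.
Qed.

Definition rough_at (eps : R) (n p : nat) : set T :=
  [set w | (M ^ n)%:R `^ (eps - alpha) <
    `|B (mesh_time (M ^ n) p.+1) w - B (mesh_time (M ^ n) p) w|].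

Definition rough_event (eps : R) (n : nat) : set T :=
  \big[setU/set0]_(p < M ^ n) rough_at eps n p.

Lemma measurable_rough eps n p : measurable (rough_at eps n p).
Proof.
rewrite /rough_at; set r := _ `^ _.
have mI : measurable (~` `[- r, r]%classic : set R).
  by apply: measurableC; exact: measurable_itv.
have := measurable_increment B (mesh_time (M ^ n) p) (mesh_time (M ^ n) p.+1) measurableT mI.
rewrite setTI; congr (measurable _); apply/seteqP.
by split => w /=; rewrite in_itv/= -ler_norml ltNge => /negP.
Qed.

(** A mesh increment has standard deviation [(M ^ n) ^ (- alpha)], so that exceeding
    it by the factor [(M ^ n) ^ eps] has a probability that decays faster than every
    power of [M ^ n]; the second power suffices against the [M ^ n] choices of [p]. *)
Lemma rough_events_negligible (eps : R) : 0 < eps ->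
  P.-negligible (lim_sup_set (rough_event eps)).
Proof.
move=> eps0; have /andP[a0 a1] := alpha01.
pose j := Num.truncn eps^-1.
have epsj : 1 <= eps * j.+1%:R.
  by rewrite -ler_pdivrMl// mulr1 ltW// truncnS_gt.
pose C := 2 * (j.+1`!%:R * 4 ^+ j.+1) : R.
apply: (@Borel_Cantelli_geometric _ _ _ P _ C) => n.
  by apply: bigsetU_measurable => p _; exact: measurable_rough.
set N := (M ^ n)%N; have N0 : (0 < N)%N by exact: mesh_size_gt0.
have N0r : 0 < N%:R :> R by rewrite ltr0n.
have N1 : 1 <= N%:R :> R by rewrite ler1n.
have bound : (P (rough_event eps n) <= (N%:R * (C / N%:R ^+ 2))%:E)%E.
  apply: union_bound.
  - by move=> p; exact: measurable_rough.
  - move=> p pN.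
    have st : mesh_time N p < mesh_time N p.+1 :> R.
      by rewrite /mesh_time ltr_pM2r ?invr_gt0// ltr_nat.
    have s0 : 0 <= mesh_time N p :> R by rewrite divr_ge0.
    have t1 : mesh_time N p.+1 <= 1 :> R by rewrite /mesh_time ler_pdivrMr// mul1r ler_nat.
    have x0 : 0 <= N%:R `^ eps :> R by exact: powR_ge0.
    have := fbm_increment_tail fbmB s0 st t1 x0.
    have -> : mesh_time N p.+1 - mesh_time N p = N%:R^-1 :> R.
      by rewrite /mesh_time -mulrBl -natr1 addrAC subrr add0r mul1r.
    rewrite -(powR_inv1 (ltW N0r)) -powRrM mulN1r -powRD; last by rewrite (gt_eqF N0r) implybT.
    move=> /le_trans; apply; rewrite lee_fin /C -(mulrA 2) -(mulrA j.+1`!%:R) ler_wpM2l//.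
    have u0 : 0 < (N%:R `^ eps) ^+ 2 / 4 :> R by rewrite divr_gt0// exprn_gt0// powR_gt0.
    apply: (le_trans (expRN_le_power j u0)); rewrite ler_wpM2l//.
    rewrite expr_div_n invf_div ler_wpM2l ?exprn_ge0//.
    rewrite lef_pV2 ?posrE ?exprn_gt0 ?powR_gt0//.
    rewrite -exprM mulnC exprM ler_sqr ?nnegrE ?exprn_ge0 ?powR_ge0//.
    rewrite -powR_mulrn ?powR_ge0// -powRrM -[leLHS]powRr1 ?(ltW N0r)//.
    exact: ler_powR.
apply: (le_trans bound).
rewrite lee_fin (_ : N%:R * (C / N%:R ^+ 2) = C * N%:R^-1); last by field; rewrite gt_eqF.
by rewrite ler_wpM2l ?mesh_size_inv_le// /C !mulr_ge0// exprn_ge0.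
Qed.

(** One factor [(M ^ n) ^ eps] is the oscillation of the path inside a mesh interval
    relative to [(M ^ n) ^ (- alpha)]; the second one absorbs constants. *)
Definition return_radius (eps : R) (n : nat) : R := (M ^ n)%:R `^ (2 * eps - alpha).

(** The expected number of returns within [M ^ (n %/ h)] steps carries the factor
    [(M ^ n) ^ (2 * eps)] of the radius; the third power of [(M ^ n) ^ eps] is the
    room from which the moment of order [k] gains [(M ^ n) ^ (- eps * k)]. *)
Definition return_bound (eps : R) (h n : nat) : nat :=
  (Num.truncn ((M ^ (n %/ h))%:R `^ (1 - alpha) * (M ^ n)%:R `^ (3 * eps) : R)).+1.

Definition crowded_at (eps : R) (h k n p : nat) : set T :=
  [set w | (k * return_bound eps h n <=
    points_above (close_return B (M ^ n) p (return_radius eps n) w) (M ^ (n %/ h)) 0)%N].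

Definition crowded_event (eps : R) (h k n : nat) : set T :=
  \big[setU/set0]_(p < M ^ n) crowded_at eps h k n p.

Lemma measurable_crowded eps h k n p : measurable (crowded_at eps h k n p).
Proof.
have mI : measurable (`[(k * return_bound eps h n)%:R, +oo[%classic : set R).
  exact: measurable_itv.
have := measurable_bin_points_above B (M ^ n) p (return_radius eps n) (M ^ (n %/ h)) 0 1
  measurableT mI.
rewrite setTI; congr (measurable _); apply/seteqP.
by split => w /=; rewrite bin1 in_itv/= andbT ler_nat.
Qed.

(** The condition on [k] makes the probability for one starting point of order
    [(M ^ n) ^ (- 2)], which leaves a summable bound after the union over the
    [M ^ n] starting points. *)
Lemma crowded_events_negligible (eps : R) (h k : nat) : 0 < eps -> 2 <= eps * k%:R ->
  P.-negligible (lim_sup_set (crowded_event eps h k)).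
Proof.
move=> eps0 epsk; have /andP[a0 a1] := alpha01.
have [K K0 HK] := many_returns_unlikely alpha01 fbmB.
pose C := (K / (1 - alpha)) ^+ k.
have b0 : 0 < 1 - alpha by rewrite subr_gt0.
have KK0 : 0 < K / (1 - alpha) by rewrite divr_gt0.
apply: (@Borel_Cantelli_geometric _ _ _ P _ C) => n.
  by apply: bigsetU_measurable => p _; exact: measurable_crowded.
set N := (M ^ n)%N; have N0 : (0 < N)%N by exact: mesh_size_gt0.
have N0r : 0 < N%:R :> R by rewrite ltr0n.
have N1 : 1 <= N%:R :> R by rewrite ler1n.
have bound : (P (crowded_event eps h k n) <= (N%:R * (C / N%:R ^+ 2))%:E)%E.
  apply: union_bound.
  - by move=> p; exact: measurable_crowded.
  - move=> p pN.
    set m := (M ^ (n %/ h))%N; set y := return_bound eps h n.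
    have m0 : 0 < m%:R :> R by rewrite ltr0n mesh_size_gt0.
    have r0 : 0 < return_radius eps n by exact: powR_gt0.
    have y0 : (0 < y)%N by [].
    apply: (le_trans (HK N p m k y _ N0 r0 y0)); rewrite lee_fin.
    have yge : m%:R `^ (1 - alpha) * N%:R `^ (3 * eps) <= y%:R :> R by rewrite ltW// truncnS_gt.
    have q0 : 0 < m%:R `^ (1 - alpha) * N%:R `^ (3 * eps) :> R by rewrite mulr_gt0// powR_gt0.
    have y0r : 0 < y%:R :> R by rewrite ltr0n.
    have NN : N%:R `^ (2 * eps - alpha) * N%:R `^ alpha = N%:R `^ (2 * eps) :> R.
      by rewrite -powRD ?subrK// (gt_eqF N0r) implybT.
    have step : (\sum_(j < m) K * return_radius eps n * N%:R `^ alpha * j.+1%:R `^ (- alpha)) / y%:R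
        <= K / (1 - alpha) * N%:R `^ (- eps).
      rewrite -mulr_sumr -(mulrA K) /return_radius NN ler_pdivrMr//.
      apply: (@le_trans _ _ (K * N%:R `^ (2 * eps) * (m%:R `^ (1 - alpha) / (1 - alpha)))).
        by rewrite ler_wpM2l ?sum_powR_le// mulr_ge0 ?powR_ge0// ltW.
      apply: (@le_trans _ _ (K / (1 - alpha) * N%:R `^ (- eps) *
          (m%:R `^ (1 - alpha) * N%:R `^ (3 * eps)))); last first.
        by rewrite ler_wpM2l// mulr_ge0 ?powR_ge0// ltW.
      have -> : N%:R `^ (2 * eps) = N%:R `^ (- eps) * N%:R `^ (3 * eps) :> R.
        rewrite -powRD; last by rewrite (gt_eqF N0r) implybT.
        by congr (_ `^ _); ring.
      by rewrite le_eqVlt; apply/orP; left; apply/eqP; field; rewrite gt_eqF.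
    apply: (@le_trans _ _ ((K / (1 - alpha) * N%:R `^ (- eps)) ^+ k)).
      apply: lerXn2r => //; rewrite nnegrE.
        rewrite divr_ge0// sumr_ge0// => j _.
        by rewrite !mulr_ge0 ?powR_ge0// ltW.
      by rewrite mulr_ge0 ?powR_ge0// ltW.
    rewrite exprMn -/C ler_wpM2l ?exprn_ge0 ?(ltW KK0)//.
    rewrite -powR_mulrn ?powR_ge0// -powRrM mulNr powRN lef_pV2 ?posrE ?powR_gt0 ?exprn_gt0//.
    by rewrite -powR_mulrn ?(ltW N0r)//; exact: ler_powR.
apply: (le_trans bound).
rewrite lee_fin (_ : N%:R * (C / N%:R ^+ 2) = C * N%:R^-1); last by field; rewrite gt_eqF.
by rewrite ler_wpM2l ?mesh_size_inv_le// exprn_ge0// ltW.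
Qed.

End exceptional_events.

(** * Oscillation of a path inside the mesh intervals *)

Section oscillation.
Context {R : realType}.
Variables (b : R -> R) (M : nat) (beta : R) (n0 : nat).
Hypothesis M_ge2 : (2 <= M)%N.
Hypothesis beta0 : 0 < beta.
Hypothesis cb : {within `[0, 1], continuous b}.
Hypothesis rough : forall n p, (n0 <= n)%N -> (p < M ^ n)%N ->
  `|b (mesh_time (M ^ n) p.+1) - b (mesh_time (M ^ n) p)| <= (M ^ n)%:R `^ (- beta).

Local Notation theta := (M%:R `^ (- beta) : R).

Lemma powR_mesh_size (n : nat) (x : R) : (M ^ n)%:R `^ x = (M%:R `^ x) ^+ n :> R.
Proof. by rewrite natrX -powR_mulrn// -powR_mulrn ?powR_ge0// powRAC. Qed.

Lemma theta_lt1 : 0 < theta < 1.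
Proof.
have M0 : 0 < M%:R :> R by rewrite ltr0n; lia.
rewrite powR_gt0//= powRN invf_lt1 ?powR_gt0//.
rewrite -[X in X < _](_ : 1 `^ beta = 1); last by rewrite powR1.
apply: gt0_ltr_powR => //; rewrite ?nnegrE//.
by rewrite ltr1n.
Qed.

Lemma mesh_steps n p i : (n0 <= n)%N -> (p + i <= M ^ n)%N ->
  `|b (mesh_time (M ^ n) (p + i)) - b (mesh_time (M ^ n) p)| <= i%:R * theta ^+ n.
Proof.
move=> n0n; elim: i => [|i IH] pi; first by rewrite addn0 subrr normr0 mul0r.
rewrite addnS in pi *.
rewrite -(subrK (b (mesh_time (M ^ n) (p + i))) (b (mesh_time (M ^ n) (p + i).+1))) -addrA.
rewrite (le_trans (ler_normD _ _))// -natr1 mulrDl mul1r [leLHS]addrC lerD//.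
  by apply: IH; exact: ltnW.
by rewrite -powR_mesh_size; exact: rough.
Qed.

(** This is the sum of [M * theta ^ i] over all [i >= 1]: at most [M] mesh steps are
    made at each level finer than the given one. *)
Definition chaining_constant : R := M%:R * theta / (1 - theta).

Lemma mesh_index (n p : nat) (t : R) :
  mesh_time (M ^ n) p <= t < mesh_time (M ^ n) p.+1 -> Num.truncn (t * (M ^ n)%:R) = p.
Proof.
have N0 : 0 < (M ^ n)%:R :> R by rewrite ltr0n expn_gt0; lia.
rewrite /mesh_time ler_pdivrMr// ltr_pdivlMr// => /andP[h1 h2].
by apply: truncn_def; rewrite h1.
Qed.

(** The left end points [tau m] of the mesh intervals of level [m] around [t]
    converge to [t], and going from [tau m] to [tau m.+1] takes fewer than [M] steps
    of level [m.+1]. Summing the geometric series bounds the increments between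
    [tau n] and all later [tau m], and continuity at [t] concludes. *)
Lemma oscillation_bound n p (t : R) : (n0 <= n)%N -> (p < M ^ n)%N ->
  mesh_time (M ^ n) p <= t < mesh_time (M ^ n) p.+1 ->
  `|b t - b (mesh_time (M ^ n) p)| <= chaining_constant * (M ^ n)%:R `^ (- beta).
Proof.
move=> n0n pn tp.
have /andP[th0 th1] := theta_lt1.
have M0 : (0 < M)%N by lia.
have N0 m : 0 < (M ^ m)%:R :> R by rewrite ltr0n expn_gt0 M0.
have C0 : 0 <= chaining_constant.
  by rewrite divr_ge0// ?mulr_ge0 ?(ltW th0)// subr_ge0 ltW.
have t0 : 0 <= t by case/andP: tp => + _; apply: le_trans; rewrite divr_ge0.
have t1 : t < 1.
  case/andP: tp => _ /lt_le_trans; apply.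
  by rewrite /mesh_time ler_pdivrMr// mul1r ler_nat.
pose q m := Num.truncn (t * (M ^ m)%:R).
pose tau m : R := mesh_time (M ^ m) (q m).
have qn : q n = p by exact: mesh_index.
have qb m : (q m)%:R <= t * (M ^ m)%:R < (q m).+1%:R.
  by rewrite truncn_le ?mulr_ge0// truncnS_gt.
have qlt m : (q m < M ^ m)%N.
  rewrite -(ltr_nat R); case/andP: (qb m) => /le_lt_trans + _; apply.
  by rewrite gtr_pMl.
have q1 m : (M * q m <= q m.+1)%N.
  rewrite -ltnS -(ltr_nat R) natrM.
  case/andP: (qb m) => h1 _; case/andP: (qb m.+1) => _; apply: le_lt_trans.
  by rewrite expnS natrM mulrCA ler_wpM2l.
have q2 m : (q m.+1 < M * q m + M)%N.
  rewrite addnC -mulnS -(ltr_nat R) natrM.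
  case/andP: (qb m) => _ h2; case/andP: (qb m.+1) => + _; move=> /le_lt_trans; apply.
  by rewrite expnS natrM mulrCA ltr_pM2l// ltr0n.
have tauE m : tau m = mesh_time (M ^ m.+1) (M * q m).
  rewrite /tau /mesh_time expnS !natrM; field.
  by rewrite !pnatr_eq0 -!lt0n M0 expn_gt0 M0.
have step m : (n0 <= m)%N -> `|b (tau m.+1) - b (tau m)| <= M%:R * theta ^+ m.+1.
  move=> n0m; rewrite (tauE m) /tau -[q m.+1](subnKC (q1 m)).
  apply: le_trans (mesh_steps _ _) _.
  - by rewrite leqW.
  - by rewrite (subnKC (q1 m)) ltnW.
  rewrite ler_wpM2r ?exprn_ge0 ?(ltW th0)// ler_nat.
  by have := q2 m; have := q1 m; lia.
have chain l : `|b (tau (n + l)%N) - b (tau n)| <= chaining_constant * (theta ^+ n - theta ^+ (n + l)).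
  elim: l => [|l IH]; first by rewrite addn0 !subrr normr0 mulr0.
  rewrite addnS -(subrK (b (tau (n + l)%N)) (b (tau (n + l).+1))) -addrA.
  apply: le_trans (ler_normD _ _) _.
  have nl : (n0 <= n + l)%N by rewrite (leq_trans n0n)// leq_addr.
  apply: (le_trans (lerD (step _ nl) IH)).
  rewrite le_eqVlt; apply/orP; left; apply/eqP.
  rewrite /chaining_constant exprS; field.
  by rewrite subr_eq0 gt_eqF.
rewrite powR_mesh_size -qn -/(tau n).
apply/ler_addgt0Pr => e e0.
have [dl /= dl0 Hdl] : exists2 dl : R, 0 < dl & forall s : R, 0 <= s <= 1 -> `|t - s| < dl -> `|b t - b s| < e.
  have A t' : (0 <= t' <= 1) -> (`[0, 1]%classic : set R) t' by rewrite /= in_itv/=.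
  have /subspace_continuousP /(_ t (A t _)) := cb.
  rewrite t0 (ltW t1) => /(_ isT) /cvgrPdist_lt /(_ e e0).
  rewrite /within/= => /nbhs_ballP[dl /= dl0 H]; exists dl => // s s01 ts.
  by apply: H => //=; exact: A.
have [l ld] : exists l : nat, (M ^ (n + l))%:R^-1 < dl.
  exists (Num.truncn dl^-1).
  rewrite invf_plt ?posrE//; apply: (lt_le_trans (truncnS_gt _)).
  rewrite ler_nat; apply: (@leq_trans (2 ^ (Num.truncn dl^-1)))%N; first exact: ltn_expl.
  apply: (@leq_trans (M ^ Num.truncn dl^-1)%N).
    by case: (Num.truncn _) => // k; rewrite leq_exp2r.
  by rewrite leq_pexp2l// leq_addl.
have tl : `|t - tau (n + l)%N| < dl.
  apply: le_lt_trans ld.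
  have /andP[h1 h2] := qb (n + l)%N.
  rewrite /tau /mesh_time -{1}(mulfK (lt0r_neq0 (N0 (n + l)%N)) t) -mulrBl normrM.
  rewrite (gtr0_norm (_ : 0 < _^-1)) ?invr_gt0// ler_piMl ?invr_ge0//.
  by rewrite ger0_norm ?subr_ge0// lerBlDl natr1 ltW.
have tauI : 0 <= tau (n + l)%N <= 1.
  by rewrite divr_ge0//= ler_pdivrMr// mul1r ler_nat ltnW.
have := Hdl _ tauI tl.
have := chain l.
have : chaining_constant * (theta ^+ n - theta ^+ (n + l)) <= chaining_constant * theta ^+ n.
  by rewrite ler_wpM2l// gerBl exprn_ge0// ltW.
move=> h1 h2 h3; rewrite -(subrK (b (tau (n + l)%N)) (b t)) -addrA.
apply: le_trans (ler_normD _ _) _; rewrite [leLHS]addrC lerD//; last exact: ltW.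
exact: le_trans h1.
Qed.

End oscillation.

(** * The recursion for mesh counts *)

Section staircase.

(** Let [rk x] be the number of elements of [S'] below [x]. The sum
    [rk (r p) + j p] is nondecreasing in [p] and takes fewer than [#|S'| + J] values;
    two indices with the same sum have the same [r] and the same [j], because
    neither term can decrease. Hence the fibres of the sum are the fibres of the
    pair, and each of them is counted from its least element [p0]. *)
Lemma card_monotone_pair (N N' J Q : nat) (S : {pred 'I_N}) (S' : {pred 'I_N'})
    (r : 'I_N -> 'I_N') (j : 'I_N -> nat) :
  {in S, forall p, r p \in S'} -> {in S, forall p, (j p < J)%N} ->
  {in S &, forall p p' : 'I_N, (p <= p')%N -> (r p <= r p')%N} ->
  {in S &, forall p p' : 'I_N, (p <= p')%N -> (j p <= j p')%N} ->
  {in S, forall p0 : 'I_N,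
    (#|[pred p in S | [&& (p0 <= p)%N, r p == r p0 & j p == j p0]]| <= Q)%N} ->
  (#|S| <= (#|S'| + J) * Q)%N.
Proof.
move=> rS jJ r_mono j_mono fibQ.
pose rk (x : 'I_N') := #|[pred x' in S' | (x' < x)%N]|.
have rk_lt (x y : 'I_N') : x \in S' -> (x < y)%N -> (rk x < rk y)%N.
  move=> xS xy; apply: proper_card; apply/properP; split.
    by apply/fintype.subsetP => z; rewrite !inE => /andP[-> /ltn_trans]; apply.
  by exists x; rewrite !inE ?xS ?ltnn.
have rk_max x : x \in S' -> (rk x < #|S'|)%N.
  move=> xS; apply: proper_card; apply/properP; split.
    by apply/fintype.subsetP => z; rewrite !inE => /andP[].
  by exists x => //; rewrite !inE ltnn andbF.
have rk_mono (x y : 'I_N') : (x <= y)%N -> (rk x <= rk y)%N.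
  move=> xy; apply: subset_leq_card; apply/fintype.subsetP => z.
  by rewrite !inE => /andP[-> zx]; rewrite (leq_trans zx).
have gL p : p \in S -> (rk (r p) + j p < #|S'| + J)%N.
  by move=> pS; have := rk_max _ (rS _ pS); have := jJ _ pS; lia.
have [p1 /= p1S|S0] := pickP (mem S); last by rewrite eq_card0.
have L0 : (0 < #|S'| + J)%N by rewrite (leq_ltn_trans _ (gL _ p1S)).
pose g p : 'I_(#|S'| + J) := insubd (Ordinal L0) (rk (r p) + j p)%N.
have gE p : p \in S -> g p = (rk (r p) + j p)%N :> nat.
  by move=> pS; rewrite /g val_insubd gL.
rewrite -sum1_card (partition_big g predT)//=.
apply: (@leq_trans (\sum_(v < #|S'| + J) Q)); last by rewrite sum_nat_const card_ord.
apply: leq_sum => v _; rewrite sum1dep_card cardsE.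
have [p2 p2v|S0] := pickP (fun p => (p \in S) && (g p == v)); last by rewrite eq_card0.
have [p0 /andP[p0S /eqP p0v] p0min] := @arg_minnP _ p2 (fun p => (p \in S) && (g p == v)) (fun p => p : nat) p2v.
apply: leq_trans (fibQ p0 p0S); apply: subset_leq_card; apply/fintype.subsetP => p.
rewrite !inE => pv; have p0p := p0min p pv.
have /andP[pS /eqP gp] := pv; rewrite pS p0p/=.
have : (rk (r p) + j p = rk (r p0) + j p0)%N by rewrite -!gE// gp p0v.
have rr := r_mono _ _ p0S pS p0p; have jj := j_mono _ _ p0S pS p0p.
have kk := rk_mono _ _ rr.
move=> E; have jE : j p = j p0 by lia.
rewrite jE eqxx andbT eq_sym -val_eqE/= eqn_leq rr/= leqNgt; apply/negP => rlt.
by have := rk_lt _ _ (rS _ p0S) rlt; lia.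
Qed.

End staircase.

Section mesh_count_recursion.
Context {R : realType}.
Variables (b : R -> R) (M : nat) (A : set R).
Hypothesis M_ge2 : (2 <= M)%N.
Hypothesis A01 : A `<=` `[0, 1].
Hypothesis b_mono : forall s t, A s -> A t -> s <= t -> b s <= b t.

Definition mesh_hit (n p : nat) : Prop :=
  exists2 t, A t & mesh_time (M ^ n) p <= t < mesh_time (M ^ n) p.+1.

Lemma mesh_countE n :
  mesh_count A M n = #|[pred p : 'I_(M ^ n) | `[< mesh_hit n p >] ]|.
Proof.
apply: eq_card => p; rewrite !inE; apply: asbool_equiv_eq.
rewrite /mesh_hit /mesh_time natrX; split.
  by case=> t [At] /=; rewrite in_itv/= => tp; exists t.
by case=> t At tp; exists t; split => //=; rewrite in_itv/=.
Qed.

Variables (n q : nat) (beta C1 Cb rad : R) (Q : nat).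
Hypothesis qn : (q <= n)%N.
Hypothesis Cb_bound : forall t, 0 <= t <= 1 -> `|b t| <= Cb.
Hypothesis osc : forall p t, (p < M ^ n)%N ->
  mesh_time (M ^ n) p <= t < mesh_time (M ^ n) p.+1 ->
  `|b t - b (mesh_time (M ^ n) p)| <= C1 * (M ^ n)%:R `^ (- beta).
Hypothesis rad_large : (2 * C1 + 1) * (M ^ n)%:R `^ (- beta) <= rad.

Definition close_mesh (p o : nat) : bool := (p + o <= M ^ n)%N &&
  (`|b (mesh_time (M ^ n) (p + o)) - b (mesh_time (M ^ n) p)| <= rad).

Hypothesis uncrowded : forall p, (p < M ^ n)%N ->
  (points_above (close_mesh p) (M ^ q) 0 < Q)%N.

Let hit_point (p : nat) : R :=
  xget 0 [set t | A t /\ mesh_time (M ^ n) p <= t < mesh_time (M ^ n) p.+1].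

Let hit_pointP p : mesh_hit n p ->
  A (hit_point p) /\ mesh_time (M ^ n) p <= hit_point p < mesh_time (M ^ n) p.+1.
Proof.
move=> [t At tp]; rewrite /hit_point.
by have := @xgetPex _ 0 [set t | A t /\ mesh_time (M ^ n) p <= t < mesh_time (M ^ n) p.+1];
  apply; exists t.
Qed.

(** The values of the path on [A] are shifted by [Cb] to be nonnegative. *)
Let window (p : nat) : nat := Num.truncn ((b (hit_point p) + Cb) * (M ^ n)%:R `^ beta).

(** The first summand counts coarse intervals and the second one windows of values.
    Mesh intervals in the same coarse interval and the same window as the first one
    [p0] are close returns to the mesh point [p0]: the values at the two mesh points
    differ by at most one window and two oscillations, and the offset is less than
    [M ^ q]. The interval [p0] itself, of offset 0, is the additional element for
    which the strict inequality in [uncrowded] leaves room. *)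
Lemma mesh_count_recursion :
  (mesh_count A M n <=
   (mesh_count A M (n - q) + (Num.truncn (2 * Cb * (M ^ n)%:R `^ beta)).+1) * Q)%N.
Proof.
have M0 : (0 < M)%N by lia.
have N0 m : 0 < (M ^ m)%:R :> R by rewrite ltr0n expn_gt0 M0.
set X := (M ^ n)%:R `^ beta; have X0 : 0 < X by exact: powR_gt0.
have XV : (M ^ n)%:R `^ (- beta) = X^-1 :> R by rewrite powRN.
have hit01 p : mesh_hit n p -> 0 <= hit_point p <= 1.
  by move=> /hit_pointP[/A01]; rewrite /= in_itv.
have hitb p : mesh_hit n p -> 0 <= b (hit_point p) + Cb <= 2 * Cb.
  move=> /hit01/Cb_bound; rewrite ler_norml => /andP[h1 h2].
  by apply/andP; split; lra.
have hit_mono p p' : mesh_hit n p -> mesh_hit n p' -> (p <= p')%N ->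
    b (hit_point p) <= b (hit_point p').
  move=> /hit_pointP[Ap /andP[_ p1]] /hit_pointP[Ap' /andP[p2 _]] pp'.
  move: pp'; rewrite leq_eqVlt => /predU1P[->//|pp'].
  apply: b_mono => //; apply: ltW; apply: (lt_le_trans p1); apply: le_trans p2.
  by rewrite /mesh_time ler_pM2r ?invr_gt0// ler_nat.
have coarse_lt (p : 'I_(M ^ n)) : (p %/ M ^ q < M ^ (n - q))%N.
  by rewrite ltn_divLR ?expn_gt0 ?M0// -expnD subnK.
rewrite !mesh_countE.
apply: (@card_monotone_pair _ _ _ _ _ _ (fun p => Ordinal (coarse_lt p)) (fun p => window p)).
- move=> p; rewrite !inE => hp; have [Ap /andP[p1 p2]] := hit_pointP hp.
  exists (hit_point p) => //=.
  have E k : mesh_time (M ^ (n - q)) k = mesh_time (M ^ n) (k * M ^ q) :> R.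
    rewrite /mesh_time -{2}(subnK qn) expnD !natrM; field.
    by rewrite !pnatr_eq0 -!lt0n !expn_gt0 M0.
  rewrite !E; apply/andP; split.
    by apply: le_trans p1; rewrite /mesh_time ler_pM2r ?invr_gt0// ler_nat leq_trunc_div.
  apply: (lt_le_trans p2); rewrite /mesh_time ler_pM2r ?invr_gt0// ler_nat.
  by rewrite ltn_ceil// expn_gt0 M0.
- move=> p; rewrite inE => hpb; have /andP[h1 h2] := hitb _ hpb; rewrite ltnS /window -/X.
  by apply: le_truncn; rewrite ler_pM2r.
- by move=> p p' _ _ pp' /=; exact: leq_div2r.
- move=> p p'; rewrite !inE => hp hp' pp'; rewrite /window -/X.
  by apply: le_truncn; rewrite ler_pM2r// lerD2r; exact: hit_mono.
move=> p0; rewrite inE => hp0.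
apply: leq_trans (uncrowded (ltn_ord p0)).
set F := [pred p in _ | _].
have -> : #|F| = size [seq (p - p0)%N | p : 'I_(M ^ n) <- enum F].
  by rewrite size_map cardE.
have -> : points_above (close_mesh p0) (M ^ q) 0 =
    size [seq z <- index_iota 1 (M ^ q).+1 | close_mesh p0 z].
  by rewrite /points_above -big_filter sum1_size.
apply: (@uniq_leq_size _ _ (0%N :: _)).
  rewrite map_inj_in_uniq ?enum_uniq// => p p'.
  rewrite !mem_enum !inE => /andP[_ /and3P[p0p _ _]] /andP[_ /and3P[p0p' _ _]] pp'.
  by apply: val_inj => /=; lia.
move=> o /mapP[p]; rewrite mem_enum !inE => /andP[/asboolW hp /and3P[p0p /eqP rp /eqP jp]] ->.
have [->//|pnp0] := eqVneq (p - p0)%N 0%N.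
rewrite mem_filter mem_index_iota; apply/orP; right.
have pE : (p0 + (p - p0) = p)%N by rewrite subnKC.
have {}rp : (p %/ M ^ q = p0 %/ M ^ q)%N by move/(congr1 val): rp.
apply/andP; split; last first.
  rewrite lt0n pnp0/= ltnS.
  have := ltn_pmod p (_ : 0 < M ^ q)%N; rewrite expn_gt0 M0 => /(_ isT).
  have := divn_eq p (M ^ q); have := divn_eq p0 (M ^ q); rewrite rp.
  by set x := (_ * _)%N; lia.
rewrite /close_mesh pE (ltnW (ltn_ord p))/=; apply: le_trans rad_large.
have [_ tp] := hit_pointP hp; have [_ tp0] := hit_pointP hp0.
have o1 := osc (ltn_ord p) tp; have o2 := osc (ltn_ord p0) tp0.
have o3 : `|b (hit_point p) - b (hit_point p0)| <= X^-1.
  rewrite -[leRHS]mul1r ler_pdivlMr// -[X in _ * X](gtr0_norm X0) -normrM.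
  have /andP[h1 _] := hitb _ hp; have /andP[h2 _] := hitb _ hp0.
  have := truncn_itv (mulr_ge0 h1 (ltW X0)); have := truncn_itv (mulr_ge0 h2 (ltW X0)).
  rewrite -/X in jp; rewrite -[Num.truncn _]/(window p0) -[Num.truncn _]/(window p) jp.
  rewrite -natr1 => /andP[a1 a2] /andP[a3 a4].
  by rewrite mulrBl ler_norml; apply/andP; split; lra.
rewrite XV in o1 o2 *.
have -> : b (mesh_time (M ^ n) p) - b (mesh_time (M ^ n) p0) =
  - (b (hit_point p) - b (mesh_time (M ^ n) p)) +
  (b (hit_point p) - b (hit_point p0)) + (b (hit_point p0) - b (mesh_time (M ^ n) p0)) by ring.
apply: le_trans (ler_normD _ _) _.
rewrite (_ : (2 * C1 + 1) * X^-1 = C1 * X^-1 + X^-1 + C1 * X^-1); last by ring.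
by rewrite lerD// (le_trans (ler_normD _ _))// lerD// normrN.
Qed.

End mesh_count_recursion.

(** * From the recursion to the dimension *)

Section growth.
Context {R : realType}.
Variable M : nat.
Hypothesis M_ge2 : (2 <= M)%N.

Let M0 : 0 < M%:R :> R. Proof. by rewrite ltr0n; lia. Qed.
Let M1 : 1 <= M%:R :> R. Proof. by rewrite ler1n; lia. Qed.
Let pw (x : R) : R := M%:R `^ x.

Let pw_gt0 x : 0 < pw x. Proof. exact: powR_gt0. Qed.
Let pwD x y : pw (x + y) = pw x * pw y.
Proof. by rewrite /pw powRD// (gt_eqF M0) implybT. Qed.
Let pw_le x y : x <= y -> pw x <= pw y. Proof. exact: ler_powR. Qed.

Let powR_size (n : nat) (x : R) : (M ^ n)%:R `^ x = pw (n%:R * x).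
Proof. by rewrite /pw powRrM powR_mulrn// natrX. Qed.

Lemma mesh_power_unbounded (eps C : R) : 0 < eps ->
  exists n0 : nat, forall n, (n0 <= n)%N -> C <= (M ^ n)%:R `^ eps.
Proof.
move=> eps0; exists (Num.truncn ((C + 1) / eps)).+1 => n n0n.
have nC : (C + 1) / eps < n%:R.
  by apply: lt_le_trans (truncnS_gt _) _; rewrite ler_nat.
rewrite ltr_pdivrMr// in nC.
have en0 : 0 <= n%:R * eps by rewrite mulr_ge0// ltW.
have /andP[m1 m2] := truncn_itv en0.
set m := Num.truncn _ in m1 m2; rewrite powR_size.
apply: (@le_trans _ _ m%:R); first by rewrite -natr1 in m2; lra.
apply: (@le_trans _ _ (pw m%:R)); last exact: pw_le.
rewrite /pw powR_mulrn// -natrX ler_nat ltnW//.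
apply: (@leq_trans (2 ^ m)%N); first exact: ltn_expl.
by case: m {m1 m2} => // m; rewrite leq_exp2r.
Qed.

(** Induction on [n] with [D] the claimed exponent. In the first summand the
    hypothesis at [n - q] leaves the exponent [(n - q) * D + q * (1 - alpha)], which is
    [n * D] minus at least [4 * eta * q]; since [eta * q] is nearly [eps * n], this
    beats the error [3 * eps * n] by a factor large enough for the constants. In the
    second summand [q <= eta * n], and the surplus [4 * eta] of [D] over [alpha]
    covers [q * (1 - alpha)] and [3 * eps * n]. *)
Lemma recursive_growth (alpha eta C2 C3 : R) (h n1 : nat) (N : nat -> nat) :
  0 < alpha < 1 -> 0 < eta <= 1 -> (0 < h)%N -> h%:R^-1 <= eta ->
  0 <= C2 -> 0 <= C3 -> (forall n, (N n <= M ^ n)%N) ->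
  (forall n, (n1 <= n)%N ->
    (N n)%:R <= ((N (n - n %/ h)%N)%:R + C2 * (M ^ n)%:R `^ alpha) *
      (C3 * ((M ^ (n %/ h))%:R `^ (1 - alpha) * (M ^ n)%:R `^ (3 * (eta / h%:R))))) ->
  exists2 K : R, 0 < K & forall n,
    (N n)%:R <= K * (M ^ n)%:R `^ (Num.max (1 - alpha) alpha + 4 * eta).
Proof.
move=> /andP[a0 a1] /andP[e0 e1] h0 he C20 C30 NM rec.
set D := Num.max _ _ + _.
have h0r : 0 < h%:R :> R by rewrite ltr0n.
pose eps := eta / h%:R.
have eps0 : 0 < eps by rewrite divr_gt0.
have D1 : 1 - alpha + 4 * eta <= D by rewrite lerD2r le_max lexx.
have D2 : alpha + 4 * eta <= D by rewrite lerD2r le_max lexx orbT.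
have [n2 Hn2] := mesh_power_unbounded (2 * C3 * pw (4 * eta)) eps0.
pose n3 := maxn n1 (maxn n2 h).
pose K := 2 * (C2 * C3) + pw n3%:R.
have K0 : 0 < K by rewrite ltr_wpDl// !mulr_ge0.
exists K => // n; rewrite powR_size.
have [m] := ubnP n; elim: m n => // m IH n nm.
have D0 : 0 <= D by lra.
have [n3n|nn3] := leqP n3 n; last first.
  apply: (@le_trans _ _ (pw n3%:R)).
    apply: (@le_trans _ _ (M ^ n)%:R); first by rewrite ler_nat.
    rewrite natrX -powR_mulrn//; apply: pw_le; rewrite ler_nat.
    exact: ltnW.
  apply: (@le_trans _ _ K); first by rewrite lerDr !mulr_ge0.
  rewrite ler_peMr ?(ltW K0)// -[leLHS](powRr0 M%:R); apply: pw_le.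
  by rewrite mulr_ge0.
have n1n : (n1 <= n)%N by apply: leq_trans n3n; exact: leq_maxl.
have n2n : (n2 <= n)%N by apply: leq_trans n3n; rewrite !leq_max leqnn orbT.
have hn : (h <= n)%N by apply: leq_trans n3n; rewrite !leq_max leqnn !orbT.
set q := (n %/ h)%N.
have q0 : (0 < q)%N by rewrite divn_gt0.
have qn : (q <= n)%N by exact: leq_div.
apply: (le_trans (rec n n1n)); rewrite -/q -/eps.
rewrite (powR_size n alpha) (powR_size q (1 - alpha)) (powR_size n (3 * eps)).
have nqm : (n - q < m)%N.
  apply: (@leq_trans n); last by rewrite -ltnS.
  by rewrite ltn_subrL q0 (leq_trans q0 qn).
have {}IH := IH (n - q)%N nqm.
have q_ge : n%:R / h%:R - 1 <= q%:R :> R.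
  rewrite lerBlDr ler_pdivrMr// natr1 -natrM ler_nat ltnW//.
  exact: ltn_ceil.
have q_le : q%:R <= n%:R / h%:R :> R by rewrite ler_pdivlMr// -natrM ler_nat leq_trunc_div.
have n0 : 0 <= n%:R :> R by [].
rewrite mulrDl.
have W0 : 0 <= C3 * (pw (q%:R * (1 - alpha)) * pw (n%:R * (3 * eps))).
  by rewrite !mulr_ge0// ltW.
have epsn : eps * n%:R = eta * (n%:R / h%:R) by rewrite /eps; ring.
(* Each of the two summands takes half of the bound. *)
have T1 : (N (n - q)%N)%:R * (C3 * (pw (q%:R * (1 - alpha)) * pw (n%:R * (3 * eps))))
    <= K / 2 * pw (n%:R * D).
  apply: (le_trans (ler_wpM2r W0 IH)).
  have -> : n%:R * D = (n - q)%:R * D + (q%:R * (1 - alpha) + n%:R * (3 * eps))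
      + (q%:R * (D - (1 - alpha)) - n%:R * (3 * eps)).
    by rewrite natrB//; ring.
  rewrite 2!pwD -pwD.
  set Y := pw _; set Z := pw (_ + _); set V := pw (_ - _).
  (* The gain [V] over the exponent [n * D] pays for the constant. *)
  have C3V : C3 <= V / 2.
    rewrite ler_pdivlMr//.
    have := Hn2 n n2n; rewrite (powR_size n eps).
    move/(ler_wpM2r (ltW (pw_gt0 (- (4 * eta))))).
    rewrite -(mulrA (2 * C3)) -(pwD (4 * eta)) -(pwD (n%:R * eps)) subrr.
    rewrite [pw 0]powRr0 mulr1 => H.
    rewrite (mulrC C3); apply: (le_trans H).
    rewrite /V; apply: pw_le.
    have qD : q%:R * (4 * eta) <= q%:R * (D - (1 - alpha)).
      by rewrite ler_wpM2l//; lra.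
    have qe : (n%:R / h%:R - 1) * (4 * eta) <= q%:R * (4 * eta).
      by rewrite ler_wpM2r//; lra.
    have : n%:R * eps = eta * (n%:R / h%:R) by rewrite mulrC.
    lra.
  rewrite -(mulrA K Y) (_ : K / 2 * (Y * Z * V) = K * (Y * (V / 2 * Z))); last by field.
  rewrite ler_wpM2l ?(ltW K0)// ler_wpM2l ?(ltW (pw_gt0 _))//.
  exact: (ler_wpM2r (ltW (pw_gt0 _)) C3V).
have T2 : C2 * pw (n%:R * alpha) * (C3 * (pw (q%:R * (1 - alpha)) * pw (n%:R * (3 * eps))))
    <= K / 2 * pw (n%:R * D).
  have -> : C2 * pw (n%:R * alpha) * (C3 * (pw (q%:R * (1 - alpha)) * pw (n%:R * (3 * eps)))) =
    C2 * C3 * (pw (n%:R * alpha + (q%:R * (1 - alpha) + n%:R * (3 * eps)))).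
    by rewrite !pwD; ring.
  apply: ler_pM; rewrite ?mulr_ge0 ?(ltW (pw_gt0 _))//.
    rewrite ler_pdivlMr// mulrC lerDl ltW//.
  apply: pw_le.
  have nh : n%:R / h%:R <= n%:R * eta by rewrite ler_wpM2l.
  have q1 : q%:R * (1 - alpha) <= n%:R * eta.
    apply: (@le_trans _ _ q%:R); last exact: le_trans nh.
    by rewrite ler_piMr//; lra.
  have e3 : n%:R * eps <= n%:R * eta.
    rewrite ler_wpM2l// /eps ler_pdivrMr// ler_peMr ?(ltW e0)// ler1n//.
  have nD : n%:R * (alpha + 4 * eta) <= n%:R * D by rewrite ler_wpM2l.
  lra.
by have := lerD T1 T2; lra.
Qed.

Lemma limn_esup_le_eventually (u : nat -> \bar R) (l : \bar R) (n0 : nat) :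
  (forall n, (n0 <= n)%N -> (u n <= l)%E) -> (limn_esup u <= l)%E.
Proof.
move=> ul; rewrite limn_esup_lim; apply: lime_le.
  exact: is_cvg_esups.
near=> n; apply: ge_ereal_sup => _ /= [k nk <-]; apply: ul.
by apply: leq_trans nk; near: n; exact: nbhs_infty_ge.
Unshelve. all: by end_near. Qed.

(** The constant contributes [ln K / (n * ln M)] to the quotient, which is eventually
    at most [eta]. *)
Lemma upper_minkowski_dim_le (A : set R) (D eta K : R) : 0 < eta -> 0 < K ->
  (forall n, (mesh_count A M n)%:R <= K * (M ^ n)%:R `^ D) ->
  (upper_minkowski_dim M A <= (D + eta)%:E)%E.
Proof.
move=> e0 K0 HK.
have lM : 0 < ln M%:R :> R by rewrite ln_gt0// ltr1n.
pose n0 := (Num.truncn (ln K / (eta * ln M%:R))).+1.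
apply: (@limn_esup_le_eventually _ _ n0) => n n0n.
have n_gt0 : 0 < n%:R :> R by rewrite ltr0n; apply: leq_trans n0n.
have nlM : 0 < n%:R * ln M%:R :> R by rewrite mulr_gt0.
have nK : ln K <= n%:R * (eta * ln M%:R).
  rewrite -ler_pdivrMr ?mulr_gt0// ltW//; apply: lt_le_trans (truncnS_gt _) _.
  by rewrite ler_nat.
have [N0|N0] := posnP (mesh_count A M n).
  by rewrite N0 le0_lneNy// inver gt_eqF// mulNyr gtr0_sg ?invr_gt0// mul1e leNye.
rewrite lne_EFin ?ltr0n// inver gt_eqF// -EFinM lee_fin ler_pdivrMr//.
have N0r : 0 < (mesh_count A M n)%:R :> R by rewrite ltr0n.
apply: (@le_trans _ _ (ln (K * (M ^ n)%:R `^ D))).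
  by rewrite ler_ln ?posrE ?mulr_gt0 ?powR_gt0// ltr0n expn_gt0; lia.
rewrite lnM ?posrE ?powR_gt0// ?ltr0n ?expn_gt0; last by lia.
rewrite powR_size ln_powR.
have -> : (D + eta) * (n%:R * ln M%:R) = n%:R * (eta * ln M%:R) + n%:R * D * ln M%:R by ring.
by rewrite lerD2r.
Qed.

End growth.

Section regular_paths.
Context {R : realType} {d : measure_display} {T : measurableType d}.
Variables (P : probability T R) (alpha : R) (B : R -> {RV P >-> R}) (M : nat).
Hypothesis alpha01 : 0 < alpha < 1.
Hypothesis M_ge2 : (2 <= M)%N.

(** Everything is deterministic here: outside the two upper limits, the recursion
    for mesh counts holds at all large levels with [q = n %/ h] and
    [eps = eta / h], for every [A] at once. *)
Lemma regular_path_monotone_dim (eta : R) (h k : nat) (w : T) (A : set R) :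
  0 < eta <= 1 -> eta < alpha -> (0 < h)%N -> h%:R^-1 <= eta ->
  {within `[0, 1], continuous (fun t => B t w)} ->
  ~ lim_sup_set (rough_event alpha B M (eta / h%:R)) w ->
  ~ lim_sup_set (crowded_event alpha B M (eta / h%:R) h k) w ->
  A `<=` `[0, 1] ->
  (forall s t, A s -> A t -> s <= t -> B s w <= B t w) ->
  (upper_minkowski_dim M A <= (Num.max (1 - alpha) alpha + 5 * eta)%:E)%E.
Proof.
move=> /andP[e0 e1] ea h0 he cB nrough ncrowded A01 mono.
have /andP[a0 a1] := alpha01.
set eps := eta / h%:R in nrough ncrowded.
have h0r : 0 < h%:R :> R by rewrite ltr0n.
have eps0 : 0 < eps by rewrite divr_gt0.
have epsa : eps < alpha.
  apply: le_lt_trans ea; rewrite ler_pdivrMr// ler_peMr ?(ltW e0)// ler1n//.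
pose beta := alpha - eps; have beta0 : 0 < beta by rewrite subr_gt0.
have N0 n : 0 < (M ^ n)%:R :> R by rewrite ltr0n expn_gt0; lia.
have N1 n : 1 <= (M ^ n)%:R :> R by rewrite ler1n expn_gt0; lia.
have eventually (F : nat -> set T) : ~ lim_sup_set F w ->
    exists n0, forall n, (n0 <= n)%N -> ~ F n w.
  move=> nF; apply: contrapT => nex; apply: nF => n _.
  apply: contrapT => nFn; apply: nex; exists n => m nm Fm.
  by apply: nFn; exists m.
have [n0 Hrough] := eventually _ nrough.
have [n1 Hcrowded] := eventually _ ncrowded.
pose b t := B t w.
have rough n p : (n0 <= n)%N -> (p < M ^ n)%N ->
    `|b (mesh_time (M ^ n) p.+1) - b (mesh_time (M ^ n) p)| <= (M ^ n)%:R `^ (- beta).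
  move=> n0n pn; rewrite leNgt opprB; apply/negP => H.
  apply: (Hrough n n0n); rewrite /rough_event -bigcup_mkord.
  by exists p.
have osc := oscillation_bound M_ge2 beta0 cB rough.
set C1 := chaining_constant M beta in osc.
have [cmax _ Hmax] := EVT_max (ler01 : 0 <= 1 :> R) cB.
have [cmin _ Hmin] := EVT_min (ler01 : 0 <= 1 :> R) cB.
pose Cb := `|b cmax| + `|b cmin|.
have Cb_bound t : 0 <= t <= 1 -> `|b t| <= Cb.
  move=> t01; have tI : t \in `[0, 1] by rewrite in_itv.
  have := Hmax t tI; have := Hmin t tI; rewrite -/(b t) -/(b cmax) -/(b cmin).
  have := ler_norm (b cmax); have := ler_norm (- b cmin); rewrite normrN.
  have := normr_ge0 (b cmax); have := normr_ge0 (b cmin).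
  rewrite /Cb ler_norml => *; apply/andP; split; lra.
have Cb0 : 0 <= Cb by rewrite addr_ge0.
have [n2 Hn2] := mesh_power_unbounded M_ge2 (2 * C1 + 1) eps0.
have [K K0 HK] : exists2 K : R, 0 < K & forall n,
    (mesh_count A M n)%:R <= K * (M ^ n)%:R `^ (Num.max (1 - alpha) alpha + 4 * eta).
  apply: (@recursive_growth _ _ M_ge2 alpha eta (2 * Cb + 1) (2 * k%:R) h
    (maxn n0 (maxn n1 n2))) => //.
  - by rewrite e0.
  - by rewrite addr_ge0// mulr_ge0.
  - by move=> n; rewrite /mesh_count (leq_trans (max_card _))// card_ord.
  move=> n; rewrite !geq_max => /and3P[n0n n1n n2n].
  set q := (n %/ h)%N; have qn : (q <= n)%N by exact: leq_div.
  have rad_large : (2 * C1 + 1) * (M ^ n)%:R `^ (- beta) <= return_radius alpha M eps n.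
    have -> : return_radius alpha M eps n = (M ^ n)%:R `^ eps * (M ^ n)%:R `^ (- beta).
      rewrite /return_radius -powRD; last by rewrite (gt_eqF (N0 n)) implybT.
      by congr (_ `^ _); rewrite /beta; ring.
    by rewrite ler_wpM2r ?powR_ge0// Hn2.
  have uncrowded p : (p < M ^ n)%N ->
      (points_above (close_mesh b M n (return_radius alpha M eps n) p) (M ^ q) 0 <
        k * return_bound alpha M eps h n)%N.
    move=> pn; rewrite ltnNge; apply/negP => H.
    apply: (Hcrowded n n1n); rewrite /crowded_event -bigcup_mkord.
    by exists p.
  have := @mesh_count_recursion _ b M A M_ge2 A01 mono n q beta C1 Cb _ _ qn
    Cb_bound (fun p t => @osc n p t n0n) rad_large uncrowded.
  rewrite -(ler_nat R) natrM natrD => /le_trans; apply.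
  apply: ler_pM => //.
    rewrite lerD2l -natr1 [leRHS]mulrDl mul1r; apply: lerD.
      apply: (@le_trans _ _ (2 * Cb * (M ^ n)%:R `^ beta)).
        by rewrite truncn_le !mulr_ge0// powR_ge0.
      rewrite ler_wpM2l ?mulr_ge0//; apply: ler_powR => //.
      by rewrite /beta gerBl ltW.
    by rewrite -[leLHS](powRr0 (M ^ n)%:R); apply: ler_powR => //; exact: ltW.
  rewrite natrM (mulrC 2) -mulrA ler_wpM2l// /return_bound -/q -natr1.
  set Y := _ * _.
  have Y1 : 1 <= Y.
    have b0 : 0 <= 1 - alpha by rewrite subr_ge0 ltW.
    have c0 : 0 <= 3 * eps by rewrite mulr_ge0// ltW.
    rewrite -[leLHS]mulr1; apply: ler_pM => //.
      by rewrite -[leLHS](powRr0 (M ^ q)%:R); apply: ler_powR.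
    by rewrite -[leLHS](powRr0 (M ^ n)%:R); apply: ler_powR.
  have : (Num.truncn Y)%:R <= Y by rewrite truncn_le; lra.
  rewrite /eps; lra.
have := upper_minkowski_dim_le M_ge2 e0 K0 HK.
by rewrite -addrA -[X in 4 * eta + X]mul1r -mulrDl natr1.
Qed.

End regular_paths.

Theorem corollary1p4 (R : realType) (d : measure_display)
    (T : measurableType d) (P : probability T R)
    (alpha : R) (B : R -> {RV P >-> R}) (M : nat)
    (alpha01 : 0 < alpha < 1)
    (fbmB : fractional_brownian_motion alpha `[0, 1] B)
    (M_ge2 : (2 <= M)%N) :
  P.-negligible [set w : T | exists A : set R,
    [/\ A `<=` `[0, 1],
        ((Num.max (1 - alpha) alpha)%:E < upper_minkowski_dim M A)%E &
        forall s t : R, A s -> A t -> s <= t -> B s w <= B t w]].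
Proof.
have /andP[a0 a1] := alpha01.
(* The loss [eta j] tends to 0. The choice of [h] makes a step of [n %/ h] levels at
   most the proportion [eta j] of [n], and [k] is the order of the moment that makes
   the union bound summable. *)
pose eta j : R := alpha / j.+2%:R.
pose h j := (Num.truncn (eta j)^-1).+1.
pose eps j : R := eta j / (h j)%:R.
pose k j := (Num.truncn (2 / eps j)).+1.
have eta0 j : 0 < eta j by rewrite divr_gt0.
have eps0 j : 0 < eps j by rewrite divr_gt0.
have eta_lt j : eta j < alpha.
  by rewrite ltr_pdivrMr// ltr_pMr// ltr1n.
have eta_le1 j : eta j <= 1 by apply: ltW; apply: lt_trans a1.
have hj j : (h j)%:R^-1 <= eta j.
  by rewrite invf_ple ?posrE// ltW// truncnS_gt.
have kj j : 2 <= eps j * (k j)%:R.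
  by rewrite mulrC -ler_pdivrMr// ltW// truncnS_gt.
pose exceptional j := lim_sup_set (rough_event alpha B M (eps j)) `|`
  lim_sup_set (crowded_event alpha B M (eps j) (h j) (k j)).
have exc0 : P.-negligible (\bigcup_j exceptional j).
  apply: negligible_bigcup => j; apply: negligibleU.
    exact: rough_events_negligible.
  exact: crowded_events_negligible.
apply: negligibleS (negligibleU (fbm_continuous fbmB) exc0).
move=> w [A [A01 dimA mono]]; apply: contrapT => /not_orP[/contrapT cB nexc].
move: dimA; apply/negP; rewrite -leNgt; apply/lee_addgt0Pr => e e0.
pose j := Num.truncn (5 * alpha / e).
have ej : 5 * eta j <= e.
  rewrite mulrA ler_pdivrMr// [leRHS]mulrC -ler_pdivrMr// ltW//.
  by apply: lt_trans (truncnS_gt _) _; rewrite ltr_nat.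
have [nrough ncrowded] : ~ lim_sup_set (rough_event alpha B M (eps j)) w /\
    ~ lim_sup_set (crowded_event alpha B M (eps j) (h j) (k j)) w.
  by split=> ?; apply: nexc; exists j => //; [left|right].
have eta01 : 0 < eta j <= 1 by rewrite eta0 eta_le1.
apply: le_trans (regular_path_monotone_dim alpha01 M_ge2 eta01 (eta_lt j)
  (ltn0Sn _) (hj j) cB nrough ncrowded A01 mono) _.
by rewrite -EFinD lee_fin lerD2l.
Qed.
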